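(* For each classical Lie algebra and each index $i$ with $i$ arbitrary (type $A_r$), $i=1$ (type $B_r$), $i=r$ (type $C_r$), $i\in\{1,r-1,r\}$ (type $D_r$), each $t\in\mathbb C$ and each $w\in{}^{\mathfrak l}W$, the infinite-dimensional transfer matrix factorises as $T^+_{w,t\omega_i}(x)=\mathrm{ch}^+_{w,t\omega_i}\cdot Q^+_{w,t\omega_i}(x)\,Q^-_{w,t\omega_i}(x)$, where $\mathrm{ch}^+$ is the trace of the $x$-independent twist and $Q^\pm$ are the $Q$-operators built from degenerate Lax matrices. Explicitly (with the notation of the context), for all $t\in\mathbb C$: (A) For $\mathfrak{gl}_n$, $n\ge2$, $1\le a<n$, $I\in\mathcal S_a$: $$T^+_{I,t}(x)=\mathrm{ch}^+_{I,t}\cdot Q_I(x+t)\,Q_{\bar I}(x-a).$$ (C) For $\mathfrak{sp}_{2r}$, $r\ge1$, $\vec\mu\in\{\pm1\}^r$: $$T^+_{\vec\mu,t}(x)=\mathrm{ch}^+_{\vec\mu,t}\cdot Q_{\vec\mu}(x+t)\,Q_{-\vec\mu}(x-t-r-1).$$ (D, spinorial) For $\mathfrak{so}_{2r}$, $r\ge2$, $\vec\mu\in\{\pm1\}^r$: $$T^+_{\vec\mu,t}(x)=\mathrm{ch}^+_{\vec\mu,t}\cdot Q_{\vec\mu}(x+t)\,Q_{-\vec\mu}(x-t-r+1).$$ (BD, first fundamental) For $\mathfrak{so}_K$, $K\ge5$, $r=\lfloor K/2\rfloor$, $1\le k\le r$: $$T^+_{k,t}(x)=\mathrm{ch}^+_{k,t}\cdot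 Q_k\!\left(x-1+\tfrac t2+\tfrac K4\right)Q_{k'}\!\left(x-\tfrac t2-\tfrac K4\right),$$ $$T^+_{k',t}(x)=\mathrm{ch}^+_{k',t}\cdot Q_{k'}\!\left(x-1+\tfrac t2+\tfrac K4\right)Q_{k}\!\left(x-\tfrac t2-\tfrac K4\right).$$
   Context: General conventions. $e_{ij}$ are matrix units; $\mathrm I_m$ is the identity matrix; $N\ge0$ is a fixed integer. Twist parameters are $\tau_i=e^{x_i}$, $\tau_i^s:=e^{sx_i}$, in the domain where the traces converge: $|\tau_1|>\dots>|\tau_n|$ for $\mathfrak{gl}_n$, $|\tau_1|>\dots>|\tau_r|>1$ for $\mathfrak{sp}_{2r},\mathfrak{so}_{2r},\mathfrak{so}_{2r+1}$. For a matrix $L(x)$ with entries in an algebra acting on $\mathsf F$, $L(x)\otimes\cdots\otimes L(x)$ ($N$ factors) means $\sum e_{i_1j_1}\otimes\cdots\otimes e_{i_Nj_N}\,L(x)_{i_1j_1}\cdots L(x)_{i_Nj_N}$, and traces are over $\mathsf F$. An oscillator algebra is generated by pairs $(\mathbf a_p,\bar{\mathbf a}_p)$ with $[\mathbf a_p,\bar{\mathbf a}_q]=\delta_{pq}$, other commutators of generators zero; its Fock module $\mathsf F$ has basis the monomials in the $\bar{\mathbf a}_p$ applied to $|0\rangle$, $\mathbf a_p|0\rangle=0$. Normalized trace: $\widehat{\mathrm{tr}}_D(X)=\mathrm{tr}(DX)/\mathrm{tr}(D)$; for the twists $D$ below and $X$ in the oscillator algebra this is a rational function of the $\tau_i$,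 and $Q$-operators are understood as such (so that substitutions in the $\tau_i$ make sense). ${}^{\mathfrak l}W$ is the set of shortest representatives of $W/W_{\mathfrak l}$, with $W$ the Weyl group and $W_{\mathfrak l}$ generated by the simple reflections $s_{\alpha_j}$, $j\ne i$; it is in bijection with the index sets below (in the spinorial $D$ case, even resp. odd $\vec\mu$ correspond to $i=r$ resp. $i=r-1$, and the parameter $t$ below corresponds to the weight $2t\omega_i$). (A) Oscillators $\mathbf a_{j,i},\bar{\mathbf a}_{i,j}$, $1\le i\le a<j\le n$; $\bar{\mathbf A}=(\bar{\mathbf a}_{i,j})$ ($a\times(n-a)$), $\mathbf A=(\mathbf a_{j,i})$ ($(n-a)\times a$). $$\mathcal L_a(x)=\begin{pmatrix}(x+t)\mathrm I_a-\bar{\mathbf A}\mathbf A&-\bar{\mathbf A}(t+a-\mathbf A\bar{\mathbf A})\\-\mathbf A&(x-a)\mathrm I_{n-a}+\mathbf A\bar{\mathbf A}\end{pmatrix}.$$ $\mathcal S_a$: $a$-element subsets of $\{1,\dots,n\}$. For $I=\{i_1<\dots<i_a\}$, $\bar I=\{1,\dots,n\}\setminus I=\{j_1<\dots<j_{n-a}\}$: $\sigma_I(c)=i_c$ for $c\le a$, $\sigma_I(c)=j_{c-a}$ for $c>a$; $B_I=\sum_ie_{\sigma_I(i),i}$. $\mathcal L_I(x)$ is $B_I\mathcal L_a(x)B_I^{-1}$ with $\bar{\mathbf a}_{i,j}\mapsto-\mathbf a_{j,i}$, $\mathbf a_{j,i}\mapsto\bar{\mathbf a}_{i,j}$ applied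 for those $i\le a<j$ with $\sigma_I(j)<\sigma_I(i)$; $\mathcal L_I(x)=x\mathrm I_n+\sum e_{ij}\mathcal E^I_{ji}$. $T^+_{I,t}(x)=\mathrm{tr}\prod_{i=1}^n\tau_i^{\mathcal E^I_{ii}}\,\mathcal L_I(x)\otimes\cdots\otimes\mathcal L_I(x)$ and $\mathrm{ch}^+_{I,t}=\mathrm{tr}\prod_i\tau_i^{\mathcal E^I_{ii}}=\prod_{i\in I}\tau_i^t\prod_{i\in I,j\in\bar I}\frac{(-1)^{\delta_{i>j}}\tau_i}{\tau_i-\tau_j}$. For any proper nonempty $I\subset\{1,\dots,n\}$, using oscillators $(\mathbf a_{j,i},\bar{\mathbf a}_{i,j})_{i\in I,j\in\bar I}$, let $$L_I(x)=\Big(\mathrm I_n+\sum_{i\in I,j\in\bar I}(\bar{\mathbf a}_{i,j}\delta_{i<j}+\mathbf a_{j,i}\delta_{i>j})e_{ij}\Big)\Big(x\sum_{i\in I}e_{ii}+\sum_{j\in\bar I}e_{jj}\Big)\Big(\mathrm I_n+\sum_{i\in I,j\in\bar I}(\bar{\mathbf a}_{i,j}\delta_{j<i}-\mathbf a_{j,i}\delta_{j>i})e_{ji}\Big),$$ $D_I=\prod_{i\in I,j\in\bar I,i<j}(\tau_j/\tau_i)^{\bar{\mathbf a}_{i,j}\mathbf a_{j,i}}\prod_{i\in I,j\in\bar I,i>j}(\tau_i/\tau_j)^{\mathbf a_{j,i}\bar{\mathbf a}_{i,j}}$, and $Q_I(x)=\widehat{\mathrm{tr}}_{D_I}(L_I(x)\otimes\cdots\otimes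 L_I(x))$. (C) $i'=2r+1-i$. Oscillators $\mathbf a_{j',i},\bar{\mathbf a}_{i,j'}$, $1\le i\le j\le r$. $\bar{\mathbf A}$: rows $i=1,\dots,r$, columns labelled $r',\dots,1'$ left to right, $(i,j')$ entry $\bar{\mathbf a}_{i,j'}$ if $i<j$, $2\bar{\mathbf a}_{i,i'}$ if $i=j$, $\bar{\mathbf a}_{j,i'}$ if $i>j$. $\mathbf A$: rows labelled $r',\dots,1'$ top to bottom, columns $1,\dots,r$, $(j',i)$ entry $\mathbf a_{j',i}$ if $i\le j$, $\mathbf a_{i',j}$ if $i>j$. $$\mathcal L(x)=\begin{pmatrix}(x+t)\mathrm I_r-\bar{\mathbf A}\mathbf A&-\bar{\mathbf A}(2t+r+1-\mathbf A\bar{\mathbf A})\\-\mathbf A&(x-t-r-1)\mathrm I_r+\mathbf A\bar{\mathbf A}\end{pmatrix},\quad L_{(+,\dots,+)}(x)=\begin{pmatrix}x\mathrm I_r-\bar{\mathbf A}\mathbf A&\bar{\mathbf A}\\-\mathbf A&\mathrm I_r\end{pmatrix}.$$ $B_i=e_{ii'}-e_{i'i}+\sum_{j\le r,j\ne i}(e_{jj}+e_{j'j'})$, $B_{\vec\mu}=\prod_{j:\mu_j=-1}B_j$. $\mathcal L_{\vec\mu}(x)$ is $B_{\vec\mu}\mathcal L(x)B_{\vec\mu}^{-1}$ with $\bar{\mathbf a}_{i,j'}\mapsto-\mathbf a_{j',i}$, $\mathbf a_{j',i}\mapsto\bar{\mathbf a}_{i,j'}$ applied for those $i\le j$ with $\mu_i=-1$;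 $\mathcal L_{\vec\mu}(x)=x\mathrm I_{2r}+\sum e_{ij}\mathcal F^{\vec\mu}_{ji}$; $T^+_{\vec\mu,t}(x)=\mathrm{tr}\prod_{i=1}^r\tau_i^{\mathcal F^{\vec\mu}_{ii}}\,\mathcal L_{\vec\mu}(x)\otimes\cdots\otimes\mathcal L_{\vec\mu}(x)$; with $\delta^-_{\mu}=1$ if $\mu=-1$ and $0$ otherwise, $$\mathrm{ch}^+_{\vec\mu,t}=\mathrm{tr}\prod_{i=1}^r\tau_i^{\mathcal F^{\vec\mu}_{ii}}=\frac{\prod_{i=1}^r\tau_i^{\mu_i(t+(r-i+1)\delta^-_{\mu_i}+\sum_{k=1}^i\delta^-_{\mu_k})}}{\prod_{1\le i\le j\le r}(1-\tau_i^{-1}\tau_j^{-\mu_i\mu_j})}.$$ $D_{(+,\dots,+)}=\prod_{1\le i\le j\le r}(\tau_i\tau_j)^{-\bar{\mathbf a}_{i,j'}\mathbf a_{j',i}}$, $Q_{(+,\dots,+)}(x)=\widehat{\mathrm{tr}}_{D_{(+,\dots,+)}}(L_{(+,\dots,+)}(x)\otimes\cdots\otimes L_{(+,\dots,+)}(x))$, and $Q_{\vec\mu}(x)=B_{\vec\mu}^{\otimes N}Q_{(+,\dots,+)}(x)(B_{\vec\mu}^{\otimes N})^{-1}$ with $\tau_i$ replaced by $\tau_i^{-1}$ for all $i$ with $\mu_i=-1$. (D, spinorial) $i'=2r+1-i$; oscillators $\mathbf a_{j',i},\bar{\mathbf a}_{i,j'}$, $1\le i<j\le r$. Same labelling of rows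 and columns as in (C), with $(i,j')$ entry of $\bar{\mathbf A}$ equal to $\bar{\mathbf a}_{i,j'}$ ($i<j$), $0$ ($i=j$), $-\bar{\mathbf a}_{j,i'}$ ($i>j$), and $(j',i)$ entry of $\mathbf A$ equal to $\mathbf a_{j',i}$ ($i<j$), $0$ ($i=j$), $-\mathbf a_{i',j}$ ($i>j$). $$\mathcal L(x)=\begin{pmatrix}(x+t)\mathrm I_r-\bar{\mathbf A}\mathbf A&-\bar{\mathbf A}(2t+r-1-\mathbf A\bar{\mathbf A})\\-\mathbf A&(x-t-r+1)\mathrm I_r+\mathbf A\bar{\mathbf A}\end{pmatrix},\quad L_{(+,\dots,+)}(x)=\begin{pmatrix}x\mathrm I_r-\bar{\mathbf A}\mathbf A&\bar{\mathbf A}\\-\mathbf A&\mathrm I_r\end{pmatrix}.$$ $B_i=e_{ii'}+e_{i'i}+\sum_{j\le r,j\ne i}(e_{jj}+e_{j'j'})$, $B_{\vec\mu}=\prod_{j:\mu_j=-1}B_j$; $\mathcal L_{\vec\mu}(x)$ is $B_{\vec\mu}\mathcal L(x)B_{\vec\mu}^{-1}$ with $\bar{\mathbf a}_{i,j'}\mapsto-\mathbf a_{j',i}$, $\mathbf a_{j',i}\mapsto\bar{\mathbf a}_{i,j'}$ for those $i<j$ with $\mu_i=-1$; $\mathcal F^{\vec\mu}_{ij}$ and $T^+_{\vec\mu,t}(x)$ are defined by the same formulas as in (C), and $$\mathrm{ch}^+_{\vec\mu,t}=\mathrm{tr}\prod_{i=1}^r\tau_i^{\mathcal F^{\vec\mu}_{ii}}=\frac{\prod_{i=1}^r\tau_i^{\mu_i(t+(r-i-1)\delta^-_{\mu_i}+\sum_{k=1}^i\delta^-_{\mu_k})}}{\prod_{1\le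 i<j\le r}(1-\tau_i^{-1}\tau_j^{-\mu_i\mu_j})}.$$ $D_{(+,\dots,+)}=\prod_{1\le i<j\le r}(\tau_i\tau_j)^{-\bar{\mathbf a}_{i,j'}\mathbf a_{j',i}}$; $Q_{(+,\dots,+)}(x)$ and $Q_{\vec\mu}(x)$ are defined by the same formulas as in (C). (BD, first fundamental) $i'=K+1-i$. Oscillators $\mathbf a_i,\bar{\mathbf a}_i$, $2\le i\le K-1$; $\bar{\mathbf w}=(\bar{\mathbf a}_2,\dots,\bar{\mathbf a}_{K-1})$, $\mathbf w=(\mathbf a_2,\dots,\mathbf a_{K-1})^T$; $\mathrm J$ is the antidiagonal $(K-2)\times(K-2)$ matrix of ones, $\mathrm I=\mathrm I_{K-2}$. With $u=x-1+\frac t2+\frac K4$, $v=x-\frac t2-\frac K4$, $$\mathcal L(x)=\begin{pmatrix}1&\bar{\mathbf w}&-\frac12\bar{\mathbf w}\mathrm J\bar{\mathbf w}^T\\0&\mathrm I&-\mathrm J\bar{\mathbf w}^T\\0&0&1\end{pmatrix}\begin{pmatrix}u(u-\frac K2+2)&0&0\\-\mathbf wu&uv\,\mathrm I&0\\-\frac12\mathbf w^T\mathrm J\mathbf w&\mathbf w^T\mathrm Jv&v(v-\frac K2+2)\end{pmatrix}\begin{pmatrix}1&-\bar{\mathbf w}&-\frac12\bar{\mathbf w}\mathrm J\bar{\mathbf w}^T\\0&\mathrm I&\mathrm J\bar{\mathbf w}^T\\0&0&1\end{pmatrix}.$$ For $k\in\{1,\dots,r\}\cup\{r',\dots,1'\}$: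 $\hat B_1=\mathrm I_K$; $\hat B_k=e_{1k}+e_{k1}+e_{1'k'}+e_{k'1'}+\sum_{1<j<1',\,j\ne k,k'}e_{jj}$ for $1<k\le r$; $\hat B_k=e_{1k}+e_{k1}+e_{1'k'}+e_{k'1'}+\sum_{1<j<1',\,j\ne k,k'}e_{jj'}$ for $r'\le k<1'$; $\hat B_{1'}=\sum_je_{jj'}$. $\mathcal L_k(x)$ is $\hat B_k\mathcal L(x)\hat B_k^{-1}$ with $\bar{\mathbf a}_j\mapsto-\mathbf a_j$, $\mathbf a_j\mapsto\bar{\mathbf a}_j$ applied for $1<j\le k$ if $k\le r$ and for $k'<j<1'$ if $k\ge r'$. $\mathcal F^k_{ij}$ is the coefficient of $x^1$ in $\mathcal L_k(x)_{ji}$; $T^+_{k,t}(x)=\mathrm{tr}\prod_{i=1}^r\tau_i^{\mathcal F^k_{ii}}\,\mathcal L_k(x)\otimes\cdots\otimes\mathcal L_k(x)$ and $\mathrm{ch}^+_{k,t}=\mathrm{tr}\prod_{i=1}^r\tau_i^{\mathcal F^k_{ii}}$. The degenerate Lax matrix is $$L_1(x)=\begin{pmatrix}x^2+x(2-\frac K2-\bar{\mathbf w}\mathbf w)+\frac14\bar{\mathbf w}\mathrm J\bar{\mathbf w}^T\mathbf w^T\mathrm J\mathbf w&x\bar{\mathbf w}-\frac12\bar{\mathbf w}\mathrm J\bar{\mathbf w}^T\mathbf w^T\mathrm J&-\frac12\bar{\mathbf w}\mathrm J\bar{\mathbf w}^T\\-x\mathbf w+\frac12\mathrm J\bar{\mathbf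 w}^T\mathbf w^T\mathrm J\mathbf w&x\mathrm I-\mathrm J\bar{\mathbf w}^T\mathbf w^T\mathrm J&-\mathrm J\bar{\mathbf w}^T\\-\frac12\mathbf w^T\mathrm J\mathbf w&\mathbf w^T\mathrm J&1\end{pmatrix},$$ $D_1=\tau_1^{-\sum_{\ell=2}^{K-1}\bar{\mathbf a}_\ell\mathbf a_\ell}\prod_{i=2}^r\tau_i^{\bar{\mathbf a}_i\mathbf a_i-\bar{\mathbf a}_{i'}\mathbf a_{i'}}$, $Q_1(x)=\widehat{\mathrm{tr}}_{D_1}(L_1(x)\otimes\cdots\otimes L_1(x))$. For $1\le k\le r$, $Q_k(x)$ is $\hat B_k^{\otimes N}Q_1(x)(\hat B_k^{\otimes N})^{-1}$ with $\tau_1$ and $\tau_k$ interchanged; for $r'\le k\le1'$, $Q_k(x)$ is $\hat B_k^{\otimes N}\,Q_1(x)|_{\tau_i\mapsto\tau_i^{-1}\,\forall i}\,(\hat B_k^{\otimes N})^{-1}$ with then $\tau_1$ and $\tau_{k'}$ interchanged. *)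

(* Defs.v *)
From HB Require Import structures.
From mathcomp Require Import all_boot all_order all_algebra finmap.
From mathcomp Require Import perm complex.
From mathcomp Require Import boolp classical_sets functions reals topology.
From mathcomp Require Import normedtype sequences exp trigo.
From mathcomp.analysis.showcase Require Import summability.
(* The notations of [mpoly] clash with those of the analysis library. *)
From mathcomp Require Import -(notations) mpoly.

Set Implicit Arguments.
Unset Strict Implicit.
Unset Printing Implicit Defensive.

Import Order.TTheory GRing.Theory Num.Theory.
Import numFieldNormedType.Exports.
Local Open Scope classical_set_scope.
Local Open Scope ring_scope.

(* Conventions.  Indices are 0-based: the index i of the formulas is the
   ordinal of value i - 1, so that i' is [rev_ord i]; diagonal blocks of size
   r and r make up a matrix of size r + r.  The twist parameters are given by
   their logarithms th, i.e. tau_i = expC (th i). *)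

Section Exponential.
Variable R : realType.

Definition expC (z : R[i]) : R[i] :=
  let: (a +i* b)%C := z in (expR a)%:C%C * (cos b +i* sin b)%C.

Definition tau_of r (th : 'I_r -> R[i]) : 'I_r -> R[i] := fun i => expC (th i).

Definition gl_domain r (th : 'I_r -> R[i]) : Prop :=
  forall i j : 'I_r, (i < j)%N -> `|tau_of th j| < `|tau_of th i|.

(* |tau_1| > ... > |tau_r| > 1; the last inequality then holds for every i. *)
Definition cl_domain r (th : 'I_r -> R[i]) : Prop :=
  gl_domain th /\ forall i : 'I_r, 1 < `|tau_of th i|.

End Exponential.

(* The Fock module of the oscillator pairs (a_j, abar_j), j : J, is the
   polynomial algebra in the abar_j: the monomials applied to the vacuum
   |0> = 1 form its basis, abar_j acts by multiplication and a_j by d/d(abar_j),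
   so that a_j |0> = 0 and [a_p, abar_q] = delta_pq. *)
Section Fock.
Variables (R : realType) (J : finType).

Definition fock := mpoly #|J| R[i].
HB.instance Definition _ := GRing.Lmodule.on fock.

(* End(F); the oscillator algebra acts faithfully, so computations take place
   in this ring. *)
Record fock_end := FockEnd {
  fock_fun :> fock -> fock;
  _ : `[< linear fock_fun >] }.
HB.instance Definition _ := [isSub for fock_fun].
HB.instance Definition _ := [Choice of fock_end by <:].

Lemma fock_end_linear (f : fock_end) : linear f.
Proof. by apply/asboolP; case: f. Qed.

Definition mk_fock_end (f : fock -> fock) (lin_f : linear f) : fock_end :=
  FockEnd (asboolT lin_f).

Lemma fock_endP (f g : fock_end) : (forall v, f v = g v) -> f = g.
Proof. by move=> fg; apply: val_inj; apply/funext. Qed.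

Fact fend0_linear : linear (fun _ : fock => 0 : fock).
Proof. by move=> c u v; rewrite scaler0 addr0. Qed.
Fact fend1_linear : linear (fun v : fock => v).
Proof. by []. Qed.
Fact fendN_linear (f : fock_end) : linear (fun v => - f v).
Proof. by move=> c u v; rewrite fock_end_linear opprD scalerN. Qed.
Fact fendD_linear (f g : fock_end) : linear (fun v => f v + g v).
Proof.
by move=> c u v; rewrite !fock_end_linear scalerDr addrACA.
Qed.
Fact fendM_linear (f g : fock_end) : linear (fun v => f (g v)).
Proof. by move=> c u v; rewrite !fock_end_linear. Qed.
Fact fendZ_linear (k : R[i]) (f : fock_end) : linear (fun v => k *: f v).
Proof.
by move=> c u v; rewrite fock_end_linear scalerDr !scalerA mulrC.
Qed.

Definition fend0 := mk_fock_end fend0_linear.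
Definition fend1 := mk_fock_end fend1_linear.
Definition fendN f := mk_fock_end (fendN_linear f).
Definition fendD f g := mk_fock_end (fendD_linear f g).
Definition fendM f g := mk_fock_end (fendM_linear f g).
Definition fendZ k f := mk_fock_end (fendZ_linear k f).

Fact fendDA : associative fendD.
Proof. by move=> f g h; apply: fock_endP => v /=; rewrite addrA. Qed.
Fact fendDC : commutative fendD.
Proof. by move=> f g; apply: fock_endP => v /=; rewrite addrC. Qed.
Fact fend0D : left_id fend0 fendD.
Proof. by move=> f; apply: fock_endP => v /=; rewrite add0r. Qed.
Fact fendND : left_inverse fend0 fendN fendD.
Proof. by move=> f; apply: fock_endP => v /=; rewrite addNr. Qed.
HB.instance Definition _ :=
  GRing.isZmodule.Build fock_end fendDA fendDC fend0D fendND.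

Fact fendMA : associative fendM.
Proof. by move=> f g h; apply: fock_endP. Qed.
Fact fend1M : left_id fend1 fendM.
Proof. by move=> f; apply: fock_endP. Qed.
Fact fendM1 : right_id fend1 fendM.
Proof. by move=> f; apply: fock_endP. Qed.
Fact fendMDl : left_distributive fendM fendD.
Proof. by move=> f g h; apply: fock_endP. Qed.
Fact fendMDr : right_distributive fendM fendD.
Proof.
move=> f g h; apply: fock_endP => v /=.
by have := fock_end_linear f 1 (g v) (h v); rewrite !scale1r.
Qed.
Fact fend1_neq0 : fend1 != 0 :> fock_end.
Proof.
apply/eqP => /(congr1 (fun f : fock_end => f (1 : mpoly #|J| R[i]))) /eqP.
by rewrite oner_eq0.
Qed.
HB.instance Definition _ := GRing.Zmodule_isNzRing.Build fock_end
  fendMA fend1M fendM1 fendMDl fendMDr fend1_neq0.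

Fact fendZA k l (f : fock_end) : fendZ k (fendZ l f) = fendZ (k * l) f.
Proof. by apply: fock_endP => v /=; rewrite scalerA. Qed.
Fact fend1Z : left_id 1 fendZ.
Proof. by move=> f; apply: fock_endP => v /=; rewrite scale1r. Qed.
Fact fendZDr : right_distributive fendZ +%R.
Proof. by move=> k f g; apply: fock_endP => v /=; rewrite scalerDr. Qed.
Fact fendZDl (f : fock_end) : {morph fendZ^~ f : k l / k + l}.
Proof. by move=> k l; apply: fock_endP => v /=; rewrite scalerDl. Qed.
HB.instance Definition _ := GRing.Zmodule_isLmodule.Build R[i] fock_end
  fendZA fend1Z fendZDr fendZDl.

Fact fendZAl k (f g : fock_end) : k *: (f * g) = (k *: f) * g.
Proof. by apply: fock_endP. Qed.
HB.instance Definition _ := GRing.Lmodule_isLalgebra.Build R[i] fock_end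
  fendZAl.

Fact fendZAr k (f g : fock_end) : k *: (f * g) = f * (k *: g).
Proof.
apply: fock_endP => v /=.
have f0 : f 0 = 0.
  have := fock_end_linear f 1 0 0; rewrite !scale1r addr0.
  by move/(congr1 (fun y => y - f 0)); rewrite subrr addrK => <-.
by have := fock_end_linear f k (g v) 0; rewrite !addr0 f0 addr0.
Qed.
HB.instance Definition _ := GRing.Lalgebra_isAlgebra.Build R[i] fock_end
  fendZAr.

Fact abar_linear (j : J) :
  linear (fun v : fock => (mpolyX R[i] (mnm1 (enum_rank j)) * v : fock)).
Proof. by move=> c u v; rewrite mulrDr scalerAr. Qed.
Definition abar (j : J) : fock_end := mk_fock_end (abar_linear j).

Definition ann (j : J) : fock_end :=
  mk_fock_end (@mderiv_is_linear #|J| R[i] (enum_rank j)).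

Definition diag_coef (X : fock_end) (m : multinom #|J|) : R[i] :=
  mcoeff m (X (mpolyX R[i] m)).

(* tau^X = e^(z X), for tau = e^z and X diagonal in the basis of monomials (all
   exponents below are); off-diagonal elements of X are not looked at. *)
Definition opexp_fun (z : R[i]) (X : fock_end) (v : fock) : fock :=
  \sum_(m <- msupp v) (mcoeff m v * expC (z * diag_coef X m)) *: mpolyX R[i] m.

Fact mcoeff_opexp z X v m :
  mcoeff m (opexp_fun z X v) = mcoeff m v * expC (z * diag_coef X m).
Proof.
rewrite /opexp_fun linear_sum /=.
under eq_bigr do rewrite mcoeffZ mcoeffX.
have [mv|mv] := boolP (m \in msupp v).
  rewrite (bigD1_seq m) //= eqxx mulr1 big1 ?addr0 // => k /negPf->.
  by rewrite mulr0.
rewrite memN_msupp_eq0 // mul0r big_seq big1 // => k kv.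
by case: eqP kv mv => [-> ->|]; rewrite ?mulr0.
Qed.

Fact opexp_linear z X : linear (opexp_fun z X).
Proof.
move=> c u v; apply/mpolyP => m.
by rewrite mcoeffD mcoeffZ !mcoeff_opexp mcoeffD mcoeffZ mulrDl mulrA.
Qed.
Definition opexp z X : fock_end := mk_fock_end (opexp_linear z X).

(* The trace is an unordered sum, so that convergence is absolute. *)
Definition trace_terms (X : fock_end) : multinom #|J| -> R[i]^o := diag_coef X.
Definition trace (X : fock_end) : R[i] := sum (trace_terms X).
Definition trace_cvg (X : fock_end) : Prop :=
  cvg (partial_sum (trace_terms X) @ totally).

(* The normalised trace tr(D X) / tr(D), as a rational function of tau: its
   value at an arbitrary point tau is p(tau)/q(tau), where p/q is any fraction
   regular at tau and representing tr(D X) / tr(D) on the domain where the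
   traces converge.  The domain is open, hence this value is unique. *)
Definition ntrace r (dom : ('I_r -> R[i]) -> Prop)
    (D : ('I_r -> R[i]) -> fock_end) (X : fock_end) (tau : 'I_r -> R[i]) :
    R[i] :=
  xget 0 [set z | exists p q : mpoly r R[i],
    [/\ meval tau q != 0,
        z = meval tau p / meval tau q
      & forall th, dom th ->
          meval (tau_of th) q != 0 /\
          trace (D th * X) / trace (D th)
            = meval (tau_of th) p / meval (tau_of th) q]].

End Fock.

(* Lax matrices have entries in {poly End(F)}, the indeterminate 'X being the
   spectral parameter x. *)
Section Lax.
Variables (R : realType).

Section Algebra.
Variable E : algType R[i].

Definition sc (k : R[i]) : {poly E} := (k%:A)%:P.

Definition eval_lax n (L : 'M[{poly E}]_n) (x : R[i]) : 'M[E]_n :=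
  map_mx (fun p => p.[x%:A]) L.

Definition conj_lax n (B : 'M[R[i]]_n) (L : 'M[{poly E}]_n) :
    'M[{poly E}]_n :=
  map_mx sc B *m L *m map_mx sc (invmx B).

(* The coefficient of x^d in L_ji (note the transposition). *)
Definition gen_lax d n (L : 'M[{poly E}]_n) (i j : 'I_n) : E := (L j i)`_d.

End Algebra.

(* L (x) ... (x) L (N factors); rows and columns are indexed by the N-tuples
   of indices, enumerated. *)
Definition tens (E : pzRingType) N n (L : 'M[E]_n) :
    'M[E]_#|{ffun 'I_N -> 'I_n}| :=
  \matrix_(p, q)
    let f : {ffun 'I_N -> 'I_n} := enum_val p in
    let g : {ffun 'I_N -> 'I_n} := enum_val q in
    \prod_(k < N) L (f k) (g k).

Section Oscillators.
Variables (T : finType) (S : {set T}).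

Definition osc := fock_end R {s : T | s \in S}.
Definition osc_bar (s : T) : osc := oapp (@abar R _) 0 (insub s).
Definition osc_ann (s : T) : osc := oapp (@ann R _) 0 (insub s).

(* The oscillators after the particle-hole transformation abar_s |-> - a_s,
   a_s |-> abar_s for the labels s in P. *)
Definition ph_bar (P : {set T}) (s : T) : osc :=
  if s \in P then - osc_ann s else osc_bar s.
Definition ph_ann (P : {set T}) (s : T) : osc :=
  if s \in P then osc_bar s else osc_ann s.

Definition number (s : T) : osc := osc_bar s * osc_ann s.

Definition twist r (th : 'I_r -> R[i]) (F : 'I_r -> osc) : osc :=
  \prod_(i < r) opexp (th i) (F i).

Definition transfer N n (W : osc) (L : 'M[{poly osc}]_n) (x : R[i]) :=
  map_mx (fun X => trace (W * X)) (tens N (eval_lax L x)).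

Definition transfer_cvg N n (W : osc) (L : 'M[{poly osc}]_n) (x : R[i]) :=
  trace_cvg W /\ forall p q, trace_cvg (W * tens N (eval_lax L x) p q).

Definition qop r (dom : ('I_r -> R[i]) -> Prop) (D : ('I_r -> R[i]) -> osc)
    N n (L : 'M[{poly osc}]_n) (x : R[i]) (tau : 'I_r -> R[i]) :=
  map_mx (fun X => ntrace dom D X tau) (tens N (eval_lax L x)).

End Oscillators.
End Lax.

Definition conj_tens (R : realType) N n (B : 'M[R[i]]_n) M :=
  tens N B *m M *m invmx (tens N B).

Section GL.
Variable R : realType.
Local Notation C := R[i].
Variable n : nat.
Implicit Types (I : {set 'I_n}) (th tau : 'I_n -> C) (t x : C).

Section Blocks.
Variables (a : 'I_n) (E : algType C).

(* The label (i, j) stands for the pair (a_{j,i}, abar_{i,j}). *)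
Definition gl_labels : {set 'I_n * 'I_n} :=
  [set p : 'I_n * 'I_n | (p.1 < a <= p.2)%N].

Let gl_dim : (a + (n - a))%N = n := subnKC (ltnW (ltn_ord a)).
Let up (i : 'I_a) : 'I_n := cast_ord gl_dim (lshift (n - a) i).
Let dn (j : 'I_(n - a)) : 'I_n := cast_ord gl_dim (rshift a j).

Definition gl_lax t (ab an : 'I_n * 'I_n -> E) : 'M[{poly E}]_n :=
  let Ab := \matrix_(i < a, j < n - a) (ab (up i, dn j))%:P in
  let A := \matrix_(j < n - a, i < a) (an (up i, dn j))%:P in
  castmx (gl_dim, gl_dim)
    (block_mx
      (('X + sc E t)%:M - Ab *m A)
        (- (Ab *m ((sc E (t + (nat_of_ord a)%:R))%:M - A *m Ab)))
      (- A) (('X - sc E (nat_of_ord a)%:R)%:M + A *m Ab)).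

End Blocks.

(* The increasing enumeration of I followed by that of its complement. *)
Definition gl_sigma I (c : 'I_n) : 'I_n := nth c (enum I ++ enum (~: I)) c.

Definition gl_B I : 'M[C]_n := \sum_i delta_mx (gl_sigma I i) i.

Definition gl_flip (a : 'I_n) I : {set 'I_n * 'I_n} :=
  [set p in gl_labels a | (gl_sigma I p.2 < gl_sigma I p.1)%N].

Definition gl_laxI (a : 'I_n) I t : 'M[{poly osc R (gl_labels a)}]_n :=
  conj_lax (gl_B I)
    (gl_lax a t (ph_bar R (gl_labels a) (gl_flip a I))
                (ph_ann R (gl_labels a) (gl_flip a I))).

Definition gl_twist (a : 'I_n) I t th : osc R (gl_labels a) :=
  twist th (fun i => gen_lax 0 (gl_laxI a I t) i i).

Definition gl_ch (a : 'I_n) I t th : C := trace (gl_twist a I t th).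

Definition gl_T N (a : 'I_n) I t x th :=
  transfer N (gl_twist a I t th) (gl_laxI a I t) x.

Definition gl_T_cvg N (a : 'I_n) I t x th : Prop :=
  transfer_cvg N (gl_twist a I t th) (gl_laxI a I t) x.

Definition gl_deg_labels I : {set 'I_n * 'I_n} :=
  finset.setX I (~: I).

Definition gl_deg_lax I : 'M[{poly osc R (gl_deg_labels I)}]_n :=
  let ab i j := (osc_bar R (gl_deg_labels I) (i, j))%:P in
  let an j i := (osc_ann R (gl_deg_labels I) (i, j))%:P in
  (1%:M + \sum_(i in I) \sum_(j in ~: I)
     (if (i < j)%N then ab i j else an j i) *: delta_mx i j)
  *m ('X *: (\sum_(i in I) delta_mx i i) + \sum_(j in ~: I) delta_mx j j)
  *m (1%:M + \sum_(i in I) \sum_(j in ~: I)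
     (if (j < i)%N then ab i j else - an j i) *: delta_mx j i).

Definition gl_D I th : osc R (gl_deg_labels I) :=
  let ab i j := osc_bar R (gl_deg_labels I) (i, j) in
  let an j i := osc_ann R (gl_deg_labels I) (i, j) in
  (\prod_(i in I) \prod_(j in ~: I | (i < j)%N)
     opexp (th j - th i) (ab i j * an j i)) *
  (\prod_(i in I) \prod_(j in ~: I | (j < i)%N)
     opexp (th i - th j) (an j i * ab i j)).

Definition gl_Q N I x tau :=
  qop (@gl_domain R n) (gl_D I) N (gl_deg_lax I) x tau.

End GL.

(* Types C and D (spinorial).  The signs mu_i = +-1 are integers. *)
Section CD.
Variable R : realType.
Local Notation C := R[i].
Variable r : nat.
Implicit Types (mu : 'I_r -> int) (th tau : 'I_r -> C) (t x : C).

Definition emb (i : 'I_r) : 'I_(r + r) := lshift r i.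
Definition emb' (i : 'I_r) : 'I_(r + r) := rev_ord (emb i).

Section Blocks.
Variable E : algType C.
Implicit Types (ab an : 'I_r * 'I_r -> E).

(* The label (i, j) stands for the pair (a_{j',i}, abar_{i,j'}).  The c-th
   column of Abar and the c-th row of A carry the label j' with
   j = rev_ord c. *)
Definition sp_Ab ab : 'M[{poly E}]_r :=
  \matrix_(i, c) let j := rev_ord c in
    (if (i < j)%N then ab (i, j)
     else if i == j then ab (i, i) *+ 2 else ab (j, i))%:P.
Definition sp_A an : 'M[{poly E}]_r :=
  \matrix_(c, i) let j := rev_ord c in
    (if (i <= j)%N then an (i, j) else an (j, i))%:P.

Definition so_Ab ab : 'M[{poly E}]_r :=
  \matrix_(i, c) let j := rev_ord c in
    (if (i < j)%N then ab (i, j)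
     else if i == j then 0 else - ab (j, i))%:P.
Definition so_A an : 'M[{poly E}]_r :=
  \matrix_(c, i) let j := rev_ord c in
    (if (i < j)%N then an (i, j)
     else if i == j then 0 else - an (j, i))%:P.

(* kap = r + 1 in type C and kap = r - 1 in type D. *)
Definition cd_lax (kap : C) t (Ab A : 'M[{poly E}]_r) : 'M[{poly E}]_(r + r) :=
  block_mx
    (('X + sc E t)%:M - Ab *m A)
      (- (Ab *m ((sc E (t *+ 2 + kap))%:M - A *m Ab)))
    (- A) (('X - sc E t - sc E kap)%:M + A *m Ab).

Definition cd_deg_lax (Ab A : 'M[{poly E}]_r) : 'M[{poly E}]_(r + r) :=
  block_mx ('X%:M - Ab *m A) Ab (- A) 1%:M.

End Blocks.

(* eps = -1 in type C and eps = 1 in type D. *)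
Definition cd_B1 (eps : C) (i : 'I_r) : 'M[C]_(r + r) :=
  delta_mx (emb i) (emb' i) + eps *: delta_mx (emb' i) (emb i)
  + \sum_(j | j != i) (delta_mx (emb j) (emb j) + delta_mx (emb' j) (emb' j)).

Definition cd_B (eps : C) mu : 'M[C]_(r + r) :=
  \big[mulmx/1%:M]_(j | mu j == -1) cd_B1 eps j.

Definition cd_flip (S : {set 'I_r * 'I_r}) mu : {set 'I_r * 'I_r} :=
  [set p in S | mu p.1 == -1].

Definition cd_tau mu tau : 'I_r -> C :=
  fun i => if mu i == -1 then (tau i)^-1 else tau i.

Section D.
Variable S : {set 'I_r * 'I_r}.
Definition cd_D th : osc R S :=
  \prod_(p in S) opexp (- (th p.1 + th p.2)) (number R S p).
End D.

Definition sp_labels : {set 'I_r * 'I_r} :=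
  [set p : 'I_r * 'I_r | (p.1 <= p.2)%N].
Definition so_labels : {set 'I_r * 'I_r} :=
  [set p : 'I_r * 'I_r | (p.1 < p.2)%N].

Definition sp_laxmu mu t : 'M[{poly osc R sp_labels}]_(r + r) :=
  conj_lax (cd_B (-1) mu)
    (cd_lax (r%:R + 1) t
       (sp_Ab (ph_bar R sp_labels (cd_flip sp_labels mu)))
       (sp_A (ph_ann R sp_labels (cd_flip sp_labels mu)))).

Definition sp_twist mu t th : osc R sp_labels :=
  twist th (fun i => gen_lax 0 (sp_laxmu mu t) (emb i) (emb i)).

Definition sp_ch mu t th : C := trace (sp_twist mu t th).

Definition sp_T N mu t x th := transfer N (sp_twist mu t th) (sp_laxmu mu t) x.

Definition sp_T_cvg N mu t x th : Prop :=
  transfer_cvg N (sp_twist mu t th) (sp_laxmu mu t) x.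

Definition sp_Qplus N x tau :=
  qop (@cl_domain R r) (cd_D sp_labels) N
    (cd_deg_lax (sp_Ab (osc_bar R sp_labels)) (sp_A (osc_ann R sp_labels)))
    x tau.

Definition sp_Q N mu x tau :=
  conj_tens (cd_B (-1) mu) (sp_Qplus N x (cd_tau mu tau)).

Definition so_laxmu mu t : 'M[{poly osc R so_labels}]_(r + r) :=
  conj_lax (cd_B 1 mu)
    (cd_lax (r%:R - 1) t
       (so_Ab (ph_bar R so_labels (cd_flip so_labels mu)))
       (so_A (ph_ann R so_labels (cd_flip so_labels mu)))).

Definition so_twist mu t th : osc R so_labels :=
  twist th (fun i => gen_lax 0 (so_laxmu mu t) (emb i) (emb i)).

Definition so_ch mu t th : C := trace (so_twist mu t th).

Definition so_T N mu t x th := transfer N (so_twist mu t th) (so_laxmu mu t) x.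

Definition so_T_cvg N mu t x th : Prop :=
  transfer_cvg N (so_twist mu t th) (so_laxmu mu t) x.

Definition so_Qplus N x tau :=
  qop (@cl_domain R r) (cd_D so_labels) N
    (cd_deg_lax (so_Ab (osc_bar R so_labels)) (so_A (osc_ann R so_labels)))
    x tau.

Definition so_Q N mu x tau :=
  conj_tens (cd_B 1 mu) (so_Qplus N x (cd_tau mu tau)).

End CD.

Definition ord_first n (k : 'I_n) : 'I_n :=
  Ordinal (leq_ltn_trans (leq0n k) (ltn_ord k)).

Lemma bd_dim K : (4 < K)%N -> (1 + (K - 2 + 1))%N = K.
Proof. by case: K => [|[|K]] // _; rewrite subSS subSS subn0 add1n addn1. Qed.

Lemma bd_half_le K : (K./2 <= K)%N.
Proof. by rewrite leq_half_double -addnn (leq_trans (leq_addr K K)). Qed.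

Section BD.
Variable R : realType.
Local Notation C := R[i].
Variables (K : nat) (hK : (4 < K)%N).
Local Notation r := (K./2).
Implicit Types (k : 'I_r) (th tau : 'I_r -> C) (t x : C).

(* The indices 1, ..., r and 1', ..., r': [bd_ix false k] is k and
   [bd_ix true k] is k'. *)
Definition bd_ix (b : bool) k : 'I_K :=
  let i := widen_ord (bd_half_le K) k in if b then rev_ord i else i.

Definition bd_labels : {set 'I_K} := [set i : 'I_K | (0 < i < K.-1)%N].

(* The index of C^K corresponding to a position in the middle block. *)
Definition bd_mid (c : 'I_(K - 2)) : 'I_K :=
  cast_ord (bd_dim hK) (rshift 1 (lshift 1 c)).

Section Blocks.
Variable E : algType C.
Local Notation PE := {poly E}.
Implicit Types (ab an : 'I_K -> E).

Definition block3 m (A11 : 'M[PE]_(1, 1)) (A12 : 'M[PE]_(1, m))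
    (A13 : 'M[PE]_(1, 1)) (A21 : 'M[PE]_(m, 1)) (A22 : 'M[PE]_(m, m))
    (A23 : 'M[PE]_(m, 1)) (A31 : 'M[PE]_(1, 1)) (A32 : 'M[PE]_(1, m))
    (A33 : 'M[PE]_(1, 1)) : 'M[PE]_(1 + (m + 1)) :=
  block_mx A11 (row_mx A12 A13) (col_mx A21 A31) (block_mx A22 A23 A32 A33).

Definition bd_wb ab : 'rV[PE]_(K - 2) := \row_c (ab (bd_mid c))%:P.
Definition bd_w an : 'cV[PE]_(K - 2) := \col_c (an (bd_mid c))%:P.
Definition bd_J : 'M[PE]_(K - 2) := \matrix_(c, d) (d == rev_ord c)%:R.

Definition bd_lax t ab an : 'M[PE]_K :=
  let wb := bd_wb ab in let w := bd_w an in let J := bd_J in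
  let half : PE := sc E (1 / 2%:R) in
  let K2 : PE := sc E (K%:R / 2%:R) in
  let u : PE := 'X + sc E (-1 + t / 2%:R + K%:R / 4%:R) in
  let v : PE := 'X - sc E (t / 2%:R + K%:R / 4%:R) in
  castmx (bd_dim hK, bd_dim hK)
   (block3 1%:M wb    (- (half *: (wb *m J *m wb^T)))
           0    1%:M  (- (J *m wb^T))
           0    0     1%:M
    *m
    block3 (u * (u - K2 + 2%:R))%:M       0                  0
           (- (w *m u%:M))                (u * v)%:M         0
           (- (half *: (w^T *m J *m w)))  (w^T *m J *m v%:M)
                                          (v * (v - K2 + 2%:R))%:M
    *m
    block3 1%:M (- wb) (- (half *: (wb *m J *m wb^T)))
           0    1%:M   (J *m wb^T)
           0    0      1%:M).

Definition bd_deg_lax ab an : 'M[PE]_K :=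
  let wb := bd_wb ab in let w := bd_w an in let J := bd_J in
  let half : PE := sc E (1 / 2%:R) in
  let quarter : PE := sc E (1 / 4%:R) in
  castmx (bd_dim hK, bd_dim hK)
   (block3
     (('X ^+ 2)%:M + 'X *: ((sc E (2%:R - K%:R / 2%:R))%:M - wb *m w)
        + quarter *: (wb *m J *m wb^T *m w^T *m J *m w))
     ('X *: wb - half *: (wb *m J *m wb^T *m w^T *m J))
     (- (half *: (wb *m J *m wb^T)))
     (- ('X *: w) + half *: (J *m wb^T *m w^T *m J *m w))
     ('X%:M - J *m wb^T *m w^T *m J)
     (- (J *m wb^T))
     (- (half *: (w^T *m J *m w)))
     (w^T *m J)
     1%:M).

End Blocks.

(* The matrix hat B, for the index [bd_ix b k]. *)
Definition bd_B (b : bool) k : 'M[C]_K :=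
  if val k == 0%N then
    if b then \sum_j delta_mx j (rev_ord j) else 1%:M
  else
    let kk := bd_ix b k in let one := ord_first kk in
    delta_mx one kk + delta_mx kk one
    + delta_mx (rev_ord one) (rev_ord kk) + delta_mx (rev_ord kk) (rev_ord one)
    + \sum_(j in bd_labels | (j != kk) && (j != rev_ord kk))
        delta_mx j (if b then rev_ord j else j).

(* 1 < j <= k for the index k; for the index k', the condition of the
   definition reads (k')' = k < j < 1'. *)
Definition bd_flip (b : bool) k : {set 'I_K} :=
  [set j in bd_labels | if b then (k < j)%N else (j <= k)%N].

Definition bd_laxk (b : bool) k t : 'M[{poly osc R bd_labels}]_K :=
  conj_lax (bd_B b k)
    (bd_lax t (ph_bar R bd_labels (bd_flip b k))
              (ph_ann R bd_labels (bd_flip b k))).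

Definition bd_twist b k t th : osc R bd_labels :=
  twist th
    (fun i => gen_lax 1 (bd_laxk b k t) (bd_ix false i) (bd_ix false i)).

Definition bd_ch b k t th : C := trace (bd_twist b k t th).

Definition bd_T N b k t x th :=
  transfer N (bd_twist b k t th) (bd_laxk b k t) x.

Definition bd_T_cvg N b k t x th : Prop :=
  transfer_cvg N (bd_twist b k t th) (bd_laxk b k t) x.

Definition bd_D1 th : osc R bd_labels :=
  let num := number R bd_labels in
  twist th (fun i =>
    if val i == 0%N then - \sum_(l in bd_labels) num l
    else num (bd_ix false i) - num (bd_ix true i)).

Definition bd_Q1 N x tau :=
  qop (@cl_domain R r) bd_D1 N
    (bd_deg_lax (osc_bar R bd_labels) (osc_ann R bd_labels)) x tau.

(* tau_1 and tau_k interchanged, after inversion of all tau_i if b. *)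
Definition bd_tau (b : bool) k tau : 'I_r -> C :=
  fun i => let z := tau (tperm (ord_first k) k i) in if b then z^-1 else z.

Definition bd_Q N b k x tau :=
  conj_tens (bd_B b k) (bd_Q1 N x (bd_tau b k tau)).

End BD.

(* Main.v *)
Require Import Defs.
From HB Require Import structures.
From mathcomp Require Import all_boot all_order all_algebra finmap.
From mathcomp Require Import perm complex ring lra zify.
From mathcomp Require Import boolp classical_sets functions reals topology.
From mathcomp Require Import normedtype sequences exp trigo.
From mathcomp.analysis.showcase Require Import summability.
From mathcomp Require Import -(notations) mpoly.
Set Implicit Arguments.
Unset Strict Implicit.
Unset Printing Implicit Defensive.
Import Order.TTheory GRing.Theory Num.Theory.
Import numFieldNormedType.Exports.
Local Open Scope classical_set_scope.
Local Open Scope ring_scope.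
#[local] Existing Instance totally_filter.


Section Words.
Variables (C : fieldType) (L : Type) (zeta : L -> C) (c : L -> L -> C).

Definition exchange (f : seq L -> C) := forall u v l l',
  f (u ++ l :: l' :: v) = f (u ++ l' :: l :: v) + c l l' * f (u ++ v).

Definition twisted_cyclic (f : seq L -> C) := forall l w,
  f (l :: w) = zeta l * f (rcons w l).

Lemma exchange_rcons f u w l : exchange f ->
  f (u ++ rcons w l) = f (u ++ l :: w) +
    \sum_(i < size w) c (nth l w i) l * f (u ++ take i w ++ drop i.+1 w).
Proof.
move=> fx; elim: w u => [|x w IHw] u; first by rewrite big_ord0 addr0.
have:= IHw (rcons u x); rewrite !cat_rcons => ->.
rewrite fx big_ord_recl /= drop0 -!addrA; congr (_ + (_ + _)).
by apply: eq_bigr => i _; rewrite !cat_rcons.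
Qed.

Lemma wick_recursion f l w : exchange f -> twisted_cyclic f ->
  (1 - zeta l) * f (l :: w) =
    zeta l * \sum_(i < size w) c (nth l w i) l * f (take i w ++ drop i.+1 w).
Proof.
move=> fx fc; have := exchange_rcons [::] w l fx; rewrite /= => e.
rewrite mulrBl mul1r {1}fc e mulrDr; ring.
Qed.

Lemma size_delete (w : seq L) i : (i < size w)%N ->
  size (take i w ++ drop i.+1 w) = (size w).-1 :> nat.
Proof. by move=> lt_iw; rewrite size_cat size_takel ?size_drop; lia. Qed.

Hypothesis zeta_neq1 : forall l, zeta l != 1.

Lemma wick_unique f g : exchange f -> twisted_cyclic f ->
  exchange g -> twisted_cyclic g -> forall w, f w * g [::] = g w * f [::].
Proof.
move=> fx fc gx gc w; have [n] := ubnP (size w).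
elim: n w => // n IHn [|l w] /= lt_wn; first by rewrite mulrC.
have z1 : 1 - zeta l != 0 by rewrite subr_eq0 eq_sym.
apply: (mulfI z1); rewrite !mulrA !wick_recursion // -!mulrA; congr (_ * _).
rewrite !mulr_suml; apply: eq_bigr => i _; rewrite -!mulrA; congr (_ * _).
by apply: IHn; rewrite size_delete //; have := ltn_ord i; lia.
Qed.

End Words.

Lemma wick_closed (C : fieldType) (L T : Type) (dom : T -> Prop)
    (P : (T -> C) -> Prop) (zeta : T -> L -> C) (c : L -> L -> C)
    (f : T -> seq L -> C) :
  (forall k, P (fun=> k)) ->
  (forall g h, P g -> P h -> P (fun x => g x + h x)) ->
  (forall g h, P g -> P h -> P (fun x => g x * h x)) ->
  (forall g h, (forall x, dom x -> g x = h x) -> P g -> P h) ->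
  (forall l, P (fun x => zeta x l / (1 - zeta x l))) ->
  (forall x, dom x -> [/\ exchange c (f x), twisted_cyclic (zeta x) (f x),
     f x [::] = 1 & forall l, zeta x l != 1]) ->
  forall w, P (f^~ w).
Proof.
move=> Pk PD PM Pext Pz Hf w; have [n] := ubnP (size w).
elim: n w => // n IHn [|l w] /= lt_wn.
  by apply: Pext (Pk 1) => x /Hf[].
pose g x := zeta x l / (1 - zeta x l) *
  \sum_(i < size w) c (nth l w i) l * f x (take i w ++ drop i.+1 w).
apply: (Pext g).
  move=> x /Hf[fx fc _ z1]; have z1l : 1 - zeta x l != 0.
    by rewrite subr_eq0 eq_sym.
  apply: (mulfI z1l); rewrite (wick_recursion _ _ fx fc) /g.
  by rewrite mulrA mulrCA divff // mulr1.
have Psum (I : Type) (r : seq I) (F : I -> T -> C) : (forall i, P (F i)) ->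
    P (fun x => \sum_(i <- r) F i x).
  move=> PF; elim: r => [|i r IHr].
    by apply: (Pext _ _ _ (Pk 0)) => y _; rewrite big_nil.
  by apply: (Pext _ _ _ (PD _ _ (PF i) IHr)) => y _; rewrite big_cons.
suff Ps : P (fun y => \sum_(i < size w)
    c (nth l w i) l * f y (take i w ++ drop i.+1 w)) by exact: (PM _ _ (Pz l) Ps).
apply: (Psum _ _ (fun (i : 'I_(size w)) y =>
  c (nth l w i) l * f y (take i w ++ drop i.+1 w))) => i.
apply: (PM (fun=> _) (f^~ _) (Pk _)); apply: IHn.
by rewrite size_delete //; have := ltn_ord i; lia.
Qed.

(** [related X X'] : X and X' are one and the same noncommutative polynomial,
    evaluated at the two families of letters. *)
Section Related.
Variables (C : fieldType) (L : Type) (E E' : algType C).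
Variables (ell : L -> E) (ell' : L -> E').

Definition word (A : algType C) (a : L -> A) (w : seq L) : A :=
  \prod_(l <- w) a l.

Definition evalw (A : algType C) (a : L -> A) (s : seq (C * seq L)) : A :=
  \sum_(p <- s) p.1 *: word a p.2.

Lemma word_rcons (A : algType C) (a : L -> A) w l :
  word a (rcons w l) = word a w * a l.
Proof. by rewrite /word big_rcons_op /= ?mulr1 //; elim: w => [|x w IH]; rewrite ?big_nil ?big_cons ?mul1r ?mulr1 // IH mulrA. Qed.

Lemma word_cat (A : algType C) (a : L -> A) u v :
  word a (u ++ v) = word a u * word a v.
Proof. by rewrite /word big_cat. Qed.

Lemma word_cons (A : algType C) (a : L -> A) l w :
  word a (l :: w) = a l * word a w.
Proof. by rewrite /word big_cons. Qed.

Definition related X X' := exists s, X = evalw ell s /\ X' = evalw ell' s.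

Lemma related_scalar k : related k%:A k%:A.
Proof.
by exists [:: (k, [::])]; rewrite /evalw /word !big_seq1 /= !big_nil.
Qed.

Lemma related1 : related 1 1.
Proof. by have := related_scalar 1; rewrite !scale1r. Qed.

Lemma related0 : related 0 0.
Proof. by have := related_scalar 0; rewrite !scale0r. Qed.

Lemma relatedD X X' Y Y' :
  related X X' -> related Y Y' -> related (X + Y) (X' + Y').
Proof.
move=> [s [-> ->]] [u [-> ->]]; exists (s ++ u).
by rewrite /evalw !big_cat.
Qed.

Lemma relatedM X X' Y Y' :
  related X X' -> related Y Y' -> related (X * Y) (X' * Y').
Proof.
move=> [s [-> ->]] [u [-> ->]].
exists [seq (p.1 * q.1, p.2 ++ q.2) | p <- s, q <- u].
have evM (A : algType C) (a : L -> A) :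
    evalw a s * evalw a u =
    evalw a [seq (p.1 * q.1, p.2 ++ q.2) | p <- s, q <- u].
  rewrite /evalw big_allpairs_dep mulr_suml; apply: eq_bigr => p _.
  rewrite mulr_sumr; apply: eq_bigr => q _.
  by rewrite word_cat -scalerAl -scalerAr scalerA.
by rewrite !evM.
Qed.

Lemma relatedZ k X X' : related X X' -> related (k *: X) (k *: X').
Proof.
move=> r; have := relatedM (related_scalar k) r.
by rewrite -!scalerAl !mul1r.
Qed.

Lemma relatedN X X' : related X X' -> related (- X) (- X').
Proof. by move/(relatedZ (-1)); rewrite !scaleN1r. Qed.

Lemma relatedB X X' Y Y' :
  related X X' -> related Y Y' -> related (X - Y) (X' - Y').
Proof. by move=> r /relatedN; apply: relatedD. Qed.

Lemma relatedMn n X X' : related X X' -> related (X *+ n) (X' *+ n).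
Proof. by move=> r; elim: n => [|n IH]; rewrite ?mulr0n ?mulrS; [exact: related0|exact: relatedD]. Qed.

Lemma related_letter l : related (ell l) (ell' l).
Proof.
by exists [:: (1, [:: l])]; rewrite /evalw /word !big_seq1 /= ?big_seq1 !scale1r.
Qed.

Lemma related_sum (I : Type) (r : seq I) (P : pred I) (F : I -> E) (F' : I -> E') :
  (forall i, P i -> related (F i) (F' i)) ->
  related (\sum_(i <- r | P i) F i) (\sum_(i <- r | P i) F' i).
Proof.
by move=> h; elim/big_rec2: _ => [|i y y' Pi]; [exact: related0|apply/relatedD/h].
Qed.

Lemma related_prod (I : Type) (r : seq I) (P : pred I) (F : I -> E) (F' : I -> E') :
  (forall i, P i -> related (F i) (F' i)) ->
  related (\prod_(i <- r | P i) F i) (\prod_(i <- r | P i) F' i).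
Proof.
by move=> h; elim/big_rec2: _ => [|i y y' Pi]; [exact: related1|apply/relatedM/h].
Qed.

Definition related_mx m n (M : 'M[E]_(m, n)) (M' : 'M[E']_(m, n)) :=
  forall i j, related (M i j) (M' i j).

Lemma related_mul m n p (M : 'M[E]_(m, n)) M' (P : 'M[E]_(n, p)) P' :
  related_mx M M' -> related_mx P P' -> related_mx (M *m P) (M' *m P').
Proof.
by move=> rM rP i j; rewrite !mxE; apply: related_sum => k _; apply: relatedM.
Qed.

Lemma related_add m n (M : 'M[E]_(m, n)) M' P P' :
  related_mx M M' -> related_mx P P' -> related_mx (M + P) (M' + P').
Proof. by move=> rM rP i j; rewrite !mxE; apply: relatedD. Qed.

Lemma related_opp m n (M : 'M[E]_(m, n)) M' :
  related_mx M M' -> related_mx (- M) (- M').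
Proof. by move=> rM i j; rewrite !mxE; apply: relatedN. Qed.

Lemma related_const m n (B : 'M[C]_(m, n)) :
  related_mx (map_mx (fun k => k%:A) B) (map_mx (fun k => k%:A) B).
Proof. by move=> i j; rewrite !mxE; apply: related_scalar. Qed.

Lemma related_block m1 m2 n1 n2 (M1 : 'M[E]_(m1, n1)) M1' (M2 : 'M[E]_(m1, n2))
    M2' (M3 : 'M[E]_(m2, n1)) M3' (M4 : 'M[E]_(m2, n2)) M4' :
  related_mx M1 M1' -> related_mx M2 M2' -> related_mx M3 M3' ->
  related_mx M4 M4' ->
  related_mx (block_mx M1 M2 M3 M4) (block_mx M1' M2' M3' M4').
Proof.
move=> r1 r2 r3 r4 i j.
by case: (split_ordP i) => k ->; case: (split_ordP j) => l ->;
  rewrite ?block_mxEul ?block_mxEur ?block_mxEdl ?block_mxEdr.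
Qed.

Lemma related_cast m n m' n' (e : (m = m') * (n = n')) (M : 'M[E]_(m, n)) M' :
  related_mx M M' -> related_mx (castmx e M) (castmx e M').
Proof. by move=> r i j; rewrite !castmxE; apply: r. Qed.

End Related.

Section HasSum.
Variables (R : realType) (I : choiceType).
Local Notation C := R[i].
Local Open Scope fset_scope.
Local Open Scope ring_scope.
Implicit Types (f g : I -> C) (A : {fset I}).

Definition has_sum f (l : C) := forall eps : C, 0 < eps ->
  exists A0, forall A, A0 `<=` A -> `|l - \sum_(i <- A) f i| < eps.

Lemma has_sum_cvg f l : has_sum f l ->
  partial_sum (f : I -> C^o) @ totally --> (l : C^o).
Proof.
move=> h; apply/cvgrPdist_lt => eps eps0; have [A0 hA0] := h _ eps0.
exists A0 => // A /= /hA0; rewrite /partial_sum.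
by rewrite -(big_seq_fsetE +%R A xpredT f).
Qed.

Lemma cvg_has_sum f l :
  partial_sum (f : I -> C^o) @ totally --> (l : C^o) -> has_sum f l.
Proof.
move/cvgrPdist_lt => h eps eps0; have [A0 _ hA0] := h _ eps0.
exists A0 => A /hA0 /=; rewrite /partial_sum.
by rewrite -(big_seq_fsetE +%R A xpredT f).
Qed.

Lemma has_sum_uniq f l l' : has_sum f l -> has_sum f l' -> l = l'.
Proof.
move=> /has_sum_cvg h /has_sum_cvg h'.
exact: (cvg_unique (@norm_hausdorff C C^o) h h').
Qed.

Lemma has_sum_sum f l : has_sum f l ->
  sum (f : I -> C^o) = l :> C /\ cvg (partial_sum (f : I -> C^o) @ totally).
Proof.
move=> /has_sum_cvg h; split; last by apply/cvg_ex; exists l.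
exact: (cvg_lim (@norm_hausdorff C C^o) h).
Qed.

Lemma has_sumD f g l l' :
  has_sum f l -> has_sum g l' -> has_sum (fun i => f i + g i) (l + l').
Proof.
move=> hf hg eps eps0; have e2 : 0 < eps / 2 by rewrite divr_gt0.
have [A hA] := hf _ e2; have [B hB] := hg _ e2.
exists (A `|` B) => D; rewrite fsubUset => /andP[/hA hAD /hB hBD].
rewrite big_split /= opprD addrACA (le_lt_trans (ler_normD _ _)) //.
by rewrite [ltRHS](splitr eps) ltrD.
Qed.

Lemma has_sumZ f l k : has_sum f l -> has_sum (fun i => k * f i) (k * l).
Proof.
move=> hf eps eps0; have [->|k0] := eqVneq k 0.
  exists fset0 => A _; rewrite big1 ?mul0r ?subr0 ?normr0 // => i _.
  by rewrite mul0r.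
have e2 : 0 < eps / `|k| by rewrite divr_gt0 ?normr_gt0.
have [A hA] := hf _ e2; exists A => B /hA.
by rewrite -mulr_sumr -mulrBr normrM ltr_pdivlMr ?normr_gt0 // mulrC.
Qed.

Lemma has_sumB f g l l' :
  has_sum f l -> has_sum g l' -> has_sum (fun i => f i - g i) (l - l').
Proof.
move=> hf /(has_sumZ (-1)); rewrite mulN1r => hg.
by have := has_sumD hf hg; under eq_fun do rewrite mulN1r.
Qed.

End HasSum.

Section Reindex.
Variables (R : realType) (I J : choiceType).
Local Notation C := R[i].
Local Open Scope fset_scope.
Local Open Scope ring_scope.

Lemma has_sum_reindex (h : I -> J) (g : J -> I) (f : J -> C) l :
  cancel h g -> (forall j, f j != 0 -> h (g j) = j) ->
  has_sum (fun i => f (h i)) l <->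
  has_sum f l.
Proof.
move=> hK fh; split=> H eps /H[A0 hA0].
  exists [fset h i | i in A0] => B hB.
  pose A := [fset g j | j in [fset j in B | h (g j) == j]].
  have := hA0 A; have -> : \sum_(i <- A) f (h i) = \sum_(j <- B) f j.
    rewrite big_imfset /=.
      rewrite (big_fsetID _ (fun j => h (g j) == j) B) /=.
      rewrite [X in _ + X]big1_fset ?addr0.
        rewrite !big_fset /= big_seq_cond [RHS]big_seq_cond.
        by apply: eq_bigr => j /andP[_ /eqP->].
      move=> j; rewrite !inE => /andP[_ hj] _; apply/eqP.
      by apply: contraNT hj => /fh ->.
    by move=> i j; rewrite !inE => /andP[_ /eqP {2}<-] /andP[_ /eqP {2}<-] ->.
  apply; apply/fsubsetP => i iA; apply/imfsetP => /=; exists (h i).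
    by rewrite !inE hK eqxx andbT (fsubsetP hB) //; apply/imfsetP; exists i.
  by rewrite hK.
exists [fset g j | j in A0] => B hB.
pose A := A0 `|` [fset h i | i in B].
have := hA0 A (fsubsetUl _ _); have -> // : \sum_(i <- A) f i = \sum_(i <- B) f (h i).
have <- : \sum_(j <- [fset h i | i in B]) f j = \sum_(i <- B) f (h i).
  by rewrite big_imfset //= => i j _ _ /(can_inj hK).
apply/esym/big_fset_incl; first exact: fsubsetUr.
move=> j; rewrite in_fsetU => /orP[jA|->//] njB; apply/eqP.
apply: contraNT njB => /fh hj; apply/imfsetP; exists (g j) => //=.
by apply: (fsubsetP hB); apply/imfsetP; exists j.
Qed.

End Reindex.

Section Summable.
Variables (R : realType) (I : choiceType).
Local Notation C := R[i].
Local Open Scope fset_scope.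
Local Open Scope ring_scope.

Lemma sum_fset_le (g : I -> R) (A B : {fset I}) : (forall i, 0 <= g i) ->
  A `<=` B -> \sum_(i <- A) g i <= \sum_(i <- B) g i.
Proof.
move=> g0 AB; rewrite (big_fsetID _ (mem A) B) /=.
have -> : [fset x in B | mem A x] = A.
  by apply/fsetP => i; rewrite !inE /= andb_idl // => /(fsubsetP AB).
by rewrite lerDl sumr_ge0.
Qed.

Lemma has_sum_nonneg (g : I -> R) (b : R) : (forall i, 0 <= g i) ->
  (forall A : {fset I}, \sum_(i <- A) g i <= b) ->
  exists l, has_sum (fun i => (g i)%:C%C) l.
Proof.
move=> g0 gb; pose S := [set \sum_(i <- A) g i | A in @setT {fset I}]%classic.
have hS : has_sup S.
  split; first by exists (\sum_(i <- fset0) g i), fset0.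
  by exists b => _ [A _ <-].
exists (sup S)%:C%C => eps eps0.
have epsE : eps = (complex.Re eps)%:C%C.
  by move: eps0; case: (eps) => x y; rewrite ltcE /= => /andP[/eqP->].
have e0 : 0 < complex.Re eps by rewrite -ltcR -epsE.
have [_ [A0 _ <-] hA0] := sup_adherent e0 hS; exists A0 => A A0A.
rewrite -rmorph_sum -rmorphB /= normc_def /= expr0n addr0 sqrtr_sqr epsE ltcR.
have le1 : \sum_(i <- A) g i <= sup S by apply: sup_upper_bound => //; exists A.
have := sum_fset_le g0 A0A.
rewrite ger0_norm ?subr_ge0 //; lra.
Qed.

Lemma has_sum_bounded (f : I -> C) (g : I -> R) (b : R) :
  (forall i, `|f i| <= (g i)%:C%C) ->
  (forall A : {fset I}, \sum_(i <- A) g i <= b) ->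
  exists l, has_sum f l.
Proof.
move=> fg gb; pose re i := complex.Re (f i); pose im i := complex.Im (f i).
have dom (u : I -> R) : (forall i, `|u i| <= g i) -> 
    exists l, has_sum (fun i => (u i)%:C%C) l.
  move=> ug; pose up i := (`|u i| + u i) / 2; pose um i := (`|u i| - u i) / 2.
  have bnd (v : I -> R) : (forall i, v i <= g i) -> 
     forall A : {fset I}, \sum_(i <- A) v i <= b.
    by move=> vg A; apply: le_trans (gb A); apply: ler_sum.
  have := fun i => ler_norm (u i); have := fun i => ler_norm (- u i).
  have upP i : 0 <= up i <= g i.
    have:= ler_norm (u i); have:= ler_norm (- u i); have:= ug i.
    rewrite normrN /up; lra.
  have umP i : 0 <= um i <= g i.
    have:= ler_norm (u i); have:= ler_norm (- u i); have:= ug i.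
    rewrite normrN /um; lra.
  move=> _ _.
  have [||lp hp] := @has_sum_nonneg up b.
  - by move=> i; case/andP: (upP i).
  - by apply: bnd => i; case/andP: (upP i).
  have [||lm hm] := @has_sum_nonneg um b.
  - by move=> i; case/andP: (umP i).
  - by apply: bnd => i; case/andP: (umP i).
  exists (lp - lm); have := has_sumB hp hm; congr has_sum; apply/funext => i.
  by rewrite -rmorphB; congr (_%:C%C); rewrite /up /um; lra.
have [lr hr] : exists l, has_sum (fun i => (re i)%:C%C) l.
  apply: dom => i; rewrite -lecR; apply: le_trans (fg i).
  exact: normc_ge_Re.
have [li hi] : exists l, has_sum (fun i => (im i)%:C%C) l.
  apply: dom => i; rewrite -lecR; apply: le_trans (fg i).
  have := normc_ge_Re (- 'i%C * f i).
  have ni : `|'i%C| = 1 :> C.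
    by rewrite normc_def /= expr0n /= expr1n add0r sqrtr1.
  rewrite normrM normrN ni mul1r.
  suff -> : complex.Re (- 'i%C * f i) = im i by [].
  by rewrite /im; case: (f i) => x y /=; rewrite oppr0 mul0r sub0r mulN1r opprK.
exists (lr + 'i%C * li).
have := has_sumD hr (has_sumZ 'i%C hi); congr has_sum; apply/funext => i.
by rewrite /re /im; case: (f i) => x y; apply/eqP; rewrite eq_complex /=; apply/andP; split; apply/eqP; ring.
Qed.

End Summable.

Section Geometric.
Variable R : realType.
Local Notation C := R[i].

Lemma bernoulli_le (x : R) k : 0 <= x -> 1 + k%:R * x <= (1 + x) ^+ k.
Proof.
move=> x0; elim: k => [|k IH]; first by rewrite mul0r addr0 expr0.
rewrite exprS; apply: (@le_trans _ _ ((1 + x) * (1 + k%:R * x))); last first.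
  by rewrite ler_wpM2l //; lra.
have yx : 0 <= k%:R * (x * x) by rewrite !mulr_ge0.
rewrite -natr1 -subr_ge0.
by have -> : (1 + x) * (1 + k%:R * x) - (1 + (k%:R + 1) * x) = k%:R * (x * x)
  by ring.
Qed.

Lemma poly_geometric_le (rho : R) d : 0 <= rho -> rho < 1 -> exists sigma K : R,
  [/\ 0 < sigma, sigma < 1, 0 <= K
    & forall k, (1 + k%:R) ^+ d * rho ^+ k <= K * sigma ^+ k].
Proof.
move=> r0 r1; elim: d => [|d [s [K [s0 s1 K0 HK]]]].
  exists ((1 + rho) / 2), 1; split; [lra|lra|lra|] => k.
  by rewrite expr0 !mul1r lerXn2r ?nnegrE //; lra.
pose t := (1 + s) / 2; have t0 : 0 < t by rewrite /t; lra.
have st : s < t by rewrite /t; lra.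
pose x := t / s - 1; have x0 : 0 < x by rewrite subr_gt0 ltr_pdivlMr // mul1r.
exists t, ((1 + x^-1) * K); split => //.
- by rewrite /t; lra.
- by rewrite mulr_ge0 // addr_ge0 // invr_ge0 ltW.
move=> k; rewrite exprS -mulrA; apply: le_trans (_ : (1 + k%:R) * (K * s ^+ k) <= _).
  by rewrite ler_wpM2l // addr_ge0.
have -> : t ^+ k = (1 + x) ^+ k * s ^+ k.
  by rewrite -exprMn /x addrC subrK divfK // gt_eqF.
have bx := bernoulli_le k (ltW x0).
have : 1 + k%:R <= (1 + x^-1) * (1 + k%:R * x).
  have -> : (1 + x^-1) * (1 + k%:R * x) = 1 + k%:R + (x^-1 + k%:R * x).
    by field; rewrite gt_eqF.
  by rewrite lerDl addr_ge0 ?mulr_ge0 // ?invr_ge0 ltW.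
have xV0 : 0 <= 1 + x^-1 by rewrite addr_ge0 // invr_ge0 ltW.
move=> /le_trans/(_ (ler_wpM2l xV0 bx)) hk.
have Ks : 0 <= K * s ^+ k by rewrite mulr_ge0 // exprn_ge0 // ltW.
have -> : (1 + x^-1) * K * ((1 + x) ^+ k * s ^+ k)
  = (1 + x^-1) * (1 + x) ^+ k * (K * s ^+ k) by ring.
exact: ler_wpM2r.
Qed.

Variable n : nat.
Local Notation monom := (multinom n).
Implicit Types (m : monom) (lam : 'I_n -> C).

Definition monev lam m : C := \prod_i lam i ^+ m i.

Lemma monevD lam m m' : monev lam (mnm_add m m') = monev lam m * monev lam m'.
Proof.
by rewrite /monev -big_split; apply: eq_bigr => i _; rewrite mnmDE exprD.
Qed.

Lemma monev1 lam i : monev lam (mnm1 i) = lam i.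
Proof.
rewrite /monev (bigD1 i) //= mnm1E eqxx expr1 big1 ?mulr1 // => j ji.
by rewrite mnm1E eq_sym (negPf ji).
Qed.

Lemma box_sum_le (g : nat -> R) (b : R) : (forall k, 0 <= g k) ->
  (forall k, \sum_(j < k) g j <= b) ->
  forall A : {fset monom}, \sum_(m <- A) \prod_i g (m i) <= b ^+ n.
Proof.
move=> g0 gb A; pose N := (\max_(m <- A) mdeg m)%N.
have mN m i : m \in A -> (m i < N.+1)%N.
  move=> mA; rewrite ltnS; apply: (@leq_trans (mdeg m)).
    by rewrite mdegE (bigD1 i) //= leq_addr.
  by rewrite /N; apply: (@leq_bigmax_seq _ _ xpredT).
pose phi m : {ffun 'I_n -> 'I_N.+1} := [ffun i => inord (m i)].
pose G (y : {ffun 'I_n -> 'I_N.+1}) := \prod_i g (y i).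
have -> : \sum_(m <- A) \prod_i g (m i) = \sum_(m <- A) G (phi m).
  apply: eq_big_seq => m mA; apply: eq_bigr => i _.
  by rewrite ffunE inordK ?mN.
have -> : \sum_(m <- A) G (phi m) = \sum_(y <- [fset phi m | m in A]%fset) G y.
  rewrite big_imfset //= => m m' mA m'A /ffunP e; apply/mnmP => i.
  by have := congr1 val (e i); rewrite !ffunE /= !inordK ?mN.
rewrite big_uniq ?fset_uniq //= big_mkcond /=.
apply: le_trans (_ : \sum_y G y <= _).
  by apply: ler_sum => y _; case: ifP => // _; rewrite prodr_ge0.
rewrite /G -(bigA_distr_bigA (fun _ (j : 'I_N.+1) => g j)) /=.
rewrite prodr_const card_ord lerXn2r ?nnegrE ?sumr_ge0 ?gb //.
by apply: le_trans (gb 0%N); rewrite sumr_ge0.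
Qed.

Definition normR (z : C) : R := complex.Re `|z|.
Lemma normRE z : `|z| = (normR z)%:C%C.
Proof. by rewrite /normR normc_def. Qed.
Lemma normR_ge0 z : 0 <= normR z.
Proof. by rewrite -lecR -normRE normr_ge0. Qed.

Lemma monomial_has_sum lam (f : monom -> C) (c d : nat) :
  (forall i, `|lam i| < 1) ->
  (forall m, `|f m| <= c%:R * (1 + (mdeg m)%:R) ^+ d * \prod_i `|lam i| ^+ m i) ->
  exists l, has_sum f l.
Proof.
move=> lam1 fb; pose rho := \big[Num.max/0]_i normR (lam i).
have r1 : rho < 1.
  apply/bigmax_ltP; split=> // i _.
  by have := lam1 i; rewrite normRE (_ : 1 = 1%:C%C) // ltcR.
have r0 : 0 <= rho by apply: bigmax_ge_id.
have [s [K [s0 s1 K0 HK]]] := poly_geometric_le d r0 r1.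
pose g m := c%:R * K * \prod_i s ^+ m i.
apply: (@has_sum_bounded _ _ f g (c%:R * K * (1 - s)^-1 ^+ n)).
  move=> m; apply: le_trans (fb m) _.
  have -> : \prod_i `|lam i| ^+ m i = (\prod_i normR (lam i) ^+ m i)%:C%C.
    by rewrite rmorph_prod; apply: eq_bigr => i _; rewrite normRE rmorphXn.
  have -> : c%:R * (1 + (mdeg m)%:R) ^+ d = (c%:R * (1 + (mdeg m)%:R) ^+ d)%:C%C :> C.
    by rewrite rmorphM rmorphXn rmorphD /= !rmorph_nat.
  rewrite -rmorphM lecR /g -!mulrA ler_wpM2l //.
  have -> : \prod_i s ^+ m i = s ^+ mdeg m by rewrite -expr_sum -mdegE.
  apply: le_trans (HK _); rewrite ler_wpM2l ?exprn_ge0 ?addr_ge0 //.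
  rewrite mdegE expr_sum; apply: ler_prod => i _.
  rewrite exprn_ge0 ?normR_ge0 //= lerXn2r ?nnegrE ?normR_ge0 //.
  by apply: le_bigmax.
move=> A; rewrite -mulr_sumr ler_wpM2l ?mulr_ge0 //.
apply: box_sum_le => [k|k]; first by rewrite exprn_ge0 // ltW.
have s1' : 0 < 1 - s by rewrite subr_gt0.
rewrite -[leRHS]mul1r ler_pdivlMr // mulrC.
have := subrX1 s k; have : 0 <= s ^+ k by rewrite exprn_ge0 // ltW.
set S := \sum_(j < k) _; nra.
Qed.

Lemma geometric_has_sum_neq0 lam l : (forall i, `|lam i| < 1) ->
  has_sum (monev lam) l -> l != 0.
Proof.
move=> lam1 hl.
pose f (r : seq 'I_n) m := if all (fun i => m i == 0%N) r then monev lam m else 0.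
have step (r : seq 'I_n) : uniq r -> has_sum (f r) (\prod_(i <- r) (1 - lam i) * l).
  elim: r => [|s r IH] /=.
    by rewrite big_nil mul1r.
  case/andP => sr /IH{}IH; rewrite big_cons -mulrA mulrBl mul1r.
  set z := _ * l in IH *.
  pose h m := if m s == 0%N then 0 else f r m.
  have hh : has_sum h (lam s * z).
    rewrite -(@has_sum_reindex _ _ _ (mnm_add (mnm1 s)) (fun m => mnm_sub m (mnm1 s))).
    - have := has_sumZ (lam s) IH; congr has_sum; apply/funext => m.
      rewrite /h /f mnmDE mnm1E eqxx /= monevD monev1.
      have -> : all (fun i => mnm_add (mnm1 s) m i == 0%N) r = all (fun i => m i == 0%N) r.
        apply: eq_in_all => i ir; rewrite mnmDE mnm1E.
        by move: ir; case: (s =P i) sr => [<- /negPf->|].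
      by case: all; rewrite ?mulr0.
    - by move=> m; rewrite addmC addmK.
    move=> m; rewrite /h; case: (m s =P 0%N) => [_|ms _]; first by rewrite eqxx.
    apply/mnmP => i; rewrite mnmDE mnmBE mnm1E; case: eqP => [<-|_]; lia.
  have := has_sumB IH hh; congr has_sum; apply/funext => m.
  by rewrite /h /f /=; case: eqP => //=; rewrite ?subr0 ?subrr.
have := step _ (enum_uniq 'I_n); set p := \prod_(i <- _) _ => h.
have h1 : has_sum (f (enum 'I_n)) 1.
  move=> eps eps0; exists [fset (@mnm0 n)]%fset => A h0.
  rewrite (big_fsetD1 (@mnm0 n)) /=; last by apply: (fsubsetP h0); rewrite inE.
  rewrite {1}/f ifT; last by apply/allP => i _; rewrite mnm0E.
  rewrite big1_fset ?addr0.
    rewrite /monev big1 ?subrr ?normr0 // => i _; by rewrite mnm0E expr0.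
  move=> m; rewrite !inE => /andP[m0 _] _; rewrite /f; case: allP => // hm.
  case/eqP: m0; apply/mnmP => i; rewrite mnm0E; apply/eqP/hm.
  by rewrite mem_enum.
apply: contra_eq_neq (has_sum_uniq h h1) => ->.
by rewrite mulr0 eq_sym oner_eq0.
Qed.

End Geometric.

Section Letters.
Variable J : finType.

Definition ccr_coef (C : nzRingType) (l l' : bool * J) : C :=
  (l.2 == l'.2)%:R * (l'.1%:R - l.1%:R).

Definition ccr (C : fieldType) (E : algType C) (ell : bool * J -> E) :=
  forall l l', ell l * ell l' = ell l' * ell l + (ccr_coef C l l')%:A.

Definition weight (C : fieldType) (z : J -> C) (l : bool * J) : C :=
  if l.1 then z l.2 else (z l.2)^-1.

Lemma weight_neq1 (C : fieldType) (z : J -> C) :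
  (forall j, z j != 1) -> forall l, weight z l != 1.
Proof. by move=> z1 [[] j]; rewrite /weight //= invr_eq1. Qed.

Lemma ccr_exchange (C : fieldType) (E : algType C) (ell : bool * J -> E)
    (F : {linear E -> C^o}) (Y : E) : ccr ell ->
  exchange (@ccr_coef C) (fun w => F (word ell w * Y) : C).
Proof.
move=> hc u v l l'; rewrite !word_cat !word_cons.
rewrite !(mulrA (ell _)) hc mulrDl mulrDr mulrDl linearD /=; congr (_ + _).
by rewrite -scalerAl mul1r -scalerAr -scalerAl linearZ.
Qed.

Lemma ccr_exchange1 (C : fieldType) (E : algType C) (ell : bool * J -> E)
    (F : {linear E -> C^o}) : ccr ell ->
  exchange (@ccr_coef C) (fun w => F (word ell w) : C).
Proof.
move=> hc u v l l'; have := ccr_exchange F 1 hc u v l l'.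
by rewrite !mulr1.
Qed.

End Letters.

Section Trace.
Variables (R : realType) (J : finType).
Local Notation C := R[i].
Local Notation E := (fock_end R J).
Local Notation monom := (multinom #|J|).
Local Notation e_ j := (mnm1 (enum_rank j)).
Implicit Types (X : E) (m k : monom) (j : J).

Definition entry X k m : C := mcoeff k (X (mpolyX C m)).

Lemma fockD X (u v : fock R J) : X (u + v) = X u + X v.
Proof. by have := fock_end_linear X 1 u v; rewrite !scale1r. Qed.

Lemma fock0 X : X 0 = 0.
Proof. by apply: (addrI (X 0)); rewrite -fockD !addr0. Qed.

Lemma fockZ X (c : C) (v : fock R J) : X (c *: v) = c *: X v.
Proof. by have := fock_end_linear X c v 0; rewrite !addr0 fock0 addr0. Qed.

Lemma entry1 k m : entry 1 k m = (m == k)%:R.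
Proof. by rewrite /entry /= mcoeffX. Qed.

Lemma entryD X Y k m : entry (X + Y) k m = entry X k m + entry Y k m.
Proof. by rewrite /entry /= mcoeffD. Qed.

Lemma entryN X k m : entry (- X) k m = - entry X k m.
Proof. by rewrite /entry /= mcoeffN. Qed.

Lemma entryZ c X k m : entry (c *: X) k m = c * entry X k m.
Proof. by rewrite /entry /= mcoeffZ. Qed.

Lemma entry_abarM X j k m : entry (abar R j * X) (mnm_add k (e_ j)) m = entry X k m.
Proof. by rewrite /entry /= mulrC addmC mcoeffMX. Qed.

Lemma entry_abarM0 X j k m : k (enum_rank j) = 0%N -> entry (abar R j * X) k m = 0.
Proof.
move=> k0; rewrite /entry /= (mpolyE (X _)) mulr_sumr raddf_sum big1 //= => l _.
rewrite -scalerAr mcoeffZ -mpolyXD mcoeffX; case: eqP => [e|]; last by rewrite mulr0.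
by move: k0; rewrite -e mnmDE mnm1E eqxx.
Qed.

Lemma entryM_abar X j k m : entry (X * abar R j) k m = entry X k (mnm_add m (e_ j)).
Proof. by rewrite /entry /= addmC mpolyXD. Qed.

Lemma entry_annM X j k m :
  entry (ann R j * X) k m = (k (enum_rank j)).+1%:R * entry X (mnm_add k (e_ j)) m.
Proof. by rewrite /entry /= mcoeff_mderiv mulr_natl. Qed.

Lemma entryM_ann X j k m :
  entry (X * ann R j) k m = (m (enum_rank j))%:R * entry X k (mnm_sub m (e_ j)).
Proof. by rewrite /entry /= mderivX fockZ mcoeffZ. Qed.

Lemma mnm_subK m j : m (enum_rank j) != 0%N -> mnm_add (mnm_sub m (e_ j)) (e_ j) = m.
Proof.
move=> mj; apply/mnmP => i; rewrite mnmDE mnmBE mnm1E.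
by case: eqP => [<-|_]; lia.
Qed.

(** The operators of polynomial growth and bounded degree contain every word in
    the oscillators, and their twisted traces converge. *)
Definition tame X := exists c d e : nat, forall k m,
  `|entry X k m| <= c%:R * (1 + (mdeg m)%:R) ^+ d /\
  (entry X k m != 0 -> (mdeg k <= mdeg m + e)%N).

Lemma tame1 : tame 1.
Proof.
exists 1%N, 0%N, 0%N => k m; rewrite entry1 mulr1 normr_nat.
by case: eqP => [->|]; rewrite ?addn0 ?eqxx.
Qed.

Lemma tameN X : tame X -> tame (- X).
Proof.
by move=> [c [d [e h]]]; exists c, d, e => k m; rewrite entryN normrN oppr_eq0.
Qed.

Lemma tame0 : tame 0.
Proof.
by exists 0%N, 0%N, 0%N => k m; rewrite /entry /= mcoeff0 normr0 mul0r eqxx.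
Qed.

Lemma tameZ a X : tame X -> tame (a *: X).
Proof.
move=> [c [d [e h]]]; have [n an] : exists n : nat, `|a| <= n%:R.
  have [n hn] : exists n : nat, normR a <= n%:R.
    by exists (Num.truncn (normR a)).+1; rewrite ltW // truncnS_gt.
  by exists n; rewrite normRE -(rmorph_nat (@real_complex R)) lecR.
exists (n * c)%N, d, e => k m; rewrite entryZ; have [h1 h2] := h k m; split.
  by rewrite normrM natrM -mulrA ler_pM.
by rewrite mulf_eq0 negb_or => /andP[_ /h2].
Qed.

Lemma tameD X Y : tame X -> tame Y -> tame (X + Y).
Proof.
move=> [c [d [e h]]] [c' [d' [e' h']]].
exists (c + c')%N, (d + d')%N, (e + e')%N => k m; rewrite entryD.
have [h1 h2] := h k m; have [h1' h2'] := h' k m.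
have m1 : 1 <= 1 + (mdeg m)%:R :> C by rewrite lerDl.
split.
  apply: le_trans (ler_normD _ _) _; rewrite natrD mulrDl lerD //.
    apply: le_trans h1 _; rewrite ler_wpM2l // exprD ler_peMr ?exprn_ge0 ?addr_ge0 //.
    exact: exprn_ege1.
  apply: le_trans h1' _; rewrite ler_wpM2l // exprD ler_peMl ?exprn_ge0 ?addr_ge0 //.
  exact: exprn_ege1.
have [X0|/h2] := eqVneq (entry X k m) 0; last by lia.
by rewrite X0 add0r => /h2'; lia.
Qed.

Lemma tame_abarM j X : tame X -> tame (abar R j * X).
Proof.
move=> [c [d [e h]]]; exists c, d, e.+1 => k m.
have [k0|k0] := eqVneq (k (enum_rank j)) 0%N.
  by rewrite entry_abarM0 // normr0 eqxx mulr_ge0 ?exprn_ge0 ?addr_ge0.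
rewrite -(mnm_subK k0) entry_abarM; have [h1 h2] := h (mnm_sub k (e_ j)) m.
by split=> // /h2; rewrite mdegD mdeg1; lia.
Qed.

Lemma tame_annM j X : tame X -> tame (ann R j * X).
Proof.
move=> [c [d [e h]]]; exists (c * e.+1)%N, d.+1, e => k m; rewrite entry_annM.
have [h1 h2] := h (mnm_add k (e_ j)) m.
split; last first.
  by rewrite mulf_eq0 negb_or => /andP[_ /h2]; rewrite mdegD mdeg1; lia.
have [->|/h2] := eqVneq (entry X (mnm_add k (e_ j)) m) 0.
  by rewrite mulr0 normr0 mulr_ge0 ?exprn_ge0 ?addr_ge0.
rewrite mdegD mdeg1 => le_km; rewrite normrM normr_nat exprS.
have le_k : (k (enum_rank j)).+1%:R <= e.+1%:R * (1 + (mdeg m)%:R) :> C.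
  rewrite (_ : 1 + (mdeg m)%:R = (mdeg m).+1%:R); last by rewrite -natr1 addrC.
  rewrite -natrM ler_nat.
  have : (k (enum_rank j) <= mdeg k)%N by rewrite mdegE (bigD1 (enum_rank j)) //= leq_addr.
  nia.
rewrite (_ : _%:R * _ = e.+1%:R * (1 + (mdeg m)%:R) * (c%:R * (1 + (mdeg m)%:R) ^+ d)).
  by rewrite ler_pM.
by rewrite natrM; ring.
Qed.

Lemma tameM_abar j X : tame X -> tame (X * abar R j).
Proof.
move=> [c [d [e h]]]; exists (c * 2 ^ d)%N, d, e.+1 => k m; rewrite entryM_abar.
have [h1 h2] := h k (mnm_add m (e_ j)).
split; last by move/h2; rewrite mdegD mdeg1; lia.
apply: le_trans h1 _; rewrite natrM -mulrA ler_wpM2l // natrX -exprMn.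
rewrite lerXn2r ?nnegrE ?mulr_ge0 ?addr_ge0 // mdegD mdeg1 natrD.
rewrite -subr_ge0 (_ : _ - _ = (mdeg m)%:R) //; ring.
Qed.

Lemma tameM_ann j X : tame X -> tame (X * ann R j).
Proof.
move=> [c [d [e h]]]; exists c, d.+1, e => k m; rewrite entryM_ann.
have [->|mj] := eqVneq (m (enum_rank j)) 0%N.
  by rewrite mul0r normr0 eqxx mulr_ge0 ?exprn_ge0 ?addr_ge0.
have [h1 h2] := h k (mnm_sub m (e_ j)).
have md : mdeg m = (mdeg (mnm_sub m (e_ j))).+1.
  by rewrite -{1}(mnm_subK mj) mdegD mdeg1 addn1.
split; last by rewrite mulf_eq0 negb_or => /andP[_ /h2]; lia.
rewrite normrM normr_nat exprS mulrCA ler_pM //.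
  apply: (@le_trans _ _ (mdeg m)%:R); last by rewrite lerDr.
  by rewrite ler_nat mdegE (bigD1 (enum_rank j)) //= leq_addr.
apply: le_trans h1 _; rewrite ler_wpM2l //.
by rewrite lerXn2r ?nnegrE ?addr_ge0 // lerD2l ler_nat md.
Qed.

Variables (W : E) (k0 : C) (lam : 'I_#|J| -> C).
Hypothesis W_diag :
  forall m (v : fock R J), mcoeff m (W v) = k0 * monev lam m * mcoeff m v.
Hypothesis lam_lt1 : forall i, `|lam i| < 1.

Lemma diag_coefW X m : diag_coef (W * X) m = k0 * monev lam m * entry X m m.
Proof. by rewrite /diag_coef /= W_diag. Qed.

Lemma tame_has_sum X : tame X -> exists l, has_sum (diag_coef (W * X)) l.
Proof.
move=> [c [d [e h]]].
have [|l hl] := @monomial_has_sum R _ lam (fun m => monev lam m * entry X m m) c d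
    lam_lt1.
  move=> m; have [hb _] := h m m; rewrite normrM mulrC ler_pM //.
  by rewrite /monev normr_prod ler_prod // => i _; rewrite normrX exprn_ge0 //=.
exists (k0 * l); have := has_sumZ k0 hl; congr has_sum; apply/funext => m.
by rewrite diag_coefW mulrA.
Qed.

Lemma tame_cvg X : tame X -> trace_cvg (W * X).
Proof. by move=> /tame_has_sum[l /has_sum_sum[]]. Qed.

Lemma trace_has_sum X l : has_sum (diag_coef (W * X)) l -> trace (W * X) = l.
Proof. by move=> /has_sum_sum[]. Qed.

Lemma has_sum_trace X : tame X -> has_sum (diag_coef (W * X)) (trace (W * X)).
Proof. by move=> /tame_has_sum[l h]; rewrite (trace_has_sum h). Qed.

Lemma trace_abar_cyclic j X : tame X ->
  trace (W * (abar R j * X)) = lam (enum_rank j) * trace (W * (X * abar R j)).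
Proof.
move=> tX; apply: trace_has_sum.
rewrite -(@has_sum_reindex _ _ _ (fun m => mnm_add m (e_ j))
  (fun m => mnm_sub m (e_ j))).
- have := has_sumZ (lam (enum_rank j)) (has_sum_trace (tameM_abar j tX)).
  congr has_sum; apply/funext => m.
  by rewrite !diag_coefW entry_abarM entryM_abar monevD monev1; ring.
- by move=> m; rewrite addmK.
move=> m; rewrite diag_coefW => mj; apply: mnm_subK; apply: contraNneq mj => mj.
by rewrite entry_abarM0 // mulr0.
Qed.

Lemma trace_ann_cyclic j X : tame X ->
  trace (W * (X * ann R j)) = lam (enum_rank j) * trace (W * (ann R j * X)).
Proof.
move=> tX; apply: trace_has_sum.
rewrite -(@has_sum_reindex _ _ _ (fun m => mnm_add m (e_ j))
  (fun m => mnm_sub m (e_ j))).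
- have := has_sumZ (lam (enum_rank j)) (has_sum_trace (tame_annM j tX)).
  congr has_sum; apply/funext => m.
  rewrite !diag_coefW entry_annM entryM_ann monevD monev1 addmK.
  by rewrite mnmDE mnm1E eqxx addn1; ring.
- by move=> m; rewrite addmK.
move=> m; rewrite diag_coefW => mj; apply: mnm_subK; apply: contraNneq mj => mj.
by rewrite entryM_ann mj mul0r mulr0.
Qed.

Lemma trace_linear c X Y : tame X -> tame Y ->
  trace (W * (c *: X + Y)) = c * trace (W * X) + trace (W * Y).
Proof.
move=> tX tY; apply: trace_has_sum.
have := has_sumD (has_sumZ c (has_sum_trace tX)) (has_sum_trace tY).
congr has_sum; apply/funext => m.
by rewrite !diag_coefW entryD entryZ; ring.
Qed.

Lemma trace_neq0 : k0 != 0 -> trace W != 0.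
Proof.
move=> k00; rewrite -(mulr1 W); have h := has_sum_trace tame1.
have hl := has_sumZ k0^-1 h.
have := @geometric_has_sum_neq0 _ _ lam (k0^-1 * trace (W * 1)) lam_lt1.
rewrite mulf_eq0 invr_eq0 negb_or k00 /=; apply.
move: hl; congr has_sum; apply/funext => m.
by rewrite diag_coefW entry1 eqxx mulr1 mulrA mulVf // mul1r.
Qed.

End Trace.

Section Bracket.
Variables (C : fieldType) (E : algType C).
Implicit Types X Y Z : E.

Definition bracket X Y := X * Y - Y * X.

Lemma bracketDl X Y Z : bracket (X + Y) Z = bracket X Z + bracket Y Z.
Proof. by rewrite /bracket mulrDl mulrDr opprD addrACA. Qed.
Lemma bracketDr X Y Z : bracket X (Y + Z) = bracket X Y + bracket X Z.
Proof. by rewrite /bracket mulrDl mulrDr opprD addrACA. Qed.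
Lemma bracketZl c X Y : bracket (c *: X) Y = c *: bracket X Y.
Proof. by rewrite /bracket -scalerAl -scalerAr scalerBr. Qed.
Lemma bracketZr c X Y : bracket X (c *: Y) = c *: bracket X Y.
Proof. by rewrite /bracket -scalerAl -scalerAr scalerBr. Qed.
Lemma bracketNl X Y : bracket (- X) Y = - bracket X Y.
Proof. by rewrite -scaleN1r bracketZl scaleN1r. Qed.
Lemma bracketNr X Y : bracket X (- Y) = - bracket X Y.
Proof. by rewrite -scaleN1r bracketZr scaleN1r. Qed.
Lemma bracketC X Y : bracket X Y = - bracket Y X.
Proof. by rewrite /bracket opprB. Qed.
Lemma bracket_comm X Y : bracket X Y = 0 <-> GRing.comm X Y.
Proof. by split=> [/subr0_eq//|h]; rewrite /bracket h subrr. Qed.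

Lemma ccrP (J : finType) (ell : bool * J -> E) :
  ccr ell <-> forall l l', bracket (ell l) (ell l') = (ccr_coef C l l')%:A.
Proof.
split=> h l l'; last by rewrite -h /bracket addrCA addrN addr0.
by rewrite /bracket h addrC addKr.
Qed.

Definition bracketE :=
  (bracketDl, bracketDr, bracketZl, bracketZr, bracketNl, bracketNr).
End Bracket.

Lemma ccr_coefC (C : fieldType) (J : finType) (l l' : bool * J) :
  ccr_coef C l' l = - ccr_coef C l l'.
Proof. by rewrite /ccr_coef eq_sym -mulrN opprB. Qed.

Section Oscillators.
Variables (R : realType) (J : finType).
Local Notation C := R[i].
Local Notation E := (fock_end R J).

Definition base_letter (l : bool * J) : E :=
  if l.1 then abar R l.2 else ann R l.2.

(** The letters after exchanging creation and annihilation on the labels in P. *)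
Definition ph_letter (P : pred J) (l : bool * J) : E :=
  if P l.2 then (if l.1 then - ann R l.2 else abar R l.2) else base_letter l.

Lemma bracket_ann_abar (i j : J) : bracket (ann R i) (abar R j) = (i == j)%:R%:A.
Proof.
apply: fock_endP => v; rewrite /bracket /=.
rewrite mderivM addrK mderivX mnm1E (inj_eq enum_rank_inj) eq_sym.
case: eqP => [->|_]; last by rewrite !scale0r mul0r.
rewrite (_ : mnm_sub _ _ = @mnm0 _); last first.
  by apply/mnmP => k; rewrite mnmBE subnn mnm0E.
by rewrite mpolyX0 !scale1r mul1r.
Qed.

Lemma bracket_abar (i j : J) : bracket (abar R i) (abar R j) = 0.
Proof. by apply: fock_endP => v; rewrite /bracket /= mulrCA subrr. Qed.

Lemma bracket_ann (i j : J) : bracket (ann R i) (ann R j) = 0.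
Proof. by apply: fock_endP => v; rewrite /bracket /= mderiv_comm subrr. Qed.

Lemma base_letter_ccr : ccr base_letter.
Proof.
apply/ccrP => -[[] i] [[] j]; rewrite /base_letter /ccr_coef /=.
- by rewrite bracket_abar subrr mulr0 scale0r.
- by rewrite bracketC bracket_ann_abar sub0r mulrN1 eq_sym scaleNr.
- by rewrite bracket_ann_abar subr0 mulr1.
- by rewrite bracket_ann subrr mulr0 scale0r.
Qed.

Lemma ph_letter_ccr P : ccr (ph_letter P).
Proof.
have /ccrP h := base_letter_ccr.
have hb b i b' j := h (b, i) (b', j).
have hTT := hb true _ true _; have hTF := hb true _ false _.
have hFT := hb false _ true _; have hFF := hb false _ false _.
rewrite /base_letter /ccr_coef /= in hTT hTF hFT hFF.
apply/ccrP => -[b i] [b' j]; rewrite /ph_letter /base_letter /ccr_coef /=.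
have [<-|ij] := eqVneq i j.
  case: (P i); case: b; case: b'; rewrite ?bracketE ?(hTT, hTF, hFT, hFF) ?eqxx //=;
  by rewrite -?scaleNr ?opprK; congr (_ *: _); ring.
by case: (P i); case: (P j); case: b; case: b';
  rewrite ?bracketE ?(hTT, hTF, hFT, hFF) ?(negPf ij) !mul0r ?scale0r ?oppr0.
Qed.

Lemma tame_word P w : tame (word (ph_letter P) w).
Proof.
elim: w => [|[b j] w IH]; first by rewrite /word big_nil; exact: tame1.
rewrite word_cons /ph_letter /base_letter /=.
case: (P j); case: b; rewrite ?mulNr; try apply: tameN; first [exact: tame_abarM|exact: tame_annM].
Qed.

Variables (W : E) (k0 : C) (lam : J -> C).
Hypothesis W_diag : forall m (v : fock R J),
  mcoeff m (W v) = k0 * monev (fun i => lam (enum_val i)) m * mcoeff m v.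
Hypothesis lam_lt1 : forall j, `|lam j| < 1.
Hypothesis lam_neq0 : forall j, lam j != 0.
Variable P : pred J.

Definition ph_weight j : C := if P j then (lam j)^-1 else lam j.

Lemma lam_neq1 j : lam j != 1.
Proof. by apply: contraTneq (lam_lt1 j) => ->; rewrite normr1 ltxx. Qed.

Lemma ph_weight_neq1 j : ph_weight j != 1.
Proof. by rewrite /ph_weight; case: ifP; rewrite ?invr_eq1 lam_neq1. Qed.

Let lam_lt1' (i : 'I_#|J|) : `|lam (enum_val i)| < 1. Proof. exact: lam_lt1. Qed.
Let tlin := trace_linear W_diag lam_lt1'.

Lemma trace_W0 : trace (W * 0) = 0.
Proof.
have := tlin (-1) (tame0 R J) (tame0 R J).
by rewrite scaler0 addr0 mulN1r addNr.
Qed.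

Lemma trace_word_exchange :
  exchange (@ccr_coef J C) (fun w => trace (W * word (ph_letter P) w)).
Proof.
move=> u v l l'; set ell := ph_letter P.
have -> : word ell (u ++ l :: l' :: v) =
    ccr_coef C l l' *: word ell (u ++ v) + word ell (u ++ l' :: l :: v).
  rewrite !word_cat !word_cons !(mulrA (ell _)) (ph_letter_ccr P l l').
  by rewrite mulrDl mulrDr -scalerAl mul1r -scalerAr addrC.
by rewrite (tlin _ (tame_word P _) (tame_word P _)) addrC.
Qed.

Lemma trace_word_cyclic : twisted_cyclic (weight ph_weight)
  (fun w => trace (W * word (ph_letter P) w)).
Proof.
move=> [b j] w; rewrite word_cons word_rcons.
have t0 := trace_W0; have tw := tame_word P w; set X := word _ w in tw *.
have tN Y : tame Y -> trace (W * - Y) = - trace (W * Y).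
  move=> tY.
  by have := tlin (-1) tY (tame0 R J); rewrite scaleN1r addr0 mulN1r t0 addr0.
have cb := trace_abar_cyclic W_diag lam_lt1' j tw.
have ca := trace_ann_cyclic W_diag lam_lt1' j tw.
rewrite enum_rankK in cb ca; have l0 := lam_neq0 j.
rewrite /ph_letter /base_letter /weight /ph_weight /=.
case: (P j); case: b.
- rewrite mulrN mulNr !tN ?ca; [|exact: tameM_ann|exact: tame_annM].
  by rewrite mulrN mulKf.
- by rewrite invrK cb.
- exact: cb.
- by rewrite ca mulKf.
Qed.

Lemma related_trace (E' : algType C) (ell' : bool * J -> E')
    (F : {linear E' -> C^o}) (Y : E') : ccr ell' ->
    twisted_cyclic (weight ph_weight) (fun w => F (word ell' w * Y) : C) ->
  forall X X', related (ph_letter P) ell' X X' ->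
  trace_cvg (W * X) /\ trace (W * X) * F Y = F (X' * Y) * trace W :> C.
Proof.
move=> cc cyc _ _ [s [-> ->]].
suff [tX ->] : tame (evalw (ph_letter P) s) /\
    trace (W * evalw (ph_letter P) s) * F Y = F (evalw ell' s * Y) * trace W :> C.
  by split=> //; apply: tame_cvg tX; [exact: W_diag|exact: lam_lt1'].
elim: s => [|[c w] s [tIH IH]]; rewrite /evalw ?big_nil ?big_cons.
  split; first exact: tame0.
  rewrite mul0r linear0 mul0r.
  by rewrite trace_W0 mul0r.
rewrite -!/(evalw _ _) /=; split.
  by apply: tameD => //; apply: tameZ; apply: tame_word.
have := wick_unique (weight_neq1 ph_weight_neq1) trace_word_exchange
  trace_word_cyclic (ccr_exchange F Y cc) cyc w.
rewrite [word _ [::]]big_nil [word _ [::]]big_nil mulr1 mul1r => wu.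
have -> : F ((c *: word ell' w + evalw ell' s) * Y) =
    c * F (word ell' w * Y) + F (evalw ell' s * Y) :> C.
  by rewrite mulrDl linearD -scalerAl linearZ.
by rewrite (tlin _ (tame_word P _) tIH) mulrDl IH [RHS]mulrDl -!mulrA wu.
Qed.

End Oscillators.

Section ThermalState.
Variables (R : realType) (J : finType) (lam : J -> R[i]).
Local Notation C := R[i].
Local Notation E := (fock_end R (J + J)%type).
Implicit Types (X Y : E) (j : J).

Let cc j : E := base_letter R (true, inl j).
Let ca j : E := base_letter R (false, inl j).
Let dc j : E := base_letter R (true, inr j).
Let da j : E := base_letter R (false, inr j).

Definition occupation j : C := lam j / (1 - lam j).

Definition therm_letter (l : bool * J) : E :=
  if l.1 then (1 + occupation l.2) *: cc l.2 + occupation l.2 *: da l.2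
  else ca l.2 + dc l.2.

Definition tilde_letter (l : bool * J) : E :=
  if l.1 then da l.2 + cc l.2
  else (1 + occupation l.2) *: dc l.2 + occupation l.2 *: ca l.2.

Definition vev X : C^o := mcoeff (@mnm0 _) (X (1 : mpoly _ C)).

Fact vev_linear : linear vev.
Proof. by move=> c X Y; rewrite /vev /= mcoeffD mcoeffZ. Qed.
HB.instance Definition _ := GRing.isLinear.Build C E C^o _ vev vev_linear.

Lemma vev1 : vev 1 = 1.
Proof. by rewrite /vev /= mcoeff1 eqxx. Qed.

Let bb (l l' : bool * (J + J)) :
  bracket (base_letter R l) (base_letter R l') = (ccr_coef C l l')%:A.
Proof. by rewrite (ccrP _).1 //; apply: base_letter_ccr. Qed.

Ltac bracket_coef :=
  rewrite ?bracketE !bb /ccr_coef /= ?scalerA -!scalerDl -?scalerDl;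
  rewrite ?(inj_eq (@inl_inj _ _)) ?(inj_eq (@inr_inj _ _)) /=.

Lemma therm_letter_ccr : ccr therm_letter.
Proof.
apply/ccrP => -[[] i] [[] j]; rewrite /therm_letter /=; bracket_coef;
by congr (_ *: _); case: eqP => [e|_]; rewrite ?e; ring.
Qed.

Lemma therm_tilde_comm l l' : GRing.comm (therm_letter l) (tilde_letter l').
Proof.
apply/bracket_comm; case: l l' => [[] i] [[] j];
rewrite /therm_letter /tilde_letter /=; bracket_coef;
apply: (eq_trans _ (scale0r 1)); congr (_ *: _).
all: by case: eqP => [e|_]; rewrite ?e ?mulr0n ?mulr1n; ring.
Qed.

(** The commutant of the tilde letters, which contains the thermal letters; on
    it the vacuum expectation value is cyclic up to the weights. *)
Definition thermal X := forall l, GRing.comm X (tilde_letter l).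

Lemma thermal_letter l : thermal (therm_letter l).
Proof. by move=> l'; apply: therm_tilde_comm. Qed.

Lemma thermal_scalar c : thermal c%:A.
Proof. by move=> l; rewrite /GRing.comm -scalerAl mul1r -scalerAr mulr1. Qed.

Lemma thermal0 : thermal 0. Proof. by move=> l; apply: commr_sym; apply: commr0. Qed.
Lemma thermal1 : thermal 1. Proof. by move=> l; apply: commr_sym; apply: commr1. Qed.
Lemma thermalD X Y : thermal X -> thermal Y -> thermal (X + Y).
Proof. by move=> hX hY l; apply: commr_sym; apply: commrD; apply: commr_sym. Qed.
Lemma thermalM X Y : thermal X -> thermal Y -> thermal (X * Y).
Proof. by move=> hX hY l; apply: commr_sym; apply: commrM; apply: commr_sym. Qed.
Lemma thermalZ c X : thermal X -> thermal (c *: X).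
Proof. by move=> hX l; rewrite /GRing.comm -scalerAl hX -scalerAr. Qed.
Lemma thermalN X : thermal X -> thermal (- X).
Proof. by rewrite -scaleN1r; apply: thermalZ. Qed.

Lemma vev_abarM s X : vev (abar R s * X) = 0.
Proof. by rewrite /vev -mpolyX0 [LHS]entry_abarM0 // mnm0E. Qed.

Lemma vevM_ann s X : vev (X * ann R s) = 0.
Proof. by rewrite /vev -mpolyX0 [LHS]entryM_ann mnm0E mul0r. Qed.

Lemma vev_bar_cyclic j X : lam j != 1 -> thermal X ->
  vev (therm_letter (true, j) * X) = lam j * vev (X * therm_letter (true, j)) :> C.
Proof.
move=> l1 tX; have l1' : 1 - lam j != 0 by rewrite subr_eq0 eq_sym.
rewrite /therm_letter /= mulrDl mulrDr !linearD /= -!scalerAl -!scalerAr !linearZ /=.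
rewrite [vev (cc j * X)]vev_abarM [vev (X * da j)]vevM_ann !scaler0 add0r addr0.
have -> : vev (da j * X) = vev (X * cc j).
  have := congr1 vev (tX (true, j)); rewrite /tilde_letter /= mulrDl mulrDr !linearD /=.
  by rewrite [vev (cc j * X)]vev_abarM [vev (X * da j)]vevM_ann add0r addr0.
rewrite /occupation; set v := vev _.
transitivity (lam j / (1 - lam j) * v : C) => //.
transitivity (lam j * ((1 + lam j / (1 - lam j)) * v) : C) => //.
by field.
Qed.

Lemma vev_ann_cyclic j X : lam j != 1 -> thermal X ->
  vev (X * therm_letter (false, j)) = lam j * vev (therm_letter (false, j) * X) :> C.
Proof.
move=> l1 tX; have l1' : 1 - lam j != 0 by rewrite subr_eq0 eq_sym.
rewrite /therm_letter /= mulrDl mulrDr !linearD /=.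
rewrite [vev (dc j * X)]vev_abarM [vev (X * ca j)]vevM_ann add0r addr0.
have := congr1 vev (tX (false, j)); rewrite /tilde_letter /= mulrDl mulrDr !linearD /=.
rewrite -!scalerAl -!scalerAr !linearZ /=.
rewrite [vev (dc j * X)]vev_abarM [vev (X * ca j)]vevM_ann !scaler0 add0r addr0.
set u := vev _; set v := vev _ => /esym e.
have {}e : (1 + occupation j) * (u : C) = occupation j * (v : C) by [].
have e2 : 1 + occupation j = (1 - lam j)^-1 by rewrite /occupation; field.
have : (1 - lam j)^-1 != 0 by rewrite invr_eq0.
move=> /mulfI; apply; rewrite -e2 e /occupation mulrCA mulrA.
by rewrite e2; ring.
Qed.

(** [homogeneous z Y] : moving Y around the vacuum expectation value multiplies
    it by z, as if Y were an eigenvector of weight z of the twist. *)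
Definition homogeneous (z : C) Y :=
  thermal Y /\ forall X, thermal X -> vev (Y * X) = z * vev (X * Y) :> C.

Lemma homogeneousD z Y Y' :
  homogeneous z Y -> homogeneous z Y' -> homogeneous z (Y + Y').
Proof.
move=> [tY hY] [tY' hY']; split=> [|X tX]; first exact: thermalD.
by rewrite mulrDl mulrDr !linearD /= hY // hY' // -mulrDr.
Qed.

Lemma homogeneousZ c z Y : homogeneous z Y -> homogeneous z (c *: Y).
Proof.
move=> [tY hY]; split=> [|X tX]; first exact: thermalZ.
rewrite -scalerAl -scalerAr !linearZ /= hY //.
exact: (mulrCA c z _).
Qed.

Lemma homogeneousN z Y : homogeneous z Y -> homogeneous z (- Y).
Proof. by rewrite -scaleN1r; apply: homogeneousZ. Qed.

Lemma homogeneous_letter l : lam l.2 != 0 -> lam l.2 != 1 ->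
  homogeneous (weight lam l) (therm_letter l).
Proof.
case: l => [[] j] /= l0 l1; split; try exact: thermal_letter; move=> X tX.
  exact: vev_bar_cyclic.
by rewrite /weight /= vev_ann_cyclic // mulKf.
Qed.

Lemma thermal_word (L : Type) (ell : L -> E) w :
  (forall l, thermal (ell l)) -> thermal (word ell w).
Proof.
move=> h; elim: w => [|l w IH]; first by rewrite /word big_nil; apply: thermal1.
by rewrite word_cons; apply: thermalM.
Qed.

Lemma vev_twisted_cyclic (L : Type) (ell : L -> E) (z : L -> C) Y :
  (forall l, homogeneous (z l) (ell l)) -> thermal Y ->
  (forall l, GRing.comm (ell l) Y) ->
  twisted_cyclic z (fun w => vev (word ell w * Y) : C).
Proof.
move=> hl tY cY l w; rewrite word_cons word_rcons -!mulrA.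
rewrite (hl l).2 -?mulrA ?cY //; apply: thermalM => //.
by apply: thermal_word => l'; case: (hl l').
Qed.

End ThermalState.

Section Exponential.
Variable R : realType.
Local Notation C := R[i].
Implicit Types z : C.

Lemma expCD z w : expC (z + w) = expC z * expC w.
Proof.
case: z w => a b [c d]; rewrite /expC /= expRD cosD sinD.
by apply/eqP; rewrite eq_complex /=; apply/andP; split; apply/eqP; ring.
Qed.

Lemma expC0 : expC 0 = 1 :> C.
Proof.
rewrite /expC /= expR0 cos0 sin0.
by apply/eqP; rewrite eq_complex /=; apply/andP; split; apply/eqP; ring.
Qed.

Lemma expC_neq0 z : expC z != 0.
Proof.
have: expC z * expC (- z) != 0 by rewrite -expCD subrr expC0 oner_eq0.
by rewrite mulf_eq0 negb_or => /andP[].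
Qed.

Lemma expCN z : expC (- z) = (expC z)^-1.
Proof.
by apply: (mulfI (expC_neq0 z)); rewrite -expCD subrr expC0 divff ?expC_neq0.
Qed.

Lemma expC_int z (n : int) : expC (z * n%:~R) = expC z ^ n.
Proof.
have expCn k : expC (z * k%:R) = expC z ^+ k.
  elim: k => [|k IH]; first by rewrite mulr0 expC0 expr0.
  by rewrite -natr1 mulrDr mulr1 expCD IH exprSr.
case: n => k; first exact: expCn.
by rewrite NegzE mulrNz mulrN expCN expCn exprnN.
Qed.

Lemma normc_i_eq (a b : R) : `|(a +i* b)%C| = (Num.sqrt (a ^+ 2 + b ^+ 2))%:C%C.
Proof. by rewrite normc_def. Qed.

Lemma expC_onto z : 0 < complex.Re z -> exists w, expC w = z.
Proof.
case: z => x y /= x0; pose q := Num.sqrt (1 + (y / x) ^+ 2).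
have q0 : 0 < q by rewrite sqrtr_gt0 ltr_pwDl // sqr_ge0.
exists (ln (x * q) +i* atan (y / x))%C.
have qE : cos (atan (y / x)) = q^-1 by rewrite cos_atan.
have sE : sin (atan (y / x)) = (y / x) * q^-1.
  have c0 : cos (atan (y / x)) != 0 by rewrite qE invr_eq0 gt_eqF.
  by rewrite -[in RHS](atanK (y / x)) /tan qE divfK // invr_eq0 gt_eqF.
rewrite /expC /= lnK ?posrE ?mulr_gt0 // qE sE.
have xn : x != 0 by rewrite gt_eqF.
have qn : q != 0 by rewrite gt_eqF.
by apply/eqP; rewrite eq_complex /=; apply/andP; split; apply/eqP; field; rewrite ?xn ?qn.
Qed.

Lemma vanishes_on_line r (P : mpoly r C) (b v : 'I_r -> C) (s : nat -> C) :
  injective s -> (forall k, meval (fun i => b i + s k * v i) P = 0) ->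
  forall z, meval (fun i => b i + z * v i) P = 0.
Proof.
move=> s_inj Ps; pose q : {poly C} :=
  \sum_(m <- msupp P) (mcoeff m P)%:P * \prod_i ((b i)%:P + 'X * (v i)%:P) ^+ m i.
have qE z : q.[z] = meval (fun i => b i + z * v i) P.
  rewrite horner_sum mevalE; apply: eq_bigr => m _.
  rewrite hornerM hornerC horner_prod; congr (_ * _); apply: eq_bigr => i _.
  by rewrite horner_exp !hornerE.
move=> z; rewrite -qE; suff -> : q = 0 by rewrite horner0.
apply/eqP; apply: contraT => q0.
have := @max_poly_roots _ q [seq s k | k <- iota 0 (size q)] q0.
rewrite size_map size_iota ltnn; apply.
  by apply/allP => _ /mapP[k _ ->]; rewrite /root qE Ps.
by rewrite map_inj_uniq // iota_uniq.
Qed.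

Lemma vanishes_on_domain r (P : mpoly r C) :
  (forall th, cl_domain th -> meval (tau_of th) P = 0) ->
  forall tau, meval tau P = 0.
Proof.
move=> Pdom tau; pose b (i : 'I_r) : R := (r - i).+1%:R.
pose v i := tau i - (b i)%:C%C.
have [M hM] : exists M : nat, forall i, normR (v i) <= M%:R.
  exists (Num.truncn (\sum_i normR (v i))).+1 => i.
  apply: (@le_trans _ _ (\sum_i normR (v i))); last by rewrite ltW // truncnS_gt.
  by rewrite (bigD1 i) //= lerDl sumr_ge0 // => j _; apply: normR_ge0.
pose s k : R := (3 * (M + k.+1))%:R^-1.
have s0 k : 0 < s k by rewrite invr_gt0 ltr0n; lia.
have -> : tau = (fun i => (b i)%:C%C + 1 * v i).
  by apply/funext => i; rewrite mul1r /v addrC subrK.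
apply: (@vanishes_on_line _ P _ v (fun k => (s k)%:C%C)).
  move=> k l [] /invr_inj /eqP; rewrite eqr_nat; lia.
move=> k; pose t i := (b i)%:C%C + (s k)%:C%C * v i.
have small i : normR ((s k)%:C%C * v i) <= 3^-1.
  rewrite -lecR -normRE normrM normc_def /= expr0n addr0 sqrtr_sqr.
  rewrite normRE -rmorphM lecR ger0_norm ?(ltW (s0 k)) //.
  apply: (@le_trans _ _ (s k * M%:R)); first by rewrite ler_wpM2l // ltW.
  rewrite /s mulrC ler_pdivrMr ?ltr0n; last by lia.
  by rewrite natrM mulrA mulVf ?pnatr_eq0 // mul1r ler_nat; lia.
have t_le i : normR (t i) <= b i + 3^-1.
  rewrite -lecR -normRE rmorphD /=; apply: le_trans (ler_normD _ _) _.
  rewrite lerD //; last by rewrite normRE lecR.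
  by rewrite normc_def /= expr0n addr0 sqrtr_sqr ger0_norm.
have t_ge i : b i - 3^-1 <= normR (t i).
  have h : `|(b i)%:C%C| = (b i)%:C%C :> C.
    by rewrite normc_def /= expr0n addr0 sqrtr_sqr ger0_norm.
  have := ler_normB (t i) ((s k)%:C%C * v i); rewrite {1}/t addrK h !normRE.
  rewrite -rmorphD lecR; have := small i; lra.
have t_re i : 0 < complex.Re (t i).
  have := normc_ge_Re ((s k)%:C%C * v i); rewrite normRE lecR.
  have := small i; have : 1 <= b i by rewrite ler1n.
  have -> : complex.Re (t i) = b i + complex.Re ((s k)%:C%C * v i).
    by rewrite /t; case: (_ * _).
  have := ler_norm (- complex.Re ((s k)%:C%C * v i)); rewrite normrN; lra.
have [th hth] : exists th, forall i, expC (th i) = t i.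
  have [|th hth] := @boolp.choice _ _ (fun i z => expC z = t i).
    by move=> i; apply: expC_onto.
  by exists th.
transitivity (meval (tau_of th) P).
  by congr (meval _ P); apply/funext => i; rewrite /tau_of hth.
apply: Pdom; split=> [i j ij|i]; rewrite /tau_of !hth normRE.
  rewrite normRE ltcR; have := t_le j; have := t_ge i.
  have : b j + 1 <= b i by rewrite natr1 ler_nat; have := ltn_ord j; lia.
  lra.
rewrite (_ : 1 = 1%:C%C) // ltcR; have := t_ge i.
have : 2 <= b i by rewrite ler_nat; have := ltn_ord i; lia.
lra.
Qed.

End Exponential.

Section Unique.
Variables (C : fieldType) (J : finType) (E1 E2 : algType C).
Variables (l1 : bool * J -> E1) (l2 : bool * J -> E2).
Variables (F1 : {linear E1 -> C^o}) (F2 : {linear E2 -> C^o}) (Y1 : E1) (Y2 : E2).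
Variable z : J -> C.
Hypotheses (cc1 : ccr l1) (cc2 : ccr l2) (z1 : forall j, z j != 1).
Hypothesis cyc1 : twisted_cyclic (weight z) (fun w => F1 (word l1 w * Y1) : C).
Hypothesis cyc2 : twisted_cyclic (weight z) (fun w => F2 (word l2 w * Y2) : C).

Lemma related_functional X X' : related l1 l2 X X' ->
  F1 (X * Y1) * F2 Y2 = F2 (X' * Y2) * F1 Y1 :> C.
Proof.
case=> s [-> ->] {X X'}; elim: s => [|[c w] s IH]; rewrite /evalw ?big_nil ?big_cons.
  by rewrite !mul0r !linear0 !mul0r.
rewrite -!/(evalw _ _) /=.
have e (E : algType C) (F : {linear E -> C^o}) A B Y :
    F ((c *: A + B) * Y) = c * F (A * Y) + F (B * Y) :> C.
  by rewrite mulrDl linearD -scalerAl linearZ.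
rewrite !e mulrDl IH [RHS]mulrDl -!mulrA.
have := wick_unique (weight_neq1 z1) (ccr_exchange F1 Y1 cc1) cyc1
  (ccr_exchange F2 Y2 cc2) cyc2 w.
by rewrite [word _ [::]]big_nil [word _ [::]]big_nil !mul1r => ->.
Qed.

End Unique.

Section Rational.
Variables (R : realType) (r : nat) (J : finType) (wt : J -> 'I_r -> int).
Local Notation C := R[i].
Implicit Types (tau th : 'I_r -> C) (j : J) (h : ('I_r -> C) -> C).

Definition wlam tau j : C := \prod_i tau i ^ wt j i.

Definition posz_part (z : int) : nat := if z is Posz n then n else 0%N.
Definition negz_part (z : int) : nat := if z is Negz n then n.+1 else 0%N.

Let X i : mpoly r C := mpolyX _ (mnm1 i).
Let num j : mpoly r C := \prod_i X i ^+ posz_part (wt j i).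
Let den j : mpoly r C := \prod_i X i ^+ negz_part (wt j i).
Let q0 : mpoly r C := locked ((\prod_i X i) * \prod_j (den j - num j)).

Let evX tau i : meval tau (X i) = tau i.
Proof. by rewrite mevalXU. Qed.

Let wlam_frac tau j : (forall i, tau i != 0) ->
  meval tau (den j) != 0 /\ wlam tau j = meval tau (num j) / meval tau (den j).
Proof.
move=> t0; rewrite !rmorph_prod /=; split.
  by apply/prodf_neq0 => i _; rewrite rmorphXn /= evX expf_neq0.
rewrite -prodf_div; apply: eq_bigr => i _; rewrite !rmorphXn /= evX.
by case: (wt j i) => n /=; rewrite expr0 ?divr1 // NegzE -exprnN div1r.
Qed.

Let regular tau := meval tau q0 != 0.

Let regularP tau : regular tau <->
  (forall i, tau i != 0) /\ (forall j, wlam tau j != 1).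
Proof.
rewrite /regular /q0 -lock rmorphM /= mulf_eq0 negb_or !rmorph_prod /=.
split=> [/andP[/prodf_neq0 h1 /prodf_neq0 h2]|[h1 h2]].
  have t0 i : tau i != 0 by have := h1 i isT; rewrite evX.
  split=> // j; have [d0 ->] := wlam_frac j t0; have := h2 j isT.
  by rewrite rmorphB /= subr_eq0 eq_sym; apply: contraNneq => /divr1_eq ->.
apply/andP; split; apply/prodf_neq0; first by move=> i _; rewrite evX.
move=> j _; have [d0 e] := wlam_frac j h1; have := h2 j; rewrite e => n1.
rewrite rmorphB /= subr_eq0 eq_sym; apply: contraNneq n1 => ->.
by rewrite divff.
Qed.

Let ratl h := exists p k, forall tau, regular tau ->
  h tau = meval tau p / meval tau q0 ^+ k.

Let ratl_poly p : ratl (fun tau => meval tau p).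
Proof. by exists p, 0%N => tau _; rewrite expr0 divr1. Qed.

Let ratl_const c : ratl (fun=> c).
Proof. by exists (mpolyC r c), 0%N => tau _; rewrite mevalC expr0 divr1. Qed.

Let ratlD g h : ratl g -> ratl h -> ratl (fun x => g x + h x).
Proof.
move=> [p [k Hp]] [p' [k' Hp']]; exists (p * q0 ^+ k' + p' * q0 ^+ k), (k + k')%N.
move=> tau rt; rewrite Hp // Hp' // rmorphD !rmorphM !rmorphXn /= exprD.
by rewrite addf_div ?expf_neq0.
Qed.

Let ratlM g h : ratl g -> ratl h -> ratl (fun x => g x * h x).
Proof.
move=> [p [k Hp]] [p' [k' Hp']]; exists (p * p'), (k + k')%N.
by move=> tau rt; rewrite Hp // Hp' // rmorphM /= exprD mulf_div.
Qed.

Let ratl_ext g h : (forall x, regular x -> g x = h x) -> ratl g -> ratl h.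
Proof. by move=> gh [p [k Hp]]; exists p, k => tau rt; rewrite -gh // Hp. Qed.

Let ratl_inv j : ratl (fun tau => (meval tau (den j - num j))^-1).
Proof.
exists ((\prod_i X i) * \prod_(j' | j' != j) (den j' - num j')), 1%N => tau rt.
have q0E : q0 = (den j - num j) * ((\prod_i X i) * \prod_(j' | j' != j) (den j' - num j')).
  by rewrite /q0 -lock (bigD1 j) //= mulrCA.
have : regular tau by []; rewrite /regular q0E rmorphM /= mulf_eq0 negb_or.
move=> /andP[h1 h2]; by rewrite expr1 invfM mulrCA mulfV // mulr1.
Qed.

Let ratl_weight (l : bool * J) :
  ratl (fun tau => weight (wlam tau) l / (1 - weight (wlam tau) l)).
Proof.
case: l => b j; rewrite /weight /=.
have P1 := ratlM (ratl_poly (if b then num j else - den j)) (ratl_inv j).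
apply: ratl_ext P1 => tau rt; have [t0 t1] := (regularP tau).1 rt.
have [d0 e] := wlam_frac j t0; have := t1 j; rewrite e => n1.
have dn : meval tau (den j) - meval tau (num j) != 0.
  by rewrite subr_eq0 eq_sym; apply: contraNneq n1 => ->; rewrite divff.
have n0 : meval tau (num j) != 0.
  rewrite rmorph_prod; apply/prodf_neq0 => i _.
  by rewrite rmorphXn /= evX expf_neq0.
rewrite rmorphB /=; case: b; rewrite ?rmorphN /=; field; rewrite ?d0 ?n0 dn //=.
by rewrite andbT -opprB oppr_eq0 dn.
Qed.

Let thermal_vev tau w := vev (word (therm_letter (wlam tau)) w) : C.

Let wlam_neq0 tau j : (forall i, tau i != 0) -> wlam tau j != 0.
Proof. by move=> t0; apply/prodf_neq0 => i _; apply: expfz_neq0. Qed.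

Let thermal_cyclic tau Y : regular tau ->
   thermal (wlam tau) Y -> (forall l, GRing.comm (therm_letter (wlam tau) l) Y) ->
  twisted_cyclic (weight (wlam tau))
    (fun w => vev (word (therm_letter (wlam tau)) w * Y) : C).
Proof.
move=> /regularP[t0 t1]; apply: vev_twisted_cyclic => l.
by apply: homogeneous_letter; [exact: wlam_neq0|].
Qed.

Let thermal_vev_rational w : ratl (fun tau => thermal_vev tau w).
Proof.
apply: (@wick_closed C (bool * J)%type ('I_r -> C) regular ratl
  (fun tau => weight (wlam tau)) (@ccr_coef J C) thermal_vev) => //.
move=> tau rt; have [t0 t1] := (regularP tau).1 rt; split.
- exact: ccr_exchange1 (therm_letter_ccr (wlam tau)).
- have := thermal_cyclic rt (thermal1 _) (fun l => commr1 _).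
  by move=> h l w'; have := h l w'; rewrite !mulr1.
- by rewrite /thermal_vev [word _ _]big_nil vev1.
exact: weight_neq1.
Qed.

Variables (dom : ('I_r -> C) -> Prop) (D : ('I_r -> C) -> fock_end R J).
Variable kD : ('I_r -> C) -> C.
Hypothesis dom_sub : forall th, cl_domain th -> dom th.
Hypothesis kD_neq0 : forall th, kD th != 0.
Hypothesis D_diag : forall th, dom th -> forall m (v : fock R J),
  mcoeff m (D th v)
    = kD th * monev (fun i => wlam (tau_of th) (enum_val i)) m * mcoeff m v.
Hypothesis wlam_lt1 : forall th, dom th -> forall j, `|wlam (tau_of th) j| < 1.

(** The normalised trace of a word is determined by the commutation relations
    and the cyclicity of the trace, so that it equals, after continuation in tau,
    the value of any functional with the same properties. *)
Lemma ntrace_related (E' : algType C) (ell' : bool * J -> E')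
    (F : {linear E' -> C^o}) (Y : E') tau : ccr ell' ->
    (forall i, tau i != 0) -> (forall j, wlam tau j != 1) ->
    twisted_cyclic (weight (wlam tau)) (fun w => F (word ell' w * Y) : C) ->
  forall Z Z', related (ph_letter R (pred0 : pred J)) ell' Z Z' ->
  ntrace dom D Z tau * F Y = F (Z' * Y) :> C.
Proof.
move=> cc t0 t1 cyc _ _ [s [-> ->]].
have rt : regular tau by apply/regularP.
pose h tau := vev (evalw (therm_letter (wlam tau)) s) : C.
have rh : ratl h.
  rewrite /h; elim: (s) => [|[c w] s' IH].
    apply: ratl_ext (ratl_const 0) => t _.
    by rewrite /evalw big_nil linear0.
  apply: ratl_ext (ratlD (ratlM (ratl_const c) (thermal_vev_rational w)) IH) => t _.
  by rewrite /evalw big_cons linearD linearZ.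
have [p [k hp]] := rh.
have dom_tau th : forall i, tau_of th i != 0.
  by move=> i; apply: expC_neq0.
have lam0 th j : wlam (tau_of th) j != 0 by apply: wlam_neq0.
have reg_dom th : dom th -> regular (tau_of th).
  move=> dth; apply/regularP; split=> // j; apply: contraTneq (wlam_lt1 dth j) => ->.
  by rewrite normr1 ltxx.
have trD th : dom th -> trace (D th * evalw (ph_letter R (pred0 : pred J)) s) / trace (D th)
     = h (tau_of th).
  move=> dth; have rd := reg_dom _ dth.
  have cyc1 := thermal_cyclic rd (thermal1 _) (fun l => commr1 _).
  have := related_trace (D_diag dth) (wlam_lt1 dth) (lam0 th) (P := pred0)
    (F := (@vev R J : {linear fock_end R (J + J)%type -> C^o})) (Y := 1) (therm_letter_ccr (wlam (tau_of th))) cyc1.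
  move=> /(_ (evalw (ph_letter R (pred0 : pred J)) s)
             (evalw (therm_letter (wlam (tau_of th))) s)) [].
    by exists s.
  rewrite /= vev1 !mulr1 => _ ->; rewrite mulfK //.
  by apply: trace_neq0 (D_diag dth) _ (kD_neq0 th) => i; apply: wlam_lt1.
have -> : ntrace dom D (evalw (ph_letter R (pred0 : pred J)) s) tau = h tau.
  apply: xget_unique.
    exists p, (q0 ^+ k); split.
    - by rewrite rmorphXn expf_neq0.
    - by rewrite hp // rmorphXn.
    move=> th dth; rewrite rmorphXn expf_neq0 ?trD ?hp //; exact: reg_dom.
  move=> z [p' [q' [q'0 -> H]]].
  have : meval tau (p' * q0 ^+ k - p * q') = 0.
    apply: vanishes_on_domain => th /dom_sub dth.
    have [q1 e] := H th dth; rewrite trD // hp in e; last exact: reg_dom.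
    rewrite rmorphB !rmorphM rmorphXn /=.
    have q2 : meval (tau_of th) q0 ^+ k != 0 by apply: expf_neq0; apply: reg_dom.
    move/eqP: e; rewrite eqr_div // => /eqP ->; exact: subrr.
  rewrite rmorphB !rmorphM rmorphXn /= => /subr0_eq e; rewrite hp //.
  by apply/eqP; rewrite eqr_div ?e //; apply: expf_neq0.
have := related_functional (therm_letter_ccr (wlam tau)) cc t1
  (thermal_cyclic rt (thermal1 _) (fun l => commr1 _)) cyc.
move=> /(_ (evalw (therm_letter (wlam tau)) s) (evalw ell' s)) e.
by have := e (ex_intro _ s (conj erefl erefl)); rewrite mulr1 /= vev1 mulr1.
Qed.

End Rational.

Section Diagonal.
Variables (R : realType) (J : finType).
Local Notation C := R[i].
Local Notation E := (fock_end R J).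
Implicit Types (W X : E) (k c : C) (lam : J -> C) (w : J -> int) (j : J).

Definition diag_op W k lam := forall m (v : fock R J),
  mcoeff m (W v) = k * monev (fun i => lam (enum_val i)) m * mcoeff m v.

Lemma diagonal1 : diag_op 1 1 (fun=> 1).
Proof.
move=> m v; rewrite /monev big1 ?mul1r // => i _; by rewrite expr1n.
Qed.

Lemma diagonalM W W' k k' lam lam' : diag_op W k lam -> diag_op W' k' lam' ->
  diag_op (W * W') (k * k') (fun j => lam j * lam' j).
Proof.
move=> h h' m v; rewrite /= h h'.
have -> : monev (fun i => lam (enum_val i) * lam' (enum_val i)) m
    = monev (fun i => lam (enum_val i)) m * monev (fun i => lam' (enum_val i)) m.
  by rewrite /monev -big_split; apply: eq_bigr => i _; rewrite exprMn.
by ring.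
Qed.

Lemma diagonal_prod (I : Type) (s : seq I) (P : pred I) (W : I -> E) (k : I -> C)
    (lam : I -> J -> C) :
  (forall i, P i -> diag_op (W i) (k i) (lam i)) ->
  diag_op (\prod_(i <- s | P i) W i) (\prod_(i <- s | P i) k i)
    (fun j => \prod_(i <- s | P i) lam i j).
Proof.
move=> h; elim: s => [|i s IH].
  have -> : (fun j => \prod_(i <- [::] | P i) lam i j) = (fun=> 1).
    by apply/funext => j; rewrite big_nil.
  by rewrite !big_nil; apply: diagonal1.
have [Pi|nPi] := boolP (P i).
  have -> : (fun j => \prod_(i <- i :: s | P i) lam i j)
      = (fun j => lam i j * \prod_(i <- s | P i) lam i j).
    by apply/funext => j; rewrite big_cons Pi.
  by rewrite !big_cons Pi; apply: diagonalM => //; apply: h.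
have -> : (fun j => \prod_(i <- i :: s | P i) lam i j)
    = (fun j => \prod_(i <- s | P i) lam i j).
  by apply/funext => j; rewrite big_cons (negPf nPi).
by rewrite !big_cons (negPf nPi).
Qed.

(** The diag_op of X is an affine function of the occupation numbers, with
    integral slopes. *)
Definition affine X c w := forall m,
  diag_coef X m = c + \sum_j (w j)%:~R * (m (enum_rank j))%:R.

Lemma affine_scalar c : affine c%:A c (fun=> 0).
Proof.
move=> m; rewrite /diag_coef /= mcoeffZ mcoeffX eqxx mulr1 big1 ?addr0 // => j _.
by rewrite mul0r.
Qed.

Lemma affineD X X' c c' w w' : affine X c w -> affine X' c' w' ->
  affine (X + X') (c + c') (fun j => w j + w' j).
Proof.
move=> h h' m; have := h m; have := h' m; rewrite /diag_coef /= mcoeffD => -> ->.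
by rewrite addrACA -big_split; congr (_ + _); apply: eq_bigr => j _; rewrite intrD mulrDl.
Qed.

Lemma affineN X c w : affine X c w -> affine (- X) (- c) (fun j => - w j).
Proof.
move=> h m; have := h m; rewrite /diag_coef /= mcoeffN => ->.
rewrite opprD -sumrN; congr (_ + _); apply: eq_bigr => j _.
by rewrite intrN mulNr.
Qed.

Lemma affine_ext X c w w' : affine X c w -> w =1 w' -> affine X c w'.
Proof. by move=> h e m; rewrite h; congr (_ + _); apply: eq_bigr => j _; rewrite e. Qed.

Lemma affine_sum (I : Type) (s : seq I) (P : pred I) (X : I -> E) (c : I -> C)
    (w : I -> J -> int) :
  (forall i, P i -> affine (X i) (c i) (w i)) ->
  affine (\sum_(i <- s | P i) X i) (\sum_(i <- s | P i) c i)
    (fun j => \sum_(i <- s | P i) w i j).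
Proof.
move=> h; elim: s => [|i s IH].
  rewrite !big_nil; have := affine_scalar 0; rewrite scale0r => h0.
  by apply: affine_ext h0 _ => j; rewrite big_nil.
rewrite !big_cons; case: ifP => Pi.
  by apply: affine_ext (affineD (h i Pi) IH) _ => j; rewrite big_cons Pi.
by apply: affine_ext IH _ => j; rewrite big_cons Pi.
Qed.

Lemma affine_number j : affine (abar R j * ann R j) 0 (fun j' => (j == j')%:R).
Proof.
move=> m; rewrite add0r (bigD1 j) //= eqxx mul1r big1 ?addr0; last first.
  by move=> j' /negPf; rewrite eq_sym => ->; rewrite mul0r.
have -> : diag_coef (abar R j * ann R j) m = entry (abar R j * ann R j) m m by [].
rewrite entryM_ann; have [->|mj] := eqVneq (m (enum_rank j)) 0%N.
  by rewrite mul0r.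
rewrite -{2}(mnm_subK mj) -[abar R j]mulr1 entry_abarM entry1 eqxx mulr1 //.
Qed.

Lemma affine_conumber j : affine (ann R j * abar R j) 1 (fun j' => (j == j')%:R).
Proof.
have := bracket_ann_abar R j j; rewrite eqxx scale1r => /(canRL (subrK _)) ->.
have := affineD (affine_scalar 1) (affine_number j); rewrite scale1r addr0.
by move=> h; apply: affine_ext h _ => j'; rewrite add0r.
Qed.

(** After the particle-hole exchange, the product abar a becomes - a abar. *)
Definition ph_sign (P : pred J) j : int := if P j then -1 else 1.

Lemma affine_ph_number P j :
  affine (ph_letter R P (true, j) * ph_letter R P (false, j)) (- (P j)%:R)
    (fun j' => ph_sign P j * (j == j')%:R).
Proof.
rewrite /ph_letter /base_letter /ph_sign /=; case: (P j).
  rewrite mulNr; apply: affine_ext (affineN (affine_conumber j)) _ => j'.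
  by rewrite mulN1r.
by rewrite oppr0; apply: affine_ext (affine_number j) _ => j'; rewrite mul1r.
Qed.

Lemma affine_ph_conumber P j :
  affine (ph_letter R P (false, j) * ph_letter R P (true, j)) (1 - (P j)%:R)
    (fun j' => ph_sign P j * (j == j')%:R).
Proof.
rewrite /ph_letter /base_letter /ph_sign /=; case: (P j).
  rewrite mulrN subrr -[0]oppr0; apply: affine_ext (affineN (affine_number j)) _ => j'.
  by rewrite mulN1r.
by rewrite subr0; apply: affine_ext (affine_conumber j) _ => j'; rewrite mul1r.
Qed.

Lemma diagonal_opexp z X c w : affine X c w ->
  diag_op (opexp z X) (expC (z * c)) (fun j => expC z ^ w j).
Proof.
move=> h m v; rewrite /= mcoeff_opexp mulrC; congr (_ * _).
rewrite h mulrDr expCD; congr (_ * _); rewrite mulr_sumr /monev.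
rewrite (reindex (@enum_val J J)) /=; last first.
  exists enum_rank => [i _|j _]; [exact: enum_valK|exact: enum_rankK].
elim/big_rec2: _ => [|i x y _ <-]; first by rewrite expC0.
rewrite expCD enum_valK; congr (_ * _).
by rewrite mulrA -[(m i)%:R]/((m i)%:Z%:~R) !expC_int.
Qed.

End Diagonal.

Section Continues.
Variables (R : realType) (J : finType).
Local Notation C := R[i].

(** [continues ell z phi c] : on the span of the words in ell, phi is c times the
    normalised functional that any algebra with the same commutation relations
    and the same weights carries. *)
Definition continues (E : algType C) (ell : bool * J -> E) (z : J -> C)
    (phi : E -> C) (c : C) :=
  forall (J' : finType) (ell' : bool * J -> fock_end R (J' + J')%type) Y,
    ccr ell' -> twisted_cyclic (weight z) (fun w => vev (word ell' w * Y) : C) ->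
  forall X X', related ell ell' X X' -> phi X * vev Y = vev (X' * Y) * c :> C.

Lemma trace_continues (W : fock_end R J) k lam (P : pred J) :
  diag_op W k lam -> (forall j, `|lam j| < 1) -> (forall j, lam j != 0) ->
  continues (ph_letter R P) (ph_weight lam P) (fun X => trace (W * X)) (trace W) .
Proof.
move=> dW l1 l0 J' ell' Y cc cyc X X' r.
exact: (related_trace dW l1 l0 (P := P)
  (F := (@vev R J' : {linear fock_end R (J' + J')%type -> C^o})) cc cyc r).2.
Qed.

Lemma tame_trace_cvg (W : fock_end R J) k lam X :
  diag_op W k lam -> (forall j, `|lam j| < 1) -> tame X -> trace_cvg (W * X).
Proof. by move=> dW l1 tX; apply: tame_cvg dW _ _ tX => i; apply: l1. Qed.

Lemma tame_related (E' : algType C) (P : pred J) ell' X X' :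
  related (ph_letter R P) (ell' : bool * J -> E') X X' -> tame X.
Proof.
case=> s [-> _]; elim: s => [|[c w] s IH]; rewrite /evalw ?big_nil ?big_cons.
  exact: tame0.
by apply: tameD => //; apply: tameZ; apply: tame_word.
Qed.

Lemma ntrace_continues r (wt : J -> 'I_r -> int) (dom : ('I_r -> C) -> Prop)
    (D : ('I_r -> C) -> fock_end R J) kD tau :
  (forall th, cl_domain th -> dom th) -> (forall th, kD th != 0) ->
  (forall th, dom th -> diag_op (D th) (kD th) (wlam wt (tau_of th))) ->
  (forall th, dom th -> forall j, `|wlam wt (tau_of th) j| < 1) ->
  (forall i, tau i != 0) -> (forall j, wlam wt tau j != 1) ->
  continues (ph_letter R (pred0 : pred J)) (wlam wt tau)
    (fun X => ntrace dom D X tau) 1.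
Proof.
move=> ds k0 dD l1 t0 t1 J' ell' Y cc cyc X X' r'; rewrite mulr1.
exact: (ntrace_related ds k0 dD l1 
  (F := (@vev R J' : {linear fock_end R (J' + J')%type -> C^o})) cc t0 t1 cyc r').
Qed.

End Continues.

Section Tensor.
Variables (C : fieldType) (E : algType C).

Definition scal_mx m n (B : 'M[C]_(m, n)) : 'M[E]_(m, n) := map_mx (fun k => k%:A) B.

Lemma scal_mxM m n p (A : 'M[C]_(m, n)) (B : 'M_(n, p)) :
  scal_mx (A *m B) = scal_mx A *m scal_mx B.
Proof.
apply/matrixP => i j; rewrite !mxE scaler_suml; apply: eq_bigr => k _.
by rewrite !mxE -scalerAl mul1r scalerA.
Qed.

Lemma scal_mx1 n : scal_mx 1%:M = 1%:M :> 'M[E]_n.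
Proof.
by apply/matrixP => i j; rewrite !mxE; case: eqP; rewrite ?scale1r ?scale0r.
Qed.

Lemma comm_scalar (k : C) (X : E) : GRing.comm X k%:A.
Proof. by rewrite /GRing.comm -scalerAl -scalerAr mul1r mulr1. Qed.

Lemma prod_comm_split N (n : nat) (L M : 'M[E]_n) (f h g : 'I_N -> 'I_n) :
  (forall i j k l, GRing.comm (L i j) (M k l)) ->
  \prod_k (L (f k) (h k) * M (h k) (g k))
    = (\prod_k L (f k) (h k)) * \prod_k M (h k) (g k).
Proof.
move=> LM; elim: N f h g => [|N IH] f h g; first by rewrite !big_ord0 mulr1.
rewrite !big_ord_recl (IH (fun k => f (lift ord0 k)) (fun k => h (lift ord0 k))).
rewrite !mulrA; congr (_ * _); rewrite -!mulrA; congr (_ * _).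
by symmetry; apply: commr_sym; apply: commr_prod => k _; apply: commr_sym; apply: LM.
Qed.

Lemma tens_mul N n (L M : 'M[E]_n) :
  (forall i j k l, GRing.comm (L i j) (M k l)) ->
  tens N (L *m M) = tens N L *m tens N M.
Proof.
move=> LM; apply/matrixP => p q; rewrite !mxE.
pose f := (enum_val p : {ffun 'I_N -> 'I_n}) : 'I_N -> 'I_n.
pose g := (enum_val q : {ffun 'I_N -> 'I_n}) : 'I_N -> 'I_n.
transitivity (\prod_(k < N) \sum_j L (f k) j * M j (g k)).
  by apply: eq_bigr => k _; rewrite mxE.
rewrite bigA_distr_bigA /=.
rewrite (reindex (@enum_val {ffun 'I_N -> 'I_n} predT)) /=; last first.
  exists enum_rank => [i _|j _]; [exact: enum_valK|exact: enum_rankK].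
by apply: eq_bigr => h _; rewrite !mxE prod_comm_split.
Qed.

Lemma tens_scal N n (B : 'M[C]_n) : tens N (scal_mx B) = scal_mx (tens N B).
Proof.
apply/matrixP => p q; rewrite !mxE (big_morph (fun k : C => k%:A : E) (id1 := 1) (op1 := *%R)).
- by apply: eq_bigr => k _; rewrite mxE.
- by move=> x y; rewrite -scalerAl mul1r scalerA.
- exact: scale1r.
Qed.

Lemma related_tens (L : Type) (E' : algType C) (ell : L -> E) (ell' : L -> E')
    N n (M : 'M[E]_n) (M' : 'M[E']_n) :
  related_mx ell ell' M M' -> related_mx ell ell' (tens N M) (tens N M').
Proof. by move=> r p q; rewrite !mxE; apply: related_prod => k _; apply: r. Qed.

End Tensor.

Section ScalarTensor.
Variable C : fieldType.

Lemma tens1 N n : tens N (1%:M : 'M[C]_n) = 1%:M.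
Proof.
apply/matrixP => p q; rewrite !mxE; case: eqP => [->|pq].
  by rewrite /= big1 // => k _; rewrite mxE eqxx.
have [k kpq] : exists k, (enum_val p : {ffun _}) k != (enum_val q : {ffun 'I_N -> 'I_n}) k.
  apply: contrapT => h; apply: pq; apply: enum_val_inj; apply/ffunP => k.
  by apply/eqP/negPn/negP => hk; apply: h; exists k.
by rewrite /= (bigD1 k) //= mxE (negPf kpq) mul0r.
Qed.

Lemma tens_mulC N n (A B : 'M[C]_n) : tens N (A *m B) = tens N A *m tens N B.
Proof. by apply: (@tens_mul C C^o) => i j k l; apply: mulrC. Qed.

Lemma tens_invmx N n (B : 'M[C]_n) : B \in unitmx ->
  tens N B \in unitmx /\ invmx (tens N B) = tens N (invmx B).
Proof.
move=> uB; have h : tens N B *m tens N (invmx B) = 1%:M.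
  by rewrite -tens_mulC mulmxV // tens1.
have [uT _] := mulmx1_unit h; split=> //.
by rewrite -[RHS]mul1mx -(mulVmx uT) -mulmxA h mulmx1.
Qed.

End ScalarTensor.

Section Functional.
Variables (R : realType) (J : finType) (lam : J -> R[i]).
Local Notation C := R[i].
Local Notation E := (fock_end R (J + J)%type).
Local Notation thermal := (thermal lam).

Definition vev_mx m n (M : 'M[E]_(m, n)) : 'M[C]_(m, n) := map_mx (@vev R J) M.

Lemma vev_mx_scal m n p q (A : 'M[C]_(m, n)) (M : 'M[E]_(n, p)) (B : 'M[C]_(p, q)) :
  vev_mx (scal_mx E A *m M *m scal_mx E B) = A *m vev_mx M *m B.
Proof.
apply/matrixP => i j; rewrite !mxE linear_sum; apply: eq_bigr => k _.
rewrite !mxE comm_scalar -scalerAl mul1r linearZ /= mulrC; congr (_ * _).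
rewrite linear_sum; apply: eq_bigr => l _.
by rewrite !mxE -scalerAl mul1r linearZ.
Qed.

Lemma conj_tens_vev N n (B : 'M[C]_n) (M : 'M[E]_n) : B \in unitmx ->
  conj_tens B (vev_mx (tens N M))
    = vev_mx (tens N (scal_mx E B *m M *m scal_mx E (invmx B))).
Proof.
move=> uB; have [_ iT] := tens_invmx N uB.
rewrite /conj_tens iT -vev_mx_scal -!tens_scal.
rewrite tens_mul; last first.
  by move=> i j k l; rewrite [scal_mx _ _ k l]mxE; apply: comm_scalar.
rewrite tens_mul // => i j k l; rewrite [scal_mx _ _ i j]mxE.
by apply: commr_sym; apply: comm_scalar.
Qed.

(** [trivial_right G c] : to the right of any element commuting with the family
    del, G acts under the vacuum expectation value as the scalar c. *)
Variables (K : Type) (del : K -> E).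

Definition central_for X := thermal X /\ forall k, GRing.comm X (del k).

Definition trivial_right G (c : C) :=
  central_for G /\ forall X, central_for X -> vev (X * G) = c * vev X :> C.

Lemma trivial_rightM G G' c c' :
  trivial_right G c -> trivial_right G' c' -> trivial_right (G * G') (c * c').
Proof.
move=> [[tG dG] hG] [[tG' dG'] hG']; split.
  by split=> [|k]; [exact: thermalM|apply: commr_sym; apply: commrM; apply: commr_sym].
move=> X [tX dX]; rewrite mulrA hG' ?hG ?mulrA 1?[c' * c]mulrC //.
by split=> [|k]; [exact: thermalM|apply: commr_sym; apply: commrM; apply: commr_sym].
Qed.

Lemma trivial_rightD G G' c c' :
  trivial_right G c -> trivial_right G' c' -> trivial_right (G + G') (c + c').
Proof.
move=> [[tG dG] hG] [[tG' dG'] hG']; split.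
  by split=> [|k]; [exact: thermalD|apply: commr_sym; apply: commrD; apply: commr_sym].
by move=> X cX; rewrite mulrDr linearD /= hG // hG' // -mulrDl.
Qed.

Lemma trivial_right_scalar c : trivial_right c%:A c.
Proof.
split; first by split=> [|k]; [exact: thermal_scalar|apply: commr_sym; exact: comm_scalar].
by move=> X _; rewrite -scalerAr mulr1 linearZ.
Qed.

Lemma trivial_right0 : trivial_right 0 0.
Proof. by have := trivial_right_scalar 0; rewrite scale0r. Qed.

Lemma trivial_right1 : trivial_right 1 1.
Proof. by have := trivial_right_scalar 1; rewrite scale1r. Qed.

Lemma trivial_rightZ a G c : trivial_right G c -> trivial_right (a *: G) (a * c).
Proof.
by move/(trivial_rightM (trivial_right_scalar a)); rewrite -scalerAl mul1r.
Qed.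

Lemma trivial_rightN G c : trivial_right G c -> trivial_right (- G) (- c).
Proof. by move/(trivial_rightZ (-1)); rewrite scaleN1r mulN1r. Qed.

Lemma trivial_right_sum (I : Type) (s : seq I) (P : pred I) (F : I -> E) (c : I -> C) :
  (forall i, P i -> trivial_right (F i) (c i)) ->
  trivial_right (\sum_(i <- s | P i) F i) (\sum_(i <- s | P i) c i).
Proof.
by move=> h; elim/big_rec2: _ => [|i y y' Pi]; [exact: trivial_right0|apply/trivial_rightD/h].
Qed.

Lemma trivial_right_prod (I : Type) (s : seq I) (P : pred I) (F : I -> E) (c : I -> C) :
  (forall i, P i -> trivial_right (F i) (c i)) ->
  trivial_right (\prod_(i <- s | P i) F i) (\prod_(i <- s | P i) c i).
Proof.
by move=> h; elim/big_rec2: _ => [|i y y' Pi]; [exact: trivial_right1|apply/trivial_rightM/h].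
Qed.

Lemma trivial_right_homogeneous z k : z != 1 -> homogeneous lam z (del k) ->
  (forall k', GRing.comm (del k) (del k')) -> trivial_right (del k) 0.
Proof.
move=> z1 [td hd] cd; split=> // X [tX cX]; rewrite mul0r.
have := hd X tX; rewrite -cX => /eqP; rewrite -subr_eq0 -{1}[vev _ : C]mul1r -mulrBl.
by rewrite mulf_eq0 subr_eq0 eq_sym (negPf z1) /= => /eqP.
Qed.

Definition trivial_right_mx n (U : 'M[E]_n) :=
  forall i j, trivial_right (U i j) (i == j)%:R.

Lemma vev_tens_trivial N n (L U : 'M[E]_n) :
  trivial_right_mx U -> (forall i j, central_for (L i j)) ->
  (forall i j k l, GRing.comm (L i j) (U k l)) ->
  vev_mx (tens N (L *m U)) = vev_mx (tens N L).
Proof.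
move=> tU cL LU; rewrite tens_mul //; apply/matrixP => p q; rewrite !mxE linear_sum.
have tT : forall p q, trivial_right (tens N U p q) (tens N (1%:M : 'M[C]_n) p q).
  move=> p' q'; rewrite !mxE; apply: trivial_right_prod => k _.
  by rewrite mxE; apply: tU.
have cT h : central_for (tens N L p h).
  rewrite mxE; apply: (big_ind (fun X => central_for X)) => [|X Y|k _]; last exact: cL.
    by case: trivial_right1.
  move=> [tX dX] [tY dY]; split=> [|k]; first exact: thermalM.
  by apply: commr_sym; apply: commrM; apply: commr_sym.
rewrite (bigD1 q) //= (tT q q).2 // tens1 mxE eqxx mul1r mxE.
rewrite big1 ?addr0 // => h hq; rewrite (tT h q).2 // tens1 mxE (negPf hq).
exact: mul0r.
Qed.

End Functional.

Section Span.
Variables (C : fieldType) (L : Type) (E E' : algType C).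
Variables (ell : L -> E) (ell' : L -> E').

Lemma related_right X X' : related ell ell' X X' -> related ell' ell' X' X'.
Proof. by case=> s [_ ->]; exists s. Qed.

Lemma related_mx_right m n (M : 'M[E]_(m, n)) M' :
  related_mx ell ell' M M' -> related_mx ell' ell' M' M'.
Proof. by move=> r i j; apply: related_right (r i j). Qed.

Lemma related_ind (P : E -> Prop) X X' :
  (forall c, P c%:A) -> (forall l, P (ell l)) ->
  (forall Y Z, P Y -> P Z -> P (Y + Z)) -> (forall Y Z, P Y -> P Z -> P (Y * Z)) ->
  related ell ell' X X' -> P X.
Proof.
move=> Pc Pl PD PM [s [-> _]]; rewrite /evalw.
elim: s => [|[c w] s IH]; rewrite ?big_nil ?big_cons.
  by rewrite -(scale0r 1).
apply: PD => //=; rewrite -[word _ _]mul1r scalerAl; apply: (PM _ _) => //.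
elim: w => [|l w IHw]; first by rewrite /word big_nil -(scale1r 1).
by rewrite word_cons; apply: PM.
Qed.

Lemma related_comm Y X X' :
  (forall l, GRing.comm Y (ell l)) -> related ell ell' X X' -> GRing.comm Y X.
Proof.
move=> h; apply: (related_ind (P := GRing.comm Y)) => //.
- by move=> c; apply: comm_scalar.
- by move=> *; apply: commrD.
- by move=> *; apply: commrM.
Qed.

End Span.

Section Factorisation.
Variables (R : realType) (J1 J2 JT : finType).
Local Notation C := R[i].
Variables (lam1 : J1 -> C) (lam2 : J2 -> C).
Let J := (J1 + J2)%type.
Local Notation E := (fock_end R (J + J)%type).

Definition lam12 (j : J) : C := match j with inl j => lam1 j | inr j => lam2 j end.
Let lam := lam12.

Definition left_letter (l : bool * J1) : E := therm_letter lam (l.1, inl l.2).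
Definition right_letter (l : bool * J2) : E := therm_letter lam (l.1, inr l.2).

Hypotheses (lam1_neq0 : forall j, lam1 j != 0) (lam1_neq1 : forall j, lam1 j != 1).
Hypotheses (lam2_neq0 : forall j, lam2 j != 0) (lam2_neq1 : forall j, lam2 j != 1).

Lemma left_letter_ccr : ccr left_letter.
Proof.
move=> l l'; rewrite /left_letter therm_letter_ccr /ccr_coef /=.
by rewrite (inj_eq (@inl_inj _ _)).
Qed.

Lemma right_letter_ccr : ccr right_letter.
Proof.
move=> l l'; rewrite /right_letter therm_letter_ccr /ccr_coef /=.
by rewrite (inj_eq (@inr_inj _ _)).
Qed.

Lemma left_right_comm l l' : GRing.comm (left_letter l) (right_letter l').
Proof.
by rewrite /GRing.comm [LHS]therm_letter_ccr /ccr_coef /= mul0r scale0r addr0.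
Qed.

Lemma left_homogeneous l : homogeneous lam (weight lam1 l) (left_letter l).
Proof. by apply: homogeneous_letter => /=. Qed.

Lemma right_homogeneous l : homogeneous lam (weight lam2 l) (right_letter l).
Proof. by apply: homogeneous_letter => /=. Qed.

Lemma related_thermal (L : Type) (E' : algType C) (ell : L -> E) (ell' : L -> E') X X' :
  (forall l, thermal lam (ell l)) -> related ell ell' X X' -> thermal lam X.
Proof.
move=> h; apply: (related_ind (P := thermal lam)) => //.
- by move=> c; apply: thermal_scalar.
- by move=> *; apply: thermalD.
- by move=> *; apply: thermalM.
Qed.

Lemma vev_split X Y : related left_letter left_letter X X ->
  related right_letter right_letter Y Y -> vev (X * Y) = vev X * vev Y :> C.
Proof.
move=> rX rY; have tY : thermal lam Y.
  by apply: related_thermal rY => l; case: (right_homogeneous l).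
have cY l : GRing.comm (left_letter l) Y.
  by apply: related_comm rY => l'; apply: left_right_comm.
have c1 := vev_twisted_cyclic left_homogeneous tY cY.
have c2 := vev_twisted_cyclic left_homogeneous (thermal1 lam) (fun l => commr1 _).
have := related_functional left_letter_ccr left_letter_ccr lam1_neq1 c1 c2 rX.
by rewrite /= vev1 mulr1 => ->; rewrite mulr1.
Qed.

Lemma vev_mx_split m n p (X : 'M[E]_(m, n)) (Y : 'M[E]_(n, p)) :
  related_mx left_letter left_letter X X -> related_mx right_letter right_letter Y Y ->
  vev_mx (X *m Y) = vev_mx X *m vev_mx Y.
Proof.
move=> rX rY; apply/matrixP => i j; rewrite !mxE linear_sum.
by apply: eq_bigr => k _; rewrite !mxE; apply: vev_split.
Qed.

Variables (K : Type) (del : K -> E) (zd : K -> C).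
Hypotheses (del_hom : forall k, homogeneous lam (zd k) (del k))
  (zd_neq1 : forall k, zd k != 1).
Hypothesis del_comm : forall k k', GRing.comm (del k) (del k').

(** A polynomial in the family del acts as its constant term, since every
    monomial containing some del k is killed by the cyclicity. *)
Lemma related_trivial G (c : C) :
  related del (fun=> 0 : C^o) G c -> trivial_right lam del G c.
Proof.
case=> s [-> ->]; rewrite /evalw; elim: s => [|[a w] s IH].
  by rewrite !big_nil; apply: trivial_right0.
rewrite !big_cons; apply: trivial_rightD => //=.
have tw : trivial_right lam del (word del w) (word (fun=> 0 : C^o) w).
  elim: w => [|k w IHw]; rewrite ?word_cons /word ?big_nil.
    exact: trivial_right1.
  apply: trivial_rightM IHw.
  exact: trivial_right_homogeneous (zd_neq1 k) (del_hom k) (del_comm k).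
exact: (trivial_rightZ a tw).
Qed.

Variables (ellT : bool * JT -> E) (zT : JT -> C) (P : pred JT).
Hypotheses (ellT_ccr : ccr ellT)
  (ellT_hom : forall l, homogeneous lam (weight zT l) (ellT l)).
Hypothesis ellT_del : forall l k, GRing.comm (ellT l) (del k).

Variables (phi1 : fock_end R J1 -> C) (phi2 : fock_end R J2 -> C)
  (phiT : fock_end R JT -> C) (c : C).
Hypotheses (phi1P : continues (ph_letter R pred0) lam1 phi1 1)
  (phi2P : continues (ph_letter R pred0) lam2 phi2 1)
  (phiTP : continues (ph_letter R P) zT phiT c).

Lemma continues_vev_mx (J0 : finType) (E0 : algType C) (ell0 : bool * J0 -> E0)
   (ell : bool * J0 -> E) z (phi : E0 -> C) a m n M M' :
  ccr ell -> (forall l, homogeneous lam (weight z l) (ell l)) ->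
  continues ell0 z phi a -> related_mx ell0 ell M M' ->
  map_mx phi M = a *: (vev_mx M' : 'M_(m, n)).
Proof.
move=> cc hl hphi rM; apply/matrixP => i j; rewrite !mxE.
have cyc := vev_twisted_cyclic hl (thermal1 lam) (fun l => commr1 _).
by have := hphi _ _ _ cc cyc _ _ (rM i j); rewrite vev1 !mulr1 mulrC.
Qed.

Lemma conj_related (L : Type) (E0 E1 : algType C) (ell0 : L -> E0) (ell1 : L -> E1) n
   (B : 'M[C]_n) M M' : related_mx ell0 ell1 M M' ->
  related_mx ell0 ell1 (scal_mx E0 B *m M *m scal_mx E0 (invmx B))
    (scal_mx E1 B *m M' *m scal_mx E1 (invmx B)).
Proof.
by move=> r; do 2?apply: related_mul => //; apply: related_const.
Qed.

Theorem factorisation N n (B1 B2 B : 'M[C]_n) L1 L2 LT L1' L2' LT' U :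
  B1 \in unitmx -> B2 \in unitmx -> B \in unitmx ->
  related_mx (ph_letter R pred0) left_letter L1 L1' ->
  related_mx (ph_letter R pred0) right_letter L2 L2' ->
  related_mx (ph_letter R P) ellT LT LT' ->
  related_mx del (fun=> 0 : C^o) U 1%:M ->
  (scal_mx E B1 *m L1' *m scal_mx E (invmx B1)) *m
    (scal_mx E B2 *m L2' *m scal_mx E (invmx B2))
    = scal_mx E B *m (LT' *m U) *m scal_mx E (invmx B) ->
  map_mx phiT (tens N (scal_mx _ B *m LT *m scal_mx _ (invmx B))) =
    c *: (conj_tens B1 (map_mx phi1 (tens N L1)) *m
          conj_tens B2 (map_mx phi2 (tens N L2))).
Proof.
move=> u1 u2 uB r1 r2 rT rU e.
rewrite (continues_vev_mx ellT_ccr ellT_hom phiTP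
  (related_tens (N := N) (conj_related B rT))).
rewrite (continues_vev_mx left_letter_ccr left_homogeneous phi1P (related_tens (N := N) r1)).
rewrite (continues_vev_mx right_letter_ccr right_homogeneous phi2P (related_tens (N := N) r2)).
rewrite !scale1r !conj_tens_vev //; congr (_ *: _).
have r1' := conj_related B1 r1; have r2' := conj_related B2 r2.
rewrite -vev_mx_split; try by apply: related_mx_right; apply: related_tens; eassumption.
rewrite -tens_mul; last first.
  move=> i j k l; apply: related_comm (related_mx_right r2' k l) => l2.
  apply: commr_sym; apply: related_comm (related_mx_right r1' i j) => l1.
  by apply: commr_sym; apply: left_right_comm.
rewrite e -!conj_tens_vev //; congr (conj_tens _ _).
rewrite (vev_tens_trivial (lam := lam) (del := del)) //.
- by move=> i j; have := rU i j; rewrite mxE; apply: related_trivial.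
- have rT' := related_mx_right rT; move=> i j; split.
    by apply: related_thermal (rT' i j) => l; case: (ellT_hom l).
  move=> k; apply: commr_sym; apply: related_comm (rT' i j) => l.
  exact/commr_sym/ellT_del.
move=> i j k l; apply: related_comm (rU k l) => k'.
apply: commr_sym; apply: related_comm (related_mx_right rT i j) => l'.
exact/commr_sym/ellT_del.
Qed.

End Factorisation.

Section Evaluation.
Variables (R : realType) (E : algType R[i]).
Local Notation C := R[i].
Implicit Types (p q : {poly E}) (x k : C).

Definition evp x p : E := p.[x%:A].

Fact evp_zmod x : zmod_morphism (evp x).
Proof. by move=> p q; rewrite /evp hornerD hornerN. Qed.
Fact evp_monoid x : monoid_morphism (evp x).
Proof.
split=> [|p q]; first exact: hornerC.
apply: hornerM_comm; apply: comm_coef_poly => i.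
by rewrite /GRing.comm -scalerAl -scalerAr mul1r mulr1.
Qed.
HB.instance Definition _ x := GRing.isZmodMorphism.Build _ _ (evp x) (evp_zmod x).
HB.instance Definition _ x := GRing.isMonoidMorphism.Build _ _ (evp x) (evp_monoid x).

Lemma eval_laxE n (L : 'M[{poly E}]_n) x : eval_lax L x = map_mx (evp x) L.
Proof. by []. Qed.

Lemma evpC x (a : E) : evp x a%:P = a.
Proof. exact: hornerC. Qed.

Lemma evpX x : evp x 'X = x%:A.
Proof. exact: hornerX. Qed.

Lemma evp_sc x k : evp x (sc E k) = k%:A.
Proof. exact: hornerC. Qed.

Lemma eval_conj_lax n (B : 'M[C]_n) (L : 'M[{poly E}]_n) x :
  eval_lax (conj_lax B L) x = scal_mx E B *m eval_lax L x *m scal_mx E (invmx B).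
Proof.
rewrite !eval_laxE /conj_lax !map_mxM; congr (_ *m _ *m _) => //;
by apply/matrixP => i j; rewrite !mxE; apply: evp_sc.
Qed.

Lemma coef0_eval n (L : 'M[{poly E}]_n) i j : (L i j)`_0 = eval_lax L 0 i j.
Proof. by rewrite mxE scale0r horner_coef0. Qed.

End Evaluation.

Section OscLabels.
Variables (R : realType) (T : finType) (S : {set T}).
Local Notation C := R[i].
Let J : finType := {s : T | s \in S}.
Implicit Types (P : {set T}) (s : T) (b : bool).

Definition in_labels P : pred J := fun j => val j \in P.

Definition extend_letter (E : algType C) (ell : bool * J -> E) b s : E :=
  oapp (fun j => ell (b, j)) 0 (insub s).

Lemma extend_letterE (E : algType C) (ell : bool * J -> E) b s (hs : s \in S) :
  extend_letter ell b s = ell (b, Sub s hs).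
Proof. by rewrite /extend_letter insubT. Qed.

Lemma ph_barE P s : ph_bar R S P s = extend_letter (ph_letter R (in_labels P)) true s.
Proof.
rewrite /ph_bar /osc_bar /osc_ann /extend_letter.
case: insubP => [u uS <-|_] /=; last by case: ifP; rewrite ?oppr0.
by rewrite /ph_letter /in_labels /=; case: ifP.
Qed.

Lemma ph_annE P s : ph_ann R S P s = extend_letter (ph_letter R (in_labels P)) false s.
Proof.
rewrite /ph_ann /osc_bar /osc_ann /extend_letter.
case: insubP => [u uS <-|_] /=; last by case: ifP.
by rewrite /ph_letter /in_labels /=; case: ifP.
Qed.

Lemma osc_barE s : osc_bar R S s = extend_letter (ph_letter R (pred0 : pred J)) true s.
Proof. by rewrite /osc_bar /extend_letter; case: insubP. Qed.

Lemma osc_annE s : osc_ann R S s = extend_letter (ph_letter R (pred0 : pred J)) false s.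
Proof. by rewrite /osc_ann /extend_letter; case: insubP. Qed.

Lemma related_extend (E E' : algType C) (ell : bool * J -> E) (ell' : bool * J -> E') b s :
  related ell ell' (extend_letter ell b s) (extend_letter ell' b s).
Proof.
rewrite /extend_letter; case: insubP => [u _ _|_] /=; first exact: related_letter.
exact: related0.
Qed.

Definition osc_sign P s : int := if s \in P then -1 else 1.

Lemma affine0 : affine (0 : fock_end R J) 0 (fun=> 0).
Proof. by have := @affine_scalar R J 0; rewrite scale0r. Qed.

Lemma affine_osc_number P s : exists c,
  affine (ph_bar R S P s * ph_ann R S P s) c
    (fun j => osc_sign P s * (s == val j)%:R).
Proof.
rewrite ph_barE ph_annE /extend_letter; case: insubP => [u uS us|sS] /=.
  exists (- (in_labels P u)%:R); apply: (affine_ext (affine_ph_number R (in_labels P) u)) => j.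
  by rewrite /ph_sign /in_labels /osc_sign us -val_eqE /= us.
exists 0; rewrite mul0r; apply: affine_ext affine0 _ => j.
by case: eqP => [e|]; rewrite ?mulr0 //; case/negP: sS; rewrite e; apply: (valP j).
Qed.

Lemma affine_osc_conumber P s : exists c,
  affine (ph_ann R S P s * ph_bar R S P s) c
    (fun j => osc_sign P s * (s == val j)%:R).
Proof.
rewrite ph_barE ph_annE /extend_letter; case: insubP => [u uS us|sS] /=.
  exists (1 - (in_labels P u)%:R); apply: (affine_ext (affine_ph_conumber R (in_labels P) u)) => j.
  by rewrite /ph_sign /in_labels /osc_sign us -val_eqE /= us.
exists 0; rewrite mul0r; apply: affine_ext affine0 _ => j.
by case: eqP => [e|]; rewrite ?mulr0 //; case/negP: sS; rewrite e; apply: (valP j).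
Qed.

Lemma osc0 s : osc_bar R S s = ph_bar R S finset.set0 s /\ osc_ann R S s = ph_ann R S finset.set0 s.
Proof. by rewrite /ph_bar /ph_ann inE. Qed.

Lemma twist_diagonal r th (F : 'I_r -> osc R S) (w : 'I_r -> J -> int) :
  (forall i, exists c, affine (F i) c (w i)) ->
  exists2 k : C, k != 0 &
    diag_op (twist th F) k (fun j => \prod_i expC (th i) ^ w i j).
Proof.
move=> hF; have [c hc] := boolp.choice hF.
exists (\prod_i expC (th i * c i)).
  by apply/prodf_neq0 => i _; apply: expC_neq0.
by apply: diagonal_prod => i _; apply: diagonal_opexp.
Qed.

End OscLabels.

Section TransferFacts.
Variables (R : realType) (T : finType) (S : {set T}) (P : {set T}).
Local Notation C := R[i].
Let J : finType := {s : T | s \in S}.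

Lemma transfer_cvg_related N n W k lam (L : 'M[{poly osc R S}]_n) x
    (E' : algType C) (ell' : bool * J -> E') L' :
  diag_op W k lam -> (forall j, `|lam j| < 1) ->
  related_mx (ph_letter R (in_labels (S := S) P)) ell' (eval_lax L x) L' ->
  transfer_cvg N W L x.
Proof.
move=> dW l1 r; split=> [|p q].
- have e : W * 1 = W by rewrite mulr1.
  by rewrite -e; apply: (tame_trace_cvg dW l1 (tame1 R J)).
- apply: tame_trace_cvg dW l1 _.
  exact: tame_related (related_tens (N := N) r p q).
Qed.

End TransferFacts.

Section Mixing.
Variables (R : realType) (J JT : finType) (mu : J -> R[i]).
Local Notation C := R[i].
Local Notation E := (fock_end R (J + J)%type).
Variables (p1 p2 : bool * JT -> E) (lam : JT -> C) (c d e : JT -> C).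
Hypotheses (p1_ccr : ccr p1) (p2_ccr : ccr p2).
Hypothesis p12_comm : forall l l', GRing.comm (p1 l) (p2 l').
Hypotheses (p1_hom : forall l, homogeneous mu (weight lam l) (p1 l))
  (p2_hom : forall l, homogeneous mu (weight (fun j => (lam j)^-1) l) (p2 l)).
Hypothesis ced : forall j, c j * e j = d j.

Definition mixed_letter (l : bool * JT) : E :=
  if l.1 then p1 (true, l.2) else p1 (false, l.2) + c l.2 *: p2 (true, l.2).

Definition mixed_del (j : JT) : E := d j *: p1 (true, j) + e j *: p2 (false, j).

Let b11 l l' : bracket (p1 l) (p1 l') = (ccr_coef C l l')%:A.
Proof. exact: (ccrP p1).1. Qed.
Let b22 l l' : bracket (p2 l) (p2 l') = (ccr_coef C l l')%:A.
Proof. exact: (ccrP p2).1. Qed.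
Let b12 l l' : bracket (p1 l) (p2 l') = 0.
Proof. exact/bracket_comm. Qed.
Let b21 l l' : bracket (p2 l) (p1 l') = 0.
Proof. by rewrite bracketC b12 oppr0. Qed.

Lemma mixed_letter_ccr : ccr mixed_letter.
Proof.
apply/ccrP => -[[] i] [[] j]; rewrite /mixed_letter /= ?bracketE !(b11, b22, b12, b21);
  rewrite ?scaler0 ?addr0 //= /ccr_coef /= ?subrr ?mulr0 ?scale0r ?scaler0 ?addr0 //.
Qed.

Lemma mixed_letter_homogeneous l : homogeneous mu (weight lam l) (mixed_letter l).
Proof.
case: l => [[] j]; rewrite /mixed_letter /=; first exact: p1_hom.
apply: homogeneousD; first exact: p1_hom.
exact/homogeneousZ/p2_hom.
Qed.

Lemma mixed_del_homogeneous j : homogeneous mu (lam j) (mixed_del j).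
Proof.
apply: homogeneousD; apply: homogeneousZ; first exact: (p1_hom (true, j)).
by have := p2_hom (false, j); rewrite /weight /= invrK.
Qed.

Lemma mixed_del_comm i j : GRing.comm (mixed_del i) (mixed_del j).
Proof.
apply/bracket_comm; rewrite /mixed_del ?bracketE !(b11, b22, b12, b21) /ccr_coef /=.
by rewrite !subrr !mulr0 !scale0r !scaler0 !addr0.
Qed.

Lemma mixed_letter_del l j : GRing.comm (mixed_letter l) (mixed_del j).
Proof.
apply/bracket_comm; case: l => [[] i]; rewrite /mixed_letter /mixed_del /=;
  rewrite ?bracketE !(b11, b22, b12, b21) /ccr_coef /=.
  by rewrite subrr mulr0 scale0r !scaler0 addr0.
rewrite !scaler0 addr0 add0r !scalerA -scalerDl -(scale0r 1); congr (_ *: _).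
case: eqP => [->|_]; rewrite ?mulr1n ?mulr0n -?ced; ring.
Qed.

End Mixing.

Section BlockFactorisation.
Variables (C : fieldType) (E : algType C).

Definition cmx n (k : C) : 'M[E]_n := (k%:A)%:M.

Lemma cmx_comm m n k (M : 'M[E]_(m, n)) : cmx m k *m M = M *m cmx n k.
Proof.
apply/matrixP => i j; rewrite !mxE (bigD1 i) //= [in RHS](bigD1 j) //=.
rewrite !mxE !eqxx !mulr1n big1; last first.
  by move=> l li; rewrite !mxE eq_sym (negPf li) mul0r.
rewrite big1; last by move=> l lj; rewrite !mxE (negPf lj) mulr0.
by rewrite !addr0 comm_scalar.
Qed.

Lemma cmxD n k l : cmx n (k + l) = cmx n k + cmx n l.
Proof. by rewrite /cmx scalerDl raddfD. Qed.
Lemma cmxN n k : cmx n (- k) = - cmx n k.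
Proof. by rewrite /cmx scaleNr raddfN. Qed.

Variables (p q : nat).
Implicit Types (b : 'M[E]_(p, q)) (a : 'M[E]_(q, p)).

Definition block_lax x y b a : 'M[E]_(p + q) :=
  block_mx (cmx p x - b *m a) (- (b *m (cmx q (x - y) - a *m b)))
           (- a) (cmx q y + a *m b).

Definition block_deg x b a : 'M[E]_(p + q) :=
  block_mx (cmx p x - b *m a) b (- a) 1%:M.

(** The two degenerate matrices multiply to the Lax matrix in the mixed
    oscillators, up to a unipotent factor in the combination b + c. *)
Lemma block_factor x y b a (c : 'M[E]_(p, q)) (cb : 'M[E]_(q, p)) :
  block_deg x b a *m block_mx 1%:M c cb (cmx q y + cb *m c)
    = block_lax x y b (a - cb) *m block_mx 1%:M (b + c) 0 1%:M.
Proof.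
rewrite !mulmx_block !mulmx1 !mulmx0 !mul1mx !addr0.
have [al alE] : exists al, al = a - cb by exists (a - cb).
rewrite -alE; congr block_mx.
- by rewrite alE mulmxBr opprB addrA addrAC.
- have zm (V : zmodType) (P Q S Y : V) : P - Q + S + (Q - (P - Y)) = S + Y.
    by rewrite addrACA subrK opprB addrCA [P + _]addrC subrK.
  transitivity (cmx p x *m c - b *m al *m c + b *m cmx q y).
    rewrite alE mulmxDr mulmxA mulmxBl mulmxBr mulmxBl opprB.
    rewrite [b *m cmx q y + _]addrC addrA [in RHS]addrA; congr (_ + _).
    exact: addrAC.
  rewrite mulmxDr (mulmxBr b) opprB !mulmxBl (mulmxA b al b) cmxD cmxN.
  by rewrite (mulmxBr b (cmx q x)) -(cmx_comm x b) zm.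
- by rewrite alE opprB addrC.
- transitivity (cmx q y - al *m c).
    by rewrite alE mulmxBl opprB !mulNmx addrCA [- _ + _]addrC.
  by rewrite mulmxDr !mulNmx [RHS]addrC addrA addrK.
Qed.

End BlockFactorisation.

Section MixedFactorisation.
Variables (R : realType) (J1 J2 JT : finType).
Local Notation C := R[i].
Variables (lam1 : J1 -> C) (lam2 : J2 -> C).
Hypotheses (lam1_neq0 : forall j, lam1 j != 0) (lam1_neq1 : forall j, lam1 j != 1).
Hypotheses (lam2_neq0 : forall j, lam2 j != 0) (lam2_neq1 : forall j, lam2 j != 1).
Let E := fock_end R ((J1 + J2) + (J1 + J2))%type.
Variables (p1 p2 : bool * JT -> E) (lam : JT -> C) (c d e : JT -> C).
Hypotheses (p1_ccr : ccr p1) (p2_ccr : ccr p2).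
Hypothesis p12_comm : forall l l', GRing.comm (p1 l) (p2 l').
Hypotheses (p1_hom : forall l, homogeneous (lam12 lam1 lam2) (weight lam l) (p1 l))
  (p2_hom : forall l, homogeneous (lam12 lam1 lam2)
     (weight (fun j => (lam j)^-1) l) (p2 l)).
Hypotheses (ced : forall j, c j * e j = d j) (lam_neq1 : forall j, lam j != 1).
Variables (phi1 : fock_end R J1 -> C) (phi2 : fock_end R J2 -> C)
  (phiT : fock_end R JT -> C) (P : pred JT) (a : C).
Hypotheses (phi1P : continues (ph_letter R pred0) lam1 phi1 1)
  (phi2P : continues (ph_letter R pred0) lam2 phi2 1)
  (phiTP : continues (ph_letter R P) lam phiT a).

Theorem mixed_factorisation N n (B1 B2 B : 'M[C]_n) L1 L2 LT L1' L2' LT' U :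
  B1 \in unitmx -> B2 \in unitmx -> B \in unitmx ->
  related_mx (ph_letter R pred0) (left_letter lam1 lam2) L1 L1' ->
  related_mx (ph_letter R pred0) (right_letter lam1 lam2) L2 L2' ->
  related_mx (ph_letter R P) (mixed_letter p1 p2 c) LT LT' ->
  related_mx (mixed_del p1 p2 d e) (fun=> 0 : C^o) U 1%:M ->
  (scal_mx E B1 *m L1' *m scal_mx E (invmx B1)) *m
    (scal_mx E B2 *m L2' *m scal_mx E (invmx B2))
    = scal_mx E B *m (LT' *m U) *m scal_mx E (invmx B) ->
  map_mx phiT (tens N (scal_mx _ B *m LT *m scal_mx _ (invmx B))) =
    a *: (conj_tens B1 (map_mx phi1 (tens N L1)) *m
          conj_tens B2 (map_mx phi2 (tens N L2))).
Proof.
exact: (factorisation lam1_neq0 lam1_neq1 lam2_neq0 lam2_neq1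
  (mixed_del_homogeneous d e p1_hom p2_hom) lam_neq1
  (mixed_del_comm d e p1_ccr p2_ccr p12_comm)
  (mixed_letter_ccr c p1_ccr p2_ccr p12_comm)
  (mixed_letter_homogeneous c p1_hom p2_hom)
  (mixed_letter_del p1_ccr p2_ccr p12_comm ced) phi1P phi2P phiTP).
Qed.

End MixedFactorisation.

Section ReversalBlocks.
Variables (C : fieldType) (r : nat).
Implicit Types f g h k : 'I_r -> C.

Definition revmx : 'M[C]_r := \matrix_(i, j) (j == rev_ord i)%:R.
Definition dgmx f : 'M[C]_r := \matrix_(i, j) (f i *+ (i == j)).

Lemma dgmx_mul f g : dgmx f *m dgmx g = dgmx (fun i => f i * g i).
Proof.
apply/matrixP => i j; rewrite !mxE (bigD1 i) //= !mxE eqxx mulr1n big1 ?addr0.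
  by rewrite mulrnAr.
by move=> l li; rewrite !mxE eq_sym (negPf li) mul0r.
Qed.

Lemma dgmxD f g : dgmx f + dgmx g = dgmx (fun i => f i + g i).
Proof. by apply/matrixP => i j; rewrite !mxE mulrnDl. Qed.

Lemma eq_dgmx f g : f =1 g -> dgmx f = dgmx g.
Proof. by move=> e; apply/matrixP => i j; rewrite !mxE e. Qed.

Lemma dgmx1 : dgmx (fun=> 1) = 1%:M.
Proof. by apply/matrixP => i j; rewrite !mxE. Qed.

Lemma dgmx0 : dgmx (fun=> 0) = 0.
Proof. by apply/matrixP => i j; rewrite !mxE mul0rn. Qed.

Lemma revmx_mul : revmx *m revmx = 1%:M.
Proof.
apply/matrixP => i j; rewrite !mxE (bigD1 (rev_ord i)) //= !mxE eqxx mul1r big1.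
  by rewrite rev_ordK addr0 eq_sym.
by move=> l li; rewrite !mxE (negPf li) mul0r.
Qed.

(** Matrices that preserve every plane spanned by e_i and e_i'; i' is the mirror
    image of i, whence the reversals. *)
Definition plane_mx f g h k : 'M[C]_(r + r) :=
  block_mx (dgmx f) (dgmx g *m revmx) (revmx *m dgmx h) (revmx *m dgmx k *m revmx).

Lemma revmx_mulE m (M : 'M[C]_(r, m)) i j : (revmx *m M) i j = M (rev_ord i) j.
Proof.
rewrite !mxE (bigD1 (rev_ord i)) //= !mxE eqxx mul1r big1 ?addr0 //.
by move=> l li; rewrite !mxE (negPf li) mul0r.
Qed.

Lemma mul_revmxE m (M : 'M[C]_(m, r)) i j : (M *m revmx) i j = M i (rev_ord j).
Proof.
rewrite !mxE (bigD1 (rev_ord j)) //= !mxE rev_ordK eqxx mulr1 big1 ?addr0 //.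
move=> l li; rewrite !mxE -[j]rev_ordK (inj_eq rev_ord_inj) eq_sym (negPf li).
by rewrite mulr0.
Qed.

Lemma plane_mx_mul f g h k f' g' h' k' :
  plane_mx f g h k *m plane_mx f' g' h' k' =
  plane_mx (fun i => f i * f' i + g i * h' i) (fun i => f i * g' i + g i * k' i)
           (fun i => h i * f' i + k i * h' i) (fun i => h i * g' i + k i * k' i).
Proof.
have JJ m (M : 'M[C]_(r, m)) : revmx *m (revmx *m M) = M.
  by rewrite mulmxA revmx_mul mul1mx.
rewrite mulmx_block; congr block_mx; rewrite -!mulmxA ?JJ ?(mulmxA (dgmx _) (dgmx _)) !dgmx_mul.
- by rewrite dgmxD.
- by rewrite -mulmxDl dgmxD.
- by rewrite -mulmxDr dgmxD.
- by rewrite -mulmxDr -mulmxDl dgmxD.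
Qed.

Lemma eq_plane_mx f g h k f' g' h' k' : f =1 f' -> g =1 g' -> h =1 h' -> k =1 k' ->
  plane_mx f g h k = plane_mx f' g' h' k'.
Proof.
by move=> /eq_dgmx ef /eq_dgmx eg /eq_dgmx eh /eq_dgmx ek; rewrite /plane_mx ef eg eh ek.
Qed.

Lemma plane_mx1 : plane_mx (fun=> 1) (fun=> 0) (fun=> 0) (fun=> 1) = 1%:M.
Proof.
rewrite /plane_mx dgmx1 dgmx0 mul0mx mulmx0 mulmx1 revmx_mul.
by rewrite -scalar_mx_block.
Qed.

End ReversalBlocks.

Section PlaneRotations.
Variables (R : realType) (r : nat) (eps : R[i]).
Local Notation C := R[i].
Hypothesis eps2 : eps * eps = 1.

Definition flip_mx (p : pred 'I_r) : 'M[C]_(r + r) :=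
  plane_mx (fun i => (~~ p i)%:R) (fun i => (p i)%:R) (fun i => eps * (p i)%:R)
           (fun i => (~~ p i)%:R).

Lemma emb'E (i : 'I_r) : emb' i = rshift r (rev_ord i).
Proof. by apply: val_inj => /=; have := ltn_ord i; lia. Qed.

Let sum_diag (F : 'I_r -> 'I_r) (i a b : 'I_r) : involutive F ->
  \sum_(j | j != i) ((a == F j) && (b == F j))%:R = (F a != i)%:R *+ (a == b) :> C.
Proof.
move=> FK; have [ai|ai] := eqVneq (F a) i.
  rewrite mul0rn big1 // => j ji; case: eqP => //= aj; case/eqP: ji.
  by rewrite -ai aj FK.
rewrite (bigD1 (F a)) //= FK eqxx /= big1 ?addr0 => [|j /andP[_ ja]].
  by rewrite eq_sym; case: eqP.
by case: eqP => //= aj; case/eqP: ja; rewrite aj FK.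
Qed.

Lemma cd_B1E i : cd_B1 eps i = flip_mx (pred1 i).
Proof.
apply/matrixP => a b; rewrite /cd_B1 /flip_mx /plane_mx.
rewrite !emb'E /emb.
case: (split_ordP a) => {}a ->; case: (split_ordP b) => {}b ->.
- rewrite block_mxEul !mxE summxE !eq_shift /= andbF mulr0 !add0r.
  rewrite -[RHS](@sum_diag id i a b (fun=> erefl)); apply: eq_bigr => j _.
  by rewrite emb'E !mxE !eq_shift /= addr0.
- rewrite block_mxEur mul_revmxE !mxE summxE !eq_shift /= mulr0 addr0 big1 ?addr0.
    case: (a =P i) => [->|_]; rewrite ?mul0rn //= eq_sym (inv_eq (@rev_ordK r)).
    by case: eqP.
  by move=> j _; rewrite emb'E !mxE !eq_shift /= andbF addr0.
- rewrite block_mxEdl revmx_mulE !mxE summxE !eq_shift /= add0r big1 ?addr0.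
    rewrite -mulrnAr; congr (_ * _); rewrite (inv_eq (@rev_ordK r) a i).
    by case: (a =P _) => [->|_]; rewrite ?mul0rn //= rev_ordK eq_sym; case: eqP.
  by move=> j _; rewrite emb'E !mxE !eq_shift /= andbF addr0.
- rewrite block_mxEdr mul_revmxE revmx_mulE !mxE summxE !eq_shift /= andbF mulr0 !add0r.
  rewrite (inj_eq rev_ord_inj) -[RHS](@sum_diag (@rev_ord r) i a b (@rev_ordK _)).
  by apply: eq_bigr => j _; rewrite emb'E !mxE !eq_shift /= add0r.
Qed.

Lemma flip_mxM (p q : pred 'I_r) : (forall i, ~~ (p i && q i)) ->
  flip_mx p *m flip_mx q = flip_mx (predU p q).
Proof.
move=> pq; rewrite /flip_mx plane_mx_mul; apply: eq_plane_mx => i /=;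
by have := pq i; case: (p i); case: (q i) => //= _; ring.
Qed.

Lemma flip_mx0 (p : pred 'I_r) : p =1 pred0 -> flip_mx p = 1%:M.
Proof.
move=> p0; rewrite -plane_mx1 /flip_mx; apply: eq_plane_mx => i; rewrite p0 //=.
by rewrite mulr0.
Qed.

Lemma cd_BE mu : cd_B eps mu = flip_mx (fun i => mu i == -1).
Proof.
have gen (s : seq 'I_r) : uniq s ->
    \big[mulmx/1%:M]_(j <- s | mu j == -1) cd_B1 eps j
      = flip_mx (fun i => (i \in s) && (mu i == -1)).
  elim: s => [|j s IH] /=; first by rewrite big_nil flip_mx0.
  case/andP => js /IH{}IH; rewrite big_cons IH cd_B1E.
  have [mj|mj] := boolP (mu j == -1).
    rewrite flip_mxM => [|i /=]; last first.
      by case: eqP => // ->; rewrite (negPf js).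
    congr flip_mx; apply/funext => i /=; rewrite in_cons.
    by case: (i =P j) => [->|]; rewrite ?mj.
  congr flip_mx; apply/funext => i /=; rewrite in_cons.
  by case: (i =P j) => [->|]; rewrite ?(negPf mj) ?andbF ?(negPf js).
rewrite /cd_B (gen _ (index_enum_uniq _)); congr flip_mx; apply/funext => i.
by rewrite mem_index_enum.
Qed.

Definition swap_sign (p : pred 'I_r) i : C := if p i then eps else 1.

(** The quotient of the rotations attached to opposite signs. *)
Definition swap_mx p := plane_mx (fun=> 0) (swap_sign p) (fun i => eps * swap_sign p i)
  (fun=> 0).
Definition swap_mxV p := plane_mx (fun=> 0) (fun i => eps * swap_sign p i) (swap_sign p)
  (fun=> 0).

Lemma swap_sign2 p i : swap_sign p i * swap_sign p i = 1.
Proof. by rewrite /swap_sign; case: ifP; rewrite ?mulr1. Qed.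

Lemma swap_mxK p : swap_mx p *m swap_mxV p = 1%:M.
Proof.
rewrite plane_mx_mul -plane_mx1; apply: eq_plane_mx => i; have := swap_sign2 p i => s2;
  rewrite ?mul0r ?mulr0 ?addr0 ?add0r ?s2 //.
by rewrite mulrACA eps2 mul1r.
Qed.

Lemma flip_mx_opp p : flip_mx (predC p) = flip_mx p *m swap_mx p.
Proof.
rewrite plane_mx_mul; apply: eq_plane_mx => i /=; rewrite /swap_sign; case: (p i) => /=;
  rewrite ?mul0r ?mulr0 ?mul1r ?mulr1 ?addr0 ?add0r ?eps2 //.
Qed.

Definition flip_mxV p : 'M[C]_(r + r) :=
  plane_mx (fun i => (~~ p i)%:R) (fun i => eps * (p i)%:R) (fun i => (p i)%:R)
           (fun i => (~~ p i)%:R).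

Lemma flip_mxK p : flip_mx p *m flip_mxV p = 1%:M.
Proof.
rewrite plane_mx_mul -plane_mx1; apply: eq_plane_mx => i /=; case: (p i) => /=;
  rewrite ?mul0r ?mulr0 ?mul1r ?mulr1 ?addr0 ?add0r ?eps2 //.
Qed.

Lemma mulmx_inv_comp n (A A' P P' : 'M[C]_n) : A *m A' = 1%:M -> P *m P' = 1%:M ->
  A *m P *m (P' *m A') = 1%:M.
Proof. by move=> hA hP; rewrite mulmxA -(mulmxA A) hP mulmx1. Qed.

Lemma right_inv_unit n (A B : 'M[C]_n) : A *m B = 1%:M -> A \in unitmx /\ invmx A = B.
Proof.
move=> AB; have [uA _] := mulmx1_unit AB; split=> //.
by rewrite -[RHS]mul1mx -(mulVmx uA) -mulmxA AB mulmx1.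
Qed.

End PlaneRotations.

Section PlaneConjugation.
Variables (R : realType) (r : nat) (eps : R[i]).
Local Notation C := R[i].
Variable E : algType C.
Hypothesis eps2 : eps * eps = 1.
Implicit Types (f : 'I_r -> C) (p : pred 'I_r).
Local Notation scal := (scal_mx E).
Local Notation revmx := (revmx C r).

Lemma scal_alg (k : C) (X : E) : k%:A * X = k *: X.
Proof. by rewrite -scalerAl mul1r. Qed.
Lemma scal_algr (k : C) (X : E) : X * k%:A = k *: X.
Proof. by rewrite -scalerAr mulr1. Qed.

Lemma scal_dg_mul m f (M : 'M[E]_(r, m)) i j : (scal (dgmx f) *m M) i j = f i *: M i j.
Proof.
rewrite !mxE (bigD1 i) //= !mxE eqxx mulr1n big1 ?addr0 ?scal_alg // => l li.
by rewrite !mxE eq_sym (negPf li) mulr0n scale0r mul0r.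
Qed.

Lemma mul_scal_dg m f (M : 'M[E]_(m, r)) i j : (M *m scal (dgmx f)) i j = f j *: M i j.
Proof.
rewrite !mxE (bigD1 j) //= !mxE eqxx mulr1n big1 ?addr0 ?scal_algr // => l li.
by rewrite !mxE (negPf li) mulr0n scale0r mulr0.
Qed.

Lemma scal_rev_mul m (M : 'M[E]_(r, m)) i j : (scal revmx *m M) i j = M (rev_ord i) j.
Proof.
rewrite !mxE (bigD1 (rev_ord i)) //= !mxE eqxx scale1r mul1r big1 ?addr0 // => l li.
by rewrite !mxE (negPf li) scale0r mul0r.
Qed.

Lemma mul_scal_rev m (M : 'M[E]_(m, r)) i j : (M *m scal revmx) i j = M i (rev_ord j).
Proof.
rewrite !mxE (bigD1 (rev_ord j)) //= !mxE rev_ordK eqxx scale1r mulr1 big1 ?addr0 //.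
move=> l li; rewrite !mxE -[j]rev_ordK (inj_eq rev_ord_inj) eq_sym (negPf li).
by rewrite scale0r mulr0.
Qed.

Lemma scal_plane f g h k : scal (plane_mx f g h k) =
  block_mx (scal (dgmx f)) (scal (dgmx g) *m scal revmx) (scal revmx *m scal (dgmx h))
    (scal revmx *m scal (dgmx k) *m scal revmx).
Proof. by rewrite /scal_mx map_block_mx -!/(scal_mx _ _) !scal_mxM. Qed.

Lemma scal_dg0 : scal (dgmx (fun _ : 'I_r => 0)) = 0.
Proof. by apply/matrixP => i j; rewrite !mxE mul0rn scale0r. Qed.

Lemma scal_flip p : let u := fun i => (~~ p i)%:R : C in
  let v := fun i => (p i)%:R : C in let w := fun i => eps * (p i)%:R : C in
  let dg f := scal (dgmx f) in let J := scal revmx in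
  scal (flip_mx eps p) = block_mx (dg u) (dg v *m J) (J *m dg w) (J *m dg u *m J) /\
  scal (flip_mxV eps p) = block_mx (dg u) (dg w *m J) (J *m dg v) (J *m dg u *m J).
Proof. by split; apply: scal_plane. Qed.

Lemma flip_conj_diag p (M11 M12 M21 M22 : 'M[E]_r) i :
  (scal (flip_mx eps p) *m block_mx M11 M12 M21 M22 *m scal (flip_mxV eps p))
    (lshift r i) (lshift r i) = if p i then M22 (rev_ord i) (rev_ord i) else M11 i i.
Proof.
have [f1 f2] := scal_flip p.
apply: (eq_trans (congr2 (fun A B => (A *m block_mx M11 M12 M21 M22 *m B)
  (lshift r i) (lshift r i)) f1 f2)).
rewrite !mulmx_block block_mxEul.
set u := (fun i => (~~ p i)%:R : C); set v := (fun i => (p i)%:R : C).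
have ad m (X Y : 'M[E]_(r, m)) k l : (X + Y) k l = X k l + Y k l by rewrite mxE.
have e2 (X : 'M[E]_r) : (X *m (scal revmx *m scal (dgmx v))) i i = v i *: X i (rev_ord i).
  by rewrite mulmxA mul_scal_dg mul_scal_rev.
have e3 (X : 'M[E]_r) k :
    ((scal (dgmx v) *m scal revmx) *m X) i k = v i *: X (rev_ord i) k.
  by rewrite -mulmxA scal_dg_mul scal_rev_mul.
rewrite ad mul_scal_dg e2 !ad !e3 !scal_dg_mul /u /v; case: (p i) => /=.
  by rewrite !scale0r !scale1r !add0r.
by rewrite !scale0r !scale1r !addr0.
Qed.

Lemma conj_sub n (Q Q' Qi Qi' b a : 'M[E]_n) y :
  Q' *m Qi = 1%:M -> Qi' *m Q = 1%:M ->
  Q' *m (cmx E n y - b *m a) *m Qi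
    = cmx E n y + (Q' *m b *m Qi') *m (Q *m - a *m Qi).
Proof.
move=> h1 h2; rewrite mulmxBr mulmxBl -cmx_comm -(mulmxA (cmx E n y)) h1 mulmx1.
congr (_ + _); rewrite !mulmxA -(mulmxA (Q' *m b) Qi' Q) h2 mulmx1.
by rewrite mulmxN mulNmx.
Qed.

Definition swapped_b p (b : 'M[E]_r) : 'M[E]_r :=
  \matrix_(c, i) (eps * swap_sign eps p (rev_ord c) * swap_sign eps p i
                    *: b (rev_ord c) (rev_ord i)).
Definition swapped_a p (a : 'M[E]_r) : 'M[E]_r :=
  \matrix_(i, c) (- (eps * swap_sign eps p i * swap_sign eps p (rev_ord c))
                    *: a (rev_ord i) (rev_ord c)).

Lemma swap_conj_deg p y (b a : 'M[E]_r) :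
  scal (swap_mx eps p) *m block_deg y b a *m scal (swap_mxV eps p)
    = block_mx 1%:M (swapped_a p a) (swapped_b p b)
        (cmx E r y + swapped_b p b *m swapped_a p a).
Proof.
apply: (eq_trans (congr2 (fun A B => A *m block_deg y b a *m B)
  (scal_plane _ _ _ _) (scal_plane _ _ _ _))).
rewrite !scal_dg0 !mulmx0 !mul0mx !mulmx_block.
rewrite !mul0mx !mulmx0 !add0r !addr0 mulmx1.
have s2 i := swap_sign2 eps2 p i.
have Q1 : scal (dgmx (swap_sign eps p)) *m scal revmx *m
    (scal revmx *m scal (dgmx (swap_sign eps p))) = 1%:M.
  rewrite -!scal_mxM -mulmxA (mulmxA revmx) revmx_mul mul1mx dgmx_mul.
  by rewrite (eq_dgmx (g := fun=> 1)) ?dgmx1 ?scal_mx1.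
have bE : scal revmx *m scal (dgmx (fun i => eps * swap_sign eps p i)) *m b *m
    (scal revmx *m scal (dgmx (swap_sign eps p))) = swapped_b p b.
  apply/matrixP => c i; rewrite mulmxA mul_scal_dg mul_scal_rev -mulmxA scal_rev_mul.
  by rewrite scal_dg_mul [RHS]mxE scalerA mulrC.
have aE : scal (dgmx (swap_sign eps p)) *m scal revmx *m - a *m
    (scal (dgmx (fun i => eps * swap_sign eps p i)) *m scal revmx) = swapped_a p a.
  apply/matrixP => c i; rewrite mulmxA mul_scal_rev mul_scal_dg -mulmxA scal_dg_mul.
  rewrite scal_rev_mul [RHS]mxE mxE !scalerN scaleNr scalerA; congr (- (_ *: _)); ring.
have Q2 : scal revmx *m scal (dgmx (fun i => eps * swap_sign eps p i)) *m
    (scal (dgmx (fun i => eps * swap_sign eps p i)) *m scal revmx) = 1%:M.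
  rewrite -!scal_mxM -mulmxA (mulmxA (dgmx _)) dgmx_mul (eq_dgmx (g := fun=> 1)).
    by rewrite dgmx1 mul1mx revmx_mul scal_mx1.
  by move=> i; rewrite mulrACA eps2 s2 mulr1.
have Q3 : scal revmx *m scal (dgmx (swap_sign eps p)) *m
    (scal (dgmx (swap_sign eps p)) *m scal revmx) = 1%:M.
  rewrite -!scal_mxM -mulmxA (mulmxA (dgmx _)) dgmx_mul (eq_dgmx (g := fun=> 1)) //.
  by rewrite dgmx1 mul1mx revmx_mul scal_mx1.
rewrite Q1 -aE -bE; congr block_mx.
exact: conj_sub Q2 Q3.
Qed.

End PlaneConjugation.

Section ClassicalLax.
Variables (R : realType) (r : nat) (dg : bool).
Local Notation C := R[i].
Local Notation label := ('I_r * 'I_r)%type.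

(** The two types differ by the symmetry of the blocks: dg tells whether the
    diagonal labels (i, i) are present, as they are in type C. *)
Definition cd_eps : C := if dg then -1 else 1.
Definition cd_kap : C := if dg then r%:R + 1 else r%:R - 1.
Definition cd_labels : {set label} := if dg then sp_labels r else so_labels r.

Lemma cd_eps2 : cd_eps * cd_eps = 1.
Proof. by rewrite /cd_eps; case: dg; ring. Qed.

Lemma cd_labelsP l : l \in cd_labels -> (l.1 < l.2)%N || dg && (l.1 == l.2).
Proof. by rewrite /cd_labels; case: dg; rewrite !inE ?orbF //= leq_eqVlt orbC. Qed.

Section Entries.
Variable E : algType C.
Implicit Types f ab an : label -> E.

Definition cd_Ab ab : 'M[{poly E}]_r := if dg then sp_Ab ab else so_Ab ab.
Definition cd_A an : 'M[{poly E}]_r := if dg then sp_A an else so_A an.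

(** The (i, j) entry of a matrix that is symmetric or antisymmetric with respect
    to the labels, with diagonal entries multiplied by md. *)
Definition sym_entry (md : C) f (i j : 'I_r) : E :=
  if (i < j)%N then f (i, j) else if i == j then md *: f (i, i)
  else (- cd_eps) *: f (j, i).

Definition bar_mult : C := if dg then 2 else 0.
Definition ann_mult : C := if dg then 1 else 0.

Definition Ab_mx ab : 'M[E]_r := \matrix_(i, c) sym_entry bar_mult ab i (rev_ord c).
Definition A_mx an : 'M[E]_r := \matrix_(c, i) sym_entry ann_mult an i (rev_ord c).

Lemma cd_Ab_eval ab x : map_mx (evp x) (cd_Ab ab) = Ab_mx ab.
Proof.
apply/matrixP => i c; rewrite !mxE /cd_Ab /sym_entry /bar_mult /cd_eps.
case: dg; rewrite !mxE /= evpC; case: ifP => // _; case: ifP => // _.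
- by rewrite scaler_nat.
- by rewrite opprK scale1r.
- by rewrite scale0r.
- by rewrite scaleN1r.
Qed.

Lemma cd_A_eval an x : map_mx (evp x) (cd_A an) = A_mx an.
Proof.
apply/matrixP => c i; rewrite !mxE /cd_A /sym_entry /ann_mult /cd_eps.
case: dg; rewrite !mxE; move: (rev_ord c) => j; rewrite /= evpC.
  rewrite leq_eqVlt -[(i : nat) == j]/(i == j); case: (eqVneq i j) => [<-|ij] /=.
    by rewrite ltnn scale1r.
  by case: ifP => // _; rewrite opprK scale1r.
case: ifP => // _; case: ifP => // _; first by rewrite scale0r.
by rewrite scaleN1r.
Qed.

Lemma cd_lax_eval t ab an x :
  eval_lax (cd_lax cd_kap t (cd_Ab ab) (cd_A an)) x
    = block_lax (x + t) (x - t - cd_kap) (Ab_mx ab) (A_mx an).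
Proof.
have ec (k : C) : map_mx (evp x) (sc E k)%:M = cmx E r k.
  by rewrite map_scalar_mx /= evp_sc.
have eX : map_mx (evp x) ('X%:M : 'M_r) = cmx E r x.
  by rewrite map_scalar_mx /= evpX.
rewrite eval_laxE /cd_lax map_block_mx /block_lax.
have -> : t *+ 2 + cd_kap = x + t - (x - t - cd_kap) by rewrite mulr2n; ring.
rewrite !(map_mxN, map_mxD, map_mxM, map_mxB) cd_Ab_eval cd_A_eval !raddfB !raddfD /=.
by rewrite !ec !eX !(cmxD, cmxN).
Qed.

Lemma cd_deg_lax_eval ab an x :
  eval_lax (cd_deg_lax (cd_Ab ab) (cd_A an)) x = block_deg x (Ab_mx ab) (A_mx an).
Proof.
have eX : map_mx (evp x) ('X%:M : 'M_r) = cmx E r x.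
  by rewrite map_scalar_mx /= evpX.
rewrite eval_laxE /cd_deg_lax map_block_mx /block_deg.
by rewrite !(map_mxN, map_mxD, map_mxM, map_mxB, map_mx1) cd_Ab_eval cd_A_eval eX.
Qed.

End Entries.

Lemma related_sym_entry (L : Type) (E E' : algType C) (ell : L -> E) (ell' : L -> E')
    md f f' i j : (forall l, related ell ell' (f l) (f' l)) ->
  related ell ell' (sym_entry md f i j) (sym_entry md f' i j).
Proof.
move=> h; rewrite /sym_entry; case: ifP => _ //; case: ifP => _; exact: relatedZ.
Qed.

Lemma related_Ab_mx (L : Type) (E E' : algType C) (ell : L -> E) (ell' : L -> E') f f' :
  (forall l, related ell ell' (f l) (f' l)) ->
  related_mx ell ell' (Ab_mx f) (Ab_mx f').
Proof. by move=> h i j; rewrite !mxE; apply: related_sym_entry. Qed.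

Lemma related_A_mx (L : Type) (E E' : algType C) (ell : L -> E) (ell' : L -> E') f f' :
  (forall l, related ell ell' (f l) (f' l)) ->
  related_mx ell ell' (A_mx f) (A_mx f').
Proof. by move=> h i j; rewrite !mxE; apply: related_sym_entry. Qed.

Lemma related_cmx (L : Type) (E E' : algType C) (ell : L -> E) (ell' : L -> E') n k :
  related_mx ell ell' (cmx E n k) (cmx E' n k).
Proof.
move=> i j; rewrite !mxE; case: eqP => _; rewrite ?mulr0n ?mulr1n.
  exact: related_scalar.
exact: related0.
Qed.

Lemma related_block_lax (L : Type) (E E' : algType C) (ell : L -> E) (ell' : L -> E')
    p q x y b b' a a' : related_mx ell ell' b b' -> related_mx ell ell' a a' ->
  related_mx ell ell' (block_lax (p := p) (q := q) x y b a) (block_lax x y b' a').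
Proof.
move=> rb ra; have rab := related_mul ra rb; have rba := related_mul rb ra.
apply: related_block.
- by apply: related_add; [exact: related_cmx|exact: related_opp].
- apply: related_opp; apply: related_mul => //.
  by apply: related_add; [exact: related_cmx|exact: related_opp].
- exact: related_opp.
by apply: related_add => //; apply: related_cmx.
Qed.

Lemma related_id (L : Type) (E E' : algType C) (ell : L -> E) (ell' : L -> E') n :
  related_mx ell ell' (1%:M : 'M_n) 1%:M.
Proof. by have := @related_cmx L E E' ell ell' n 1; rewrite /cmx !scale1r. Qed.

Lemma related_block_deg (L : Type) (E E' : algType C) (ell : L -> E) (ell' : L -> E')
    p q x b b' a a' : related_mx ell ell' b b' -> related_mx ell ell' a a' ->
  related_mx ell ell' (block_deg (p := p) (q := q) x b a) (block_deg x b' a').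
Proof.
move=> rb ra; apply: related_block => //; last exact: related_id.
  apply: related_add; first exact: related_cmx.
  by apply: related_opp; apply: related_mul.
exact: related_opp.
Qed.

End ClassicalLax.

Section ClassicalFactorisation.
Variables (R : realType) (r : nat) (dg : bool) (mu : 'I_r -> int) (th : 'I_r -> R[i]).
Local Notation C := R[i].
Hypothesis muP : forall i, mu i = 1 \/ mu i = -1.
Hypothesis dom_th : cl_domain th.

Let S := cd_labels r dg.
Let J : finType := {l : 'I_r * 'I_r | l \in S}.
Let eps := cd_eps R dg.
Let p : pred 'I_r := fun i => mu i == -1.
Let flip := cd_flip S mu.
Let tau := tau_of th.
Let eps2 : eps * eps = 1. Proof. exact: cd_eps2. Qed.

Definition cd_wt (l : J) (i : 'I_r) : int :=
  - ((i == (val l).1)%:R + (i == (val l).2)%:R).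

Lemma cd_wlam (u : 'I_r -> C) l :
  wlam cd_wt u l = (u (val l).1 * u (val l).2)^-1.
Proof.
have pick a : \prod_i u i ^+ (i == a) = u a.
  rewrite (bigD1 a) //= eqxx expr1 big1 ?mulr1 // => i /negPf->.
  by rewrite expr0.
rewrite -(pick (val l).1) -(pick (val l).2) -big_split -prodfV.
apply: eq_bigr => i _ /=; rewrite /cd_wt -exprD -natrD natz -exprnN.
by [].
Qed.

Let tau_neq0 i : tau i != 0. Proof. exact: expC_neq0. Qed.

Let tau' := cd_tau mu tau.
Let tau'' := cd_tau (fun i => - mu i) tau.

Let tau'_neq0 i : tau' i != 0.
Proof. by rewrite /tau' /cd_tau; case: ifP; rewrite ?invr_eq0. Qed.

Let p_opp i : (- mu i == -1) = ~~ p i.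
Proof. by rewrite /p; case: (muP i) => ->. Qed.

Let tau''E i : tau'' i = (tau' i)^-1.
Proof.
by rewrite /tau'' /tau' /cd_tau p_opp /p; case: (mu i == -1); rewrite ?invrK.
Qed.

Let lam1 := wlam cd_wt tau'.
Let lam2 := wlam cd_wt tau''.

Let lam2E l : lam2 l = (lam1 l)^-1.
Proof. by rewrite /lam2 /lam1 !cd_wlam !tau''E -invfM. Qed.

Let lamT (l : J) : C := if p (val l).1 then (lam1 l)^-1 else lam1 l.

Let in_flip (l : J) : in_labels flip l = p (val l).1.
Proof. by rewrite /in_labels /flip inE (valP l). Qed.

Let lam1_neq0 l : lam1 l != 0.
Proof. by rewrite /lam1 cd_wlam invr_eq0 mulf_neq0. Qed.

Let lamT_neq0 l : lamT l != 0.
Proof. by rewrite /lamT; case: ifP; rewrite ?invr_eq0 lam1_neq0. Qed.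

Let lamT_lt1 l : `|lamT l| < 1.
Proof.
have [dom1 dom2] := dom_th; set a := (val l).1; set b := (val l).2.
have inv_lt1 i : `|tau i|^-1 < 1 by rewrite invf_lt1 ?dom2 // normr_gt0.
have le_ab := cd_labelsP (valP l); rewrite -/a -/b in le_ab.
have lE : `|lamT l| = `|tau a|^-1 * (if p a == p b then `|tau b|^-1 else `|tau b|).
  rewrite /lamT /lam1 cd_wlam -/a -/b /tau' /cd_tau -!/(p _).
  by case: (p a); case: (p b); rewrite /= ?invrK ?invfM ?invrK normrM ?normfV.
rewrite lE; case: eqP => [_|pab].
  by rewrite mulr_ilt1 // ?invr_ge0.
have lt_ab : (a < b)%N by case/orP: le_ab => // /andP[_ /eqP ab]; rewrite ab in pab.
by rewrite mulrC ltr_pdivrMr ?normr_gt0 // mul1r; apply: dom1.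
Qed.

Let ph_lamT l : ph_weight lamT (in_labels flip) l = lam1 l.
Proof. by rewrite /ph_weight in_flip /lamT; case: (p _); rewrite ?invrK. Qed.

Let lam1_neq1 l : lam1 l != 1.
Proof. by rewrite -ph_lamT; apply: ph_weight_neq1. Qed.

Let lam2_neq0 l : lam2 l != 0. Proof. by rewrite lam2E invr_eq0. Qed.
Let lam2_neq1 l : lam2 l != 1. Proof. by rewrite lam2E invr_eq1. Qed.

Definition gcd_laxmu (t : C) : 'M[{poly osc R S}]_(r + r) :=
  conj_lax (cd_B eps mu)
    (cd_lax (cd_kap R r dg) t (cd_Ab dg (ph_bar R S flip)) (cd_A dg (ph_ann R S flip))).

Definition gcd_twist t := twist th (fun i => gen_lax 0 (gcd_laxmu t) (emb i) (emb i)).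

Let cd_B_unit : cd_B eps mu \in unitmx /\ invmx (cd_B eps mu) = flip_mxV eps p.
Proof. by rewrite cd_BE //; apply: right_inv_unit; apply: flip_mxK. Qed.

Let gcd_eval t x : eval_lax (gcd_laxmu t) x =
  scal_mx _ (cd_B eps mu) *m
    block_lax (x + t) (x - t - cd_kap R r dg) (Ab_mx dg (ph_bar R S flip))
      (A_mx dg (ph_ann R S flip)) *m scal_mx _ (invmx (cd_B eps mu)).
Proof. by rewrite /gcd_laxmu eval_conj_lax cd_lax_eval. Qed.

Let sgn (l : J) : int := osc_sign flip (val l).

Let slope (i : 'I_r) (l : J) : int := (i == (val l).1)%:R + (i == (val l).2)%:R.

Let sym_slope (i j : 'I_r) (l : J) : int :=
  sgn l * (((i, j) == val l)%:R + ((j, i) == val l)%:R).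

Let affineZ (X : osc R S) c (w : J -> int) : affine X c w ->
  affine (2 *: X) (2 * c) (fun l => w l + w l).
Proof.
move=> h; rewrite scaler_nat mulr2n mulr_natl mulr2n; exact: affineD.
Qed.

Let label_sgn (ij : 'I_r * 'I_r) (l : J) :
  osc_sign flip ij * (ij == val l)%:R = sgn l * (ij == val l)%:R.
Proof. by rewrite /sgn; case: eqP => [->|]; rewrite ?mulr0. Qed.

Let sym_affine (f g : 'I_r * 'I_r -> osc R S) (md1 md2 : C) :
  (forall s, exists c, affine (f s * g s) c
     (fun j => osc_sign flip s * (s == val j)%:R)) ->
  md1 * md2 = (if dg then 2 else 0) ->
  forall i j, exists c, affine (sym_entry dg md1 f i j * sym_entry dg md2 g i j) c
    (sym_slope i j).
Proof.
move=> hfg hmd i j; rewrite /sym_entry /sym_slope.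
have nlt (a b : 'I_r) (l : J) : (b < a)%N -> ((a, b) == val l) = false.
  move=> ba; apply/eqP => e; have := cd_labelsP (valP l); rewrite -e /=.
  by case/orP => [|/andP[_ /eqP ab]]; [rewrite ltnNge ltnW|rewrite ab ltnn in ba].
case: (ltngtP i j) => [ij|ij|/val_inj <-].
- have [c hc] := hfg (i, j); exists c; apply: affine_ext hc _ => l.
  by rewrite label_sgn (nlt j i) // addr0.
- have -> : (i == j) = false by apply/eqP => e; rewrite e ltnn in ij.
  have [c hc] := hfg (j, i); exists c.
  rewrite -scalerAl -scalerAr scalerA mulrNN cd_eps2 scale1r.
  by apply: affine_ext hc _ => l; rewrite label_sgn (nlt i j) // add0r.
rewrite eqxx -scalerAl -scalerAr scalerA hmd; have [c hc] := hfg (i, i).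
have [dgE|dgE] : dg = true \/ dg = false by case: (dg); [left|right].
  rewrite (_ : (if dg then 2 else 0) = 2 :> C); last by rewrite dgE.
  exists (2 * c); apply: (affine_ext (affineZ hc)) => l.
  by rewrite !label_sgn mulrDr.
rewrite (_ : (if dg then 2 else 0) = 0 :> C); last by rewrite dgE.
exists 0; rewrite scale0r; have h0 := @affine0 R ('I_r * 'I_r)%type S.
apply: (affine_ext h0) => l.
rewrite (_ : ((i, i) == val l) = false) ?addr0 ?mulr0 //; apply/eqP => e.
by have := cd_labelsP (valP l); rewrite -e /= ltnn dgE.
Qed.

Let sum_slope i (l : J) : \sum_(c < r) sym_slope i c l = sgn l * slope i l.
Proof.
rewrite /sym_slope -mulr_sumr /slope; congr (_ * _); move: (val l) => [a b].
rewrite big_split /=; congr (_ + _).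
  rewrite (bigD1 b) //= xpair_eqE eqxx andbT big1 ?addr0 // => j /negPf jb.
  by rewrite xpair_eqE jb andbF.
rewrite (bigD1 a) //= xpair_eqE eqxx big1 ?addr0 // => j /negPf ja.
by rewrite xpair_eqE ja.
Qed.

Let twist_affine t i : exists c, affine (gen_lax 0 (gcd_laxmu t) (emb i) (emb i)) c
  (fun l => (if p i then 1 else -1) * sgn l * slope i l).
Proof.
rewrite /gen_lax coef0_eval gcd_eval cd_B_unit.2 cd_BE // /emb flip_conj_diag.
have cmxE (k : C) a : cmx (osc R S) r k a a = k%:A by rewrite mxE eqxx.
have ad (X Y : 'M[osc R S]_r) a b : (X + Y) a b = X a b + Y a b by rewrite mxE.
have opp (X : 'M[osc R S]_r) a b : (- X) a b = - X a b by rewrite mxE.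
have mm : bar_mult R dg * ann_mult R dg = (if dg then 2 else 0).
  by rewrite /bar_mult /ann_mult; case: dg; rewrite ?mulr1 ?mulr0.
have mm' : ann_mult R dg * bar_mult R dg = (if dg then 2 else 0) by rewrite mulrC.
have hsum t' (T : 'I_r -> osc R S) : (forall j, exists c, affine (T j) c (sym_slope i j)) ->
    exists2 c, affine (t'%:A + \sum_j T j) c (fun l => sgn l * slope i l)
      & exists c, affine (t'%:A - \sum_j T j) c (fun l => - (sgn l * slope i l)).
  move=> /boolp.choice[c hc]; have hs := affine_sum (index_enum 'I_r) (P := xpredT) (fun j _ => hc j).
  have hs2 : affine (\sum_j T j) (\sum_j c j) (fun l => sgn l * slope i l).
    by apply: (affine_ext hs) => l; rewrite sum_slope.
  exists (t' + \sum_j c j).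
    have h0 := affineD (@affine_scalar R J t') hs2.
    by apply: (affine_ext h0) => l; rewrite add0r.
  exists (t' - \sum_j c j); have h0 := affineD (@affine_scalar R J t') (affineN hs2).
  by apply: (affine_ext h0) => l; rewrite add0r.
rewrite -/(p i); case: (p i).
  have hA j : exists c, affine (A_mx dg (ph_ann R S flip) (rev_ord i) j
      * Ab_mx dg (ph_bar R S flip) j (rev_ord i)) c (sym_slope i j).
    have [c hc] := sym_affine (@affine_osc_conumber R _ S flip) mm' j i.
    exists c; rewrite !mxE rev_ordK; apply: (affine_ext hc) => l.
    by rewrite /sym_slope addrC.
  have [c hc _] := hsum (0 - t - cd_kap R r dg) _ hA; exists c.
  rewrite ad cmxE [X in _ + X]mxE; apply: (affine_ext hc) => l.
  by rewrite mul1r.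
have hB j : exists c, affine (Ab_mx dg (ph_bar R S flip) i (rev_ord j)
      * A_mx dg (ph_ann R S flip) (rev_ord j) i) c (sym_slope i j).
  by rewrite !mxE rev_ordK; exact: (sym_affine (@affine_osc_number R _ S flip) mm i j).
have [_ _ [c hc]] := hsum (0 + t) _ hB; exists c.
rewrite ad cmxE opp [X in _ - X]mxE (reindex_inj rev_ord_inj); apply: (affine_ext hc) => l.
by rewrite mulN1r mulNr.
Qed.

Let twist_diag t : exists2 k : C, k != 0 & diag_op (gcd_twist t) k lamT.
Proof.
have [k k0 hk] := twist_diagonal th (twist_affine t); exists k => //.
suff <- : (fun l : J => \prod_i expC (th i) ^
    ((if p i then 1 else -1) * sgn l * slope i l)) = lamT by [].
apply/funext => l; rewrite /lamT /lam1.
have -> : \prod_i expC (th i) ^ ((if p i then 1 else -1) * sgn l * slope i l)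
    = \prod_i (tau' i ^ cd_wt l i) ^ sgn l.
  apply: eq_bigr => i _; rewrite exprz_exp /tau' /cd_tau -!/(p i) /tau /tau_of /cd_wt.
  rewrite /slope; case: (p i).
    by rewrite mul1r exprz_inv mulNr opprK mulrC.
  by rewrite mulN1r !mulNr mulrC.
rewrite /sgn /osc_sign /flip inE (valP l) /= -/(p _); case: (p _).
  by rewrite /wlam -prodfV; apply: eq_bigr => i _; rewrite exprN1.
by apply: eq_bigr => i _; rewrite expr1z.
Qed.

Let E := fock_end R ((J + J) + (J + J))%type.
Let p1 : bool * J -> E := left_letter lam1 lam2.
Let p2 : bool * J -> E := right_letter lam1 lam2.
Let s := swap_sign eps p.
Let sgl (l : 'I_r * 'I_r) : C := s l.1 * s l.2.
Let mult (l : 'I_r * 'I_r) : C := if l.1 == l.2 then 2 else 1.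
Let cf (l : J) := sgl (val l) * mult (val l).
Let df (l : J) := mult (val l).
Let ef (l : J) := sgl (val l).
Let mixed := mixed_letter p1 p2 cf.
Let del := mixed_del p1 p2 df ef.

Let sgl2 l : sgl l * sgl l = 1.
Proof. by rewrite /sgl mulrACA !swap_sign2 // mulr1. Qed.

Let mixed_true l : extend_letter mixed true l = extend_letter p1 true l.
Proof. by rewrite /extend_letter; case: insub. Qed.

Let mixed_false l : extend_letter mixed false l
  = extend_letter p1 false l + (sgl l * mult l) *: extend_letter p2 true l.
Proof.
rewrite /extend_letter; case: insubP => [u _ <-|_] /=; first by [].
by rewrite scaler0 addr0.
Qed.

Let ext_del (l : 'I_r * 'I_r) : E := oapp del 0 (insub l).

Let ext_delE l : ext_del l
  = mult l *: extend_letter p1 true l + sgl l *: extend_letter p2 false l.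
Proof.
rewrite /ext_del /extend_letter; case: insubP => [u _ <-|_] /=; first by [].
by rewrite !scaler0 addr0.
Qed.

Let A_mixed : A_mx dg (extend_letter mixed false) =
  A_mx dg (extend_letter p1 false)
    - swapped_b eps p (Ab_mx dg (extend_letter p2 true)).
Proof.
apply/matrixP => c i; rewrite !mxE !rev_ordK; move: (rev_ord c) => j {c}.
rewrite /sym_entry !mixed_false /mult /sgl -/(s _) -/(s _) /= -/eps.
case: (ltngtP i j) => [ij|ij|/val_inj <-].
- have -> : (i == j) = false by apply/eqP => e; rewrite e ltnn in ij.
  have -> : (j == i) = false by apply/eqP => e; rewrite e ltnn in ij.
  rewrite mulr1 scalerA -scaleNr; congr (_ + _ *: _).
  by rewrite -[LHS]mulr1 -eps2; ring.
- have -> : (i == j) = false by apply/eqP => e; rewrite e ltnn in ij.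
  have -> : (j == i) = false by apply/eqP => e; rewrite e ltnn in ij.
  rewrite mulr1 scalerDr scalerA -scaleNr; congr (_ + _ *: _).
  by rewrite mulNr mulrA.
rewrite eqxx scalerDr !scalerA -scaleNr; congr (_ + _ *: _).
rewrite /ann_mult /bar_mult /eps /cd_eps.
by case: (dg); ring.
Qed.

Let del_mx : Ab_mx dg (extend_letter mixed true)
    + swapped_a eps p (A_mx dg (extend_letter p2 false))
  = \matrix_(i, c) sym_entry dg (ann_mult R dg) ext_del i (rev_ord c).
Proof.
apply/matrixP => i c; rewrite !mxE !rev_ordK; move: (rev_ord c) => j {c}.
rewrite /sym_entry !mixed_true !ext_delE /mult /sgl -/(s _) -/(s _) /= -/eps.
case: (ltngtP i j) => [ij|ij|/val_inj <-].
- have -> : (i == j) = false by apply/eqP => e; rewrite e ltnn in ij.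
  have -> : (j == i) = false by apply/eqP => e; rewrite e ltnn in ij.
  rewrite scale1r scalerA; congr (_ + _ *: _).
  by rewrite -[RHS]mulr1 -eps2; ring.
- have -> : (i == j) = false by apply/eqP => e; rewrite e ltnn in ij.
  have -> : (j == i) = false by apply/eqP => e; rewrite e ltnn in ij.
  rewrite scale1r scalerDr scalerA; congr (_ + _ *: _).
  ring.
rewrite eqxx scalerDr !scalerA.
rewrite /ann_mult /bar_mult /eps /cd_eps.
apply: congr2; [apply: (congr1 ( *:%R^~ _))|apply: (congr1 ( *:%R^~ _))];
by case: (dg); ring.
Qed.

Let B := cd_B eps mu.
Let B2 := cd_B eps (fun i => - mu i).

Let B2E : B2 = B *m swap_mx eps p.
Proof.
rewrite /B2 /B; refine (eq_trans (@cd_BE R r eps (fun i => - mu i)) _).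
refine (eq_trans _ (esym (congr1 (mulmx^~ (swap_mx eps p)) (@cd_BE R r eps mu)))).
refine (eq_trans _ (flip_mx_opp eps2 p)); congr flip_mx; apply/funext => i.
exact: p_opp.
Qed.

Let B2_inv : B2 \in unitmx /\ invmx B2 = swap_mxV eps p *m invmx B.
Proof.
have uB : B \in unitmx by case: cd_B_unit.
by have := right_inv_unit (mulmx_inv_comp (mulmxV uB) (swap_mxK eps2 p)); rewrite -B2E.
Qed.

Let letters_hom1 l : homogeneous (lam12 lam1 lam2) (weight lam1 l) (p1 l).
Proof. exact: left_homogeneous. Qed.

Let letters_hom2 l :
  homogeneous (lam12 lam1 lam2) (weight (fun j => (lam1 j)^-1) l) (p2 l).
Proof.
have <- : lam2 = (fun j => (lam1 j)^-1) by apply/funext.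
exact: right_homogeneous.
Qed.

Let ced l : cf l * ef l = df l.
Proof. by rewrite /cf /ef /df mulrAC sgl2 mul1r. Qed.

Let factor_identity t x (y := x - t - cd_kap R r dg) :
  (scal_mx E B *m block_deg (x + t) (Ab_mx dg (extend_letter p1 true))
      (A_mx dg (extend_letter p1 false)) *m scal_mx E (invmx B)) *m
  (scal_mx E B2 *m block_deg y (Ab_mx dg (extend_letter p2 true))
      (A_mx dg (extend_letter p2 false)) *m scal_mx E (invmx B2))
  = scal_mx E B *m (block_lax (x + t) y (Ab_mx dg (extend_letter mixed true))
        (A_mx dg (extend_letter mixed false)) *m
      block_mx 1%:M (\matrix_(i, c) sym_entry dg (ann_mult R dg) ext_del i (rev_ord c))
        0 1%:M) *m scal_mx E (invmx B).
Proof.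
have eb : extend_letter mixed true = extend_letter p1 true.
  by apply/funext => l; apply: mixed_true.
rewrite A_mixed -del_mx eb -block_factor -swap_conj_deg // B2_inv.2 B2E !scal_mxM.
set L1 := block_deg _ _ _; set L2 := block_deg _ _ _.
have BB : scal_mx E (invmx B) *m scal_mx E B = 1%:M.
  by rewrite -scal_mxM mulVmx ?scal_mx1 //; case: cd_B_unit.
by rewrite -!mulmxA (mulmxA (scal_mx E (invmx B))) BB mul1mx.
Qed.

Let D_diag : exists kD : ('I_r -> C) -> C, (forall u, kD u != 0) /\
  forall u, diag_op (cd_D S u) (kD u) (wlam cd_wt (tau_of u)).
Proof.
have [c hc] := boolp.choice (@affine_osc_number R _ S finset.set0).
exists (fun u => \prod_(q in S) expC (- (u q.1 + u q.2) * c q)); split=> u.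
  by apply/prodf_neq0 => q _; apply: expC_neq0.
have -> : wlam cd_wt (tau_of u) = fun l : J => \prod_(q in S)
     expC (- (u q.1 + u q.2)) ^ (osc_sign finset.set0 q * (q == val l)%:R).
  apply/funext => l; rewrite cd_wlam (bigD1 (val l)) ?(valP l) //= big1 ?mulr1.
    by rewrite /osc_sign inE eqxx mulr1 expr1z expCN expCD.
  by move=> q /andP[_ /negPf ql]; rewrite ql mulr0 expr0z.
apply: diagonal_prod => q _; apply: diagonal_opexp; have := hc q.
have [e1 e2] := osc0 R S q.
have -> : Defs.number R S q = ph_bar R S finset.set0 q * ph_ann R S finset.set0 q.
  by rewrite -e1 -e2.
by [].
Qed.

Let dom_wlam_lt1 (u : 'I_r -> C) : cl_domain u -> forall l, `|wlam cd_wt (tau_of u) l| < 1.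
Proof.
move=> [_ du] l; rewrite cd_wlam normfV normrM invfM.
have inv_lt1 i : `|tau_of u i|^-1 < 1 by rewrite invf_lt1 ?du // normr_gt0 expC_neq0.
by rewrite mulr_ilt1 // ?invr_ge0.
Qed.

Definition gcd_Q N x u := qop (@cl_domain R r) (cd_D S) N
  (cd_deg_lax (cd_Ab dg (osc_bar R S)) (cd_A dg (osc_ann R S))) x u.

Theorem classical_factorisation N t x :
  transfer_cvg N (gcd_twist t) (gcd_laxmu t) x /\
  transfer N (gcd_twist t) (gcd_laxmu t) x = trace (gcd_twist t) *:
    (conj_tens B (gcd_Q N (x + t) tau') *m
     conj_tens B2 (gcd_Q N (x - t - cd_kap R r dg) tau'')).
Proof.
have [k k0 dW] := twist_diag t.
have ebar : ph_bar R S flip = extend_letter (ph_letter R (in_labels flip)) true.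
  by apply/funext => l; apply: ph_barE.
have eann : ph_ann R S flip = extend_letter (ph_letter R (in_labels flip)) false.
  by apply/funext => l; apply: ph_annE.
have ebar0 : osc_bar R S = extend_letter (ph_letter R (pred0 : pred J)) true.
  by apply/funext => l; apply: osc_barE.
have eann0 : osc_ann R S = extend_letter (ph_letter R (pred0 : pred J)) false.
  by apply/funext => l; apply: osc_annE.
have rT (E' : algType C) (ell' : bool * J -> E') y z :
  related_mx (ph_letter R (in_labels flip)) ell'
    (block_lax y z (Ab_mx dg (ph_bar R S flip)) (A_mx dg (ph_ann R S flip)))
    (block_lax y z (Ab_mx dg (extend_letter ell' true)) (A_mx dg (extend_letter ell' false))).
  rewrite ebar eann; apply: related_block_lax; [apply: related_Ab_mx|apply: related_A_mx];
  by move=> l; apply: related_extend.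
have rQ (E' : algType C) (ell' : bool * J -> E') y :
  related_mx (ph_letter R (pred0 : pred J)) ell'
    (block_deg y (Ab_mx dg (osc_bar R S)) (A_mx dg (osc_ann R S)))
    (block_deg y (Ab_mx dg (extend_letter ell' true)) (A_mx dg (extend_letter ell' false))).
  rewrite ebar0 eann0; apply: related_block_deg; [apply: related_Ab_mx|apply: related_A_mx];
  by move=> l; apply: related_extend.
split.
  have h := conj_related B (rT E mixed (x + t) (x - t - cd_kap R r dg)).
  rewrite -gcd_eval in h; exact: (transfer_cvg_related N dW lamT_lt1 h).
have [kD [kD0 dD]] := D_diag.
have cQ u : (forall i, u i != 0) -> (forall l, wlam cd_wt u l != 1) ->
    continues (ph_letter R (pred0 : pred J)) (wlam cd_wt u)
      (fun X => ntrace (@cl_domain R r) (cd_D S) X u) 1.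
  move=> u0 u1; by apply: (ntrace_continues (kD := kD)) => // th0 _; apply: dD.
have tau''_neq0 i : tau'' i != 0 by rewrite tau''E invr_eq0.
have cT : continues (ph_letter R (in_labels flip)) lam1
    (fun X => trace (gcd_twist t * X)) (trace (gcd_twist t)).
  have <- : ph_weight lamT (in_labels flip) = lam1 by apply/funext.
  exact: (trace_continues dW lamT_lt1 lamT_neq0).
have rU : related_mx del (fun=> 0 : C^o) (block_mx 1%:M
    (\matrix_(i, c) sym_entry dg (ann_mult R dg) ext_del i (rev_ord c)) 0 1%:M) 1%:M.
  have -> : (1%:M : 'M[C^o]_(r + r)) = block_mx 1%:M 0 0 1%:M by rewrite -scalar_mx_block.
  apply: related_block; try exact: related_id; last first.
    by move=> i j; rewrite !mxE; apply: related0.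
  move=> i j; rewrite !mxE.
  have r0 : related del (fun=> 0 : C^o)
      (sym_entry dg (ann_mult R dg) ext_del i (rev_ord j))
      (sym_entry dg (ann_mult R dg) (fun=> 0 : C^o) i (rev_ord j)).
    apply: related_sym_entry => l; rewrite /ext_del; case: (insub l) => [l0|] /=.
      exact: (related_letter del (fun=> 0 : C^o)).
    exact: related0.
  by move: r0; rewrite [X in related _ _ _ X -> _]/sym_entry !scaler0 !if_same.
rewrite /transfer /gcd_Q /qop !cd_deg_lax_eval gcd_eval.
have fact := mixed_factorisation lam1_neq0 lam1_neq1 lam2_neq0 lam2_neq1
  (left_letter_ccr lam1 lam2) (right_letter_ccr lam1 lam2)
  (left_right_comm lam1 lam2) letters_hom1 letters_hom2 ced lam1_neq1
  (cQ _ tau'_neq0 lam1_neq1) (cQ _ tau''_neq0 lam2_neq1) cT N.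
exact: (fact _ _ _ _ _ _ _ _ _ _ _ cd_B_unit.1 B2_inv.1 cd_B_unit.1
  (rQ _ _ _) (rQ _ _ _) (rT _ _ _ _) rU (factor_identity t x)).
Qed.

End ClassicalFactorisation.

Section CastSquare.
Lemma castmx_mulsq (E : pzSemiRingType) m n (e : m = n) (A B : 'M[E]_m) :
  castmx (e, e) (A *m B) = castmx (e, e) A *m castmx (e, e) B.
Proof. by case: n / e; rewrite !castmx_id. Qed.

Lemma castmx_sqP (T : Type) m n (e : m = n) (A : 'M[T]_m) (B : 'M[T]_n) :
  (forall u v, A u v = B (cast_ord e u) (cast_ord e v)) -> castmx (e, e) A = B.
Proof.
by case: n / e B => B AB; apply/matrixP => u v; rewrite castmx_id AB !cast_ord_id.
Qed.
End CastSquare.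

Section Relabel.
Variables (R : realType) (E : algType R[i]) (n : nat) (f : 'I_n -> 'I_n).
Local Notation C := R[i].
Hypothesis f_inj : injective f.

Definition relabel_mx : 'M[C]_n := \sum_i delta_mx (f i) i.
Definition relabel_mxV : 'M[C]_n := \sum_i delta_mx i (f i).
Definition relabeled (M : 'M[E]_n) : 'M[E]_n := \matrix_(p, q) M (f p) (f q).

Lemma relabel_mxE i j : relabel_mx i j = (i == f j)%:R.
Proof.
rewrite /relabel_mx summxE (bigD1 j) //= mxE eqxx andbT big1 ?addr0 // => k kj.
by rewrite mxE [j == k]eq_sym (negPf kj) andbF.
Qed.

Lemma relabel_mxVE i j : relabel_mxV i j = (j == f i)%:R.
Proof.
rewrite /relabel_mxV summxE (bigD1 i) //= mxE eqxx big1 ?addr0 // => k ki.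
by rewrite mxE [i == k]eq_sym (negPf ki).
Qed.

Lemma relabel_mxK : relabel_mx *m relabel_mxV = 1%:M /\ relabel_mxV *m relabel_mx = 1%:M.
Proof.
have h : relabel_mxV *m relabel_mx = 1%:M.
  apply/matrixP => i j; rewrite !mxE (bigD1 (f i)) //= relabel_mxE relabel_mxVE eqxx.
  rewrite mul1r (inj_eq f_inj) big1 ?addr0 // => k ki.
  by rewrite relabel_mxVE (negPf ki) mul0r.
by split=> //; apply: mulmx1C.
Qed.

Lemma relabelE M :
  scal_mx E relabel_mxV *m M *m scal_mx E relabel_mx = relabeled M.
Proof.
have sE (A : 'M[C]_n) i j : scal_mx E A i j = (A i j)%:A by rewrite mxE.
apply/matrixP => p q; rewrite [LHS]mxE [RHS]mxE (bigD1 (f q)) //=.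
rewrite sE relabel_mxE eqxx scale1r mulr1 big1 ?addr0; last first.
  by move=> k kq; rewrite sE relabel_mxE (negPf kq) scale0r mulr0.
rewrite mxE (bigD1 (f p)) //= sE relabel_mxVE eqxx scale1r mul1r big1 ?addr0 //.
by move=> k kp; rewrite sE relabel_mxVE (negPf kp) scale0r mul0r.
Qed.

Lemma relabel_conj M : scal_mx E relabel_mx *m relabeled M *m scal_mx E relabel_mxV = M.
Proof.
have [h _] := relabel_mxK; have h' := congr1 (fun A : 'M_n => scal_mx E A) h.
rewrite scal_mxM scal_mx1 in h'.
by rewrite -relabelE !mulmxA h' mul1mx -mulmxA h' mulmx1.
Qed.

Lemma relabeledM M M' : relabeled (M *m M') = relabeled M *m relabeled M'.
Proof.
have [h _] := relabel_mxK; have h' := congr1 (fun A : 'M_n => scal_mx E A) h.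
rewrite scal_mxM scal_mx1 in h'.
by rewrite -!relabelE !mulmxA -(mulmxA _ (scal_mx E relabel_mx)) h' mulmx1.
Qed.

Lemma relabel_diag (S : pzRingType) (g : C -> S) (M : 'M[S]_n) i : g 0 = 0 -> g 1 = 1 ->
  (map_mx g relabel_mx *m M *m map_mx g relabel_mxV) (f i) (f i) = M i i.
Proof.
move=> g0 g1; have sE (A : 'M[C]_n) j k : map_mx g A j k = g (A j k) by rewrite mxE.
rewrite mxE (bigD1 i) //= sE relabel_mxVE eqxx g1 mulr1 big1 ?addr0; last first.
  by move=> k ki; rewrite sE relabel_mxVE (inj_eq f_inj) eq_sym (negPf ki) g0 mulr0.
rewrite mxE (bigD1 i) //= sE relabel_mxE eqxx g1 mul1r big1 ?addr0 // => k ki.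
by rewrite sE relabel_mxE (inj_eq f_inj) eq_sym (negPf ki) g0 mul0r.
Qed.

End Relabel.

Section DegenerateGL.
Variables (R : realType) (E : algType R[i]) (n : nat).
Local Notation C := R[i].
Implicit Types (ab an : 'I_n * 'I_n -> E) (I : {set 'I_n}).

Definition gl_up ab an (i j : 'I_n) : E := if (i < j)%N then ab (i, j) else an (i, j).
Definition gl_dn ab an (i j : 'I_n) : E := if (j < i)%N then ab (i, j) else - an (i, j).

Definition gl_deg1 ab an I : 'M[E]_n := \matrix_(i, j)
  ((i == j)%:R + if (i \in I) && (j \notin I) then gl_up ab an i j else 0).
Definition gl_deg2 x I : 'M[E]_n := \matrix_(i, j)
  ((if i \in I then x%:A else 1) *+ (i == j)).
Definition gl_deg3 ab an I : 'M[E]_n := \matrix_(i, j)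
  ((i == j)%:R + if (i \notin I) && (j \in I) then gl_dn ab an j i else 0).

Definition gl_deg ab an I x : 'M[E]_n :=
  gl_deg1 ab an I *m gl_deg2 x I *m gl_deg3 ab an I.

Lemma sum_delta_mx (A : pzRingType) (I K : {set 'I_n}) (f : 'I_n -> 'I_n -> A) p q :
  (\sum_(i in I) \sum_(j in K) f i j *: (delta_mx i j : 'M[A]_n)) p q
    = if (p \in I) && (q \in K) then f p q else 0.
Proof.
rewrite summxE; case: (boolP (p \in I)) => pI; last first.
  rewrite big1 // => i iI; rewrite summxE big1 // => j _; rewrite !mxE.
  by case: eqP => [pi|_]; rewrite ?mulr0 //; rewrite pi iI in pI.
rewrite (bigD1 p) //= [X in _ + X]big1 ?addr0; last first.
  move=> i /andP[_ ip]; rewrite summxE big1 // => j _; rewrite !mxE eq_sym (negPf ip).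
  by rewrite mulr0.
rewrite summxE; case: (boolP (q \in K)) => qK; last first.
  rewrite big1 // => j jK; rewrite !mxE.
  by case: eqP; case: eqP => [qj|_] _; rewrite ?mulr0 //; rewrite qj jK in qK.
rewrite (bigD1 q) //= !mxE !eqxx mulr1 big1 ?addr0 // => j /andP[_ jq].
by rewrite !mxE eq_sym eqxx eq_sym [q == j]eq_sym (negPf jq) mulr0.
Qed.

Lemma sum_delta_diag (A : pzRingType) (I : {set 'I_n}) p q :
  (\sum_(i in I) (delta_mx i i : 'M[A]_n)) p q = ((p \in I) && (p == q))%:R.
Proof.
rewrite summxE; case: (boolP (p \in I)) => pI /=; last first.
  rewrite big1 // => i iI; rewrite !mxE.
  by case: eqP => [pi|_] //; rewrite pi iI in pI.
rewrite (bigD1 p) //= mxE eqxx [q == p]eq_sym big1 ?addr0 // => i /andP[_ ip].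
by rewrite mxE eq_sym (negPf ip).
Qed.


Lemma gl_deg1_eval ab an I x :
  map_mx (evp x) (1%:M + \sum_(i in I) \sum_(j in ~: I)
     (if (i < j)%N then (ab (i, j))%:P else (an (i, j))%:P) *: delta_mx i j)
  = gl_deg1 ab an I.
Proof.
apply/matrixP => p q; rewrite [LHS]mxE [RHS]mxE [X in evp x X]mxE.
rewrite (sum_delta_mx I (~: I) (fun i j => if (i < j)%N then (ab (i, j))%:P else (an (i, j))%:P)).
rewrite finset.inE raddfD /= mxE raddfMn /= rmorph1; congr (_ + _).
by rewrite /gl_up; case: ifP => _; [case: ifP => _; apply: evpC|apply: raddf0].
Qed.

Lemma gl_deg2_eval I x :
  map_mx (evp x) ('X *: (\sum_(i in I) delta_mx i i) + \sum_(j in ~: I) delta_mx j j)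
  = gl_deg2 x I.
Proof.
apply/matrixP => p q; rewrite [LHS]mxE [RHS]mxE [X in evp x X]mxE.
rewrite [X in evp x (X + _)]mxE !sum_delta_diag finset.inE raddfD /= rmorphM /= evpX.
rewrite !raddfMn /= rmorph1.
by case: (p \in I); case: (p == q); rewrite /= ?mulr1 ?mulr0 ?addr0 ?add0r.
Qed.

Lemma gl_deg3_eval ab an I x :
  map_mx (evp x) (1%:M + \sum_(i in I) \sum_(j in ~: I)
     (if (j < i)%N then (ab (i, j))%:P else - (an (i, j))%:P) *: delta_mx j i)
  = gl_deg3 ab an I.
Proof.
apply/matrixP => p q; rewrite [LHS]mxE [RHS]mxE [X in evp x X]mxE exchange_big /=.
rewrite (sum_delta_mx (~: I) I (fun j i => if (j < i)%N then (ab (i, j))%:P else - (an (i, j))%:P)).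
rewrite finset.inE raddfD /= mxE raddfMn /= rmorph1; congr (_ + _).
rewrite /gl_dn; case: ifP => _; last exact: raddf0.
by case: ifP => _; rewrite ?raddfN; [|apply: congr1]; apply: evpC.
Qed.

End DegenerateGL.

Section DegenerateEval.
Variables (R : realType) (n : nat) (I : {set 'I_n}).
Local Notation C := R[i].
Let S := gl_deg_labels I.

Lemma gl_deg_lax_eval x : eval_lax (gl_deg_lax R I) x
  = gl_deg (osc_bar R S) (osc_ann R S) I x.
Proof.
have mxM (E : algType C) (A B D : 'M[{poly E}]_n) :
    map_mx (evp x) (A *m B *m D) = map_mx (evp x) A *m map_mx (evp x) B *m map_mx (evp x) D.
  by rewrite !map_mxM.
rewrite eval_laxE /gl_deg_lax mxM /gl_deg.
apply: congr2; last exact: gl_deg3_eval.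
by apply: congr2; [exact: gl_deg1_eval|exact: gl_deg2_eval].
Qed.

End DegenerateEval.

Section Sigma.
Variables (n : nat) (a : 'I_n) (I : {set 'I_n}).
Hypothesis cardI : #|I| = a.
Local Notation sigma := (gl_sigma I).

Definition gl_dim : (a + (n - a))%N = n := subnKC (ltnW (ltn_ord a)).
Definition gl_fst (i : 'I_a) : 'I_n := cast_ord gl_dim (lshift (n - a) i).
Definition gl_snd (j : 'I_(n - a)) : 'I_n := cast_ord gl_dim (rshift a j).

Let size_enum : size (enum I) = a. Proof. by rewrite -cardE. Qed.

Let sizeE : size (enum I ++ enum (~: I)) = n.
Proof. by rewrite size_cat -!cardE cardsC card_ord. Qed.

Lemma gl_sigma_inj : injective sigma.
Proof.
move=> c d; rewrite /gl_sigma => h; apply/val_inj/eqP => /=.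
rewrite -(@nth_uniq _ c (enum I ++ enum (~: I))) ?sizeE //.
  by rewrite h (set_nth_default c) // sizeE.
rewrite cat_uniq !enum_uniq /= andbT; apply/hasPn => x.
by rewrite !mem_enum finset.inE.
Qed.

Lemma gl_sigma_in c : (sigma c \in I) = (c < a)%N.
Proof.
rewrite /gl_sigma nth_cat size_enum; case: ltnP => ca.
  by rewrite -mem_enum mem_nth ?size_enum.
apply/negbTE; rewrite -finset.in_setC -mem_enum mem_nth //.
by rewrite -(ltn_add2l a) subnKC // -{1}size_enum -size_cat sizeE.
Qed.

Lemma gl_sigma_fst i : sigma (gl_fst i) \in I.
Proof. by rewrite gl_sigma_in /=. Qed.

Lemma gl_sigma_snd j : (sigma (gl_snd j) \in I) = false.
Proof. by rewrite gl_sigma_in /= ltnNge leq_addr. Qed.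

Lemma gl_fst_snd u : (exists i, u = gl_fst i) \/ (exists j, u = gl_snd j).
Proof.
rewrite -(cast_ordKV gl_dim u); case: (split_ordP (cast_ord (esym gl_dim) u)) => v ->.
  by left; exists v.
by right; exists v.
Qed.

Lemma gl_label_mem i j : (gl_fst i, gl_snd j) \in gl_labels a.
Proof. by rewrite inE /= ltn_ord leq_addr. Qed.

End Sigma.

Section DegenerateBlocks.
Variables (R : realType) (E : algType R[i]) (n : nat) (a : 'I_n) (I : {set 'I_n}).
Hypothesis cardI : #|I| = a.
Local Notation C := R[i].
Local Notation sigma := (gl_sigma I).
Implicit Types (ab an : 'I_n * 'I_n -> E).

Let castP (M : 'M[E]_n) (A11 : 'M[E]_a) (A12 : 'M[E]_(a, n - a))
    (A21 : 'M[E]_(n - a, a)) (A22 : 'M[E]_(n - a)) :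
  (forall i k, M (gl_fst i) (gl_fst k) = A11 i k) ->
  (forall i j, M (gl_fst i) (gl_snd j) = A12 i j) ->
  (forall j i, M (gl_snd j) (gl_fst i) = A21 j i) ->
  (forall j l, M (gl_snd j) (gl_snd l) = A22 j l) ->
  M = castmx (gl_dim a, gl_dim a) (block_mx A11 A12 A21 A22).
Proof.
move=> h11 h12 h21 h22; symmetry; apply: castmx_sqP => u v.
case: (split_ordP u) => {}u ->; case: (split_ordP v) => {}v ->.
- by rewrite block_mxEul h11.
- by rewrite block_mxEur h12.
- by rewrite block_mxEdl h21.
- by rewrite block_mxEdr h22.
Qed.

Let fst_inj (i k : 'I_a) : (sigma (gl_fst i) == sigma (gl_fst k)) = (i == k).
Proof. by rewrite (inj_eq (@gl_sigma_inj n I)). Qed.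
Let snd_inj (i k : 'I_(n - a)) : (sigma (gl_snd i) == sigma (gl_snd k)) = (i == k).
Proof.
by rewrite (inj_eq (@gl_sigma_inj n I)) /gl_snd (inj_eq (@cast_ord_inj _ _ _)) eq_shift.
Qed.
Let fst_snd (i : 'I_a) (j : 'I_(n - a)) : (sigma (gl_fst i) == sigma (gl_snd j)) = false.
Proof. by rewrite (inj_eq (@gl_sigma_inj n I)) /gl_snd (inj_eq (@cast_ord_inj _ _ _)) eq_shift. Qed.
Let snd_fst (i : 'I_a) (j : 'I_(n - a)) : (sigma (gl_snd j) == sigma (gl_fst i)) = false.
Proof. by rewrite eq_sym fst_snd. Qed.

Let inI := (gl_sigma_fst cardI, gl_sigma_snd cardI, fst_inj, snd_inj, fst_snd, snd_fst, addr0, add0r).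

Lemma gl_deg_relabeled ab an x : relabeled sigma (gl_deg ab an I x)
  = castmx (gl_dim a, gl_dim a) (block_deg x
      (\matrix_(i, j) gl_up ab an (sigma (gl_fst i)) (sigma (gl_snd j)))
      (\matrix_(j, i) - gl_dn ab an (sigma (gl_fst i)) (sigma (gl_snd j)))).
Proof.
set b := \matrix_(i, j) _; set c := \matrix_(j, i) _.
rewrite /gl_deg !(relabeledM (@gl_sigma_inj n I)).
rewrite (castP (M := relabeled _ (gl_deg1 _ _ _)) (A11 := 1%:M) (A12 := b) (A21 := 0)
  (A22 := 1%:M)); try by move=> ? ?; rewrite ![LHS]mxE ![RHS]mxE !inI.
rewrite (castP (M := relabeled _ (gl_deg2 _ _ _)) (A11 := cmx E a x) (A12 := 0) (A21 := 0)
  (A22 := 1%:M)); try by move=> ? ?; rewrite ![LHS]mxE ![RHS]mxE !inI.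
rewrite (castP (M := relabeled _ (gl_deg3 _ _ _)) (A11 := 1%:M) (A12 := 0) (A21 := - c)
  (A22 := 1%:M)); try by move=> ? ?; rewrite ![LHS]mxE ![RHS]mxE !inI ?[c _ _]mxE ?opprK.
rewrite -!castmx_mulsq !mulmx_block /block_deg; congr castmx; congr block_mx;
  by rewrite ?(mul1mx, mulmx1, mul0mx, mulmx0, addr0, add0r, mulmxN).
Qed.

Lemma gl_deg_compl_relabeled ab an x : relabeled sigma (gl_deg ab an (~: I) x)
  = castmx (gl_dim a, gl_dim a) (let y := 
      \matrix_(j, i) gl_up ab an (sigma (gl_snd j)) (sigma (gl_fst i)) in
      let z := \matrix_(i, j) gl_dn ab an (sigma (gl_snd j)) (sigma (gl_fst i)) in
    block_mx 1%:M z y (cmx E (n - a) x + y *m z)).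
Proof.
set b := \matrix_(i, j) _; set c := \matrix_(j, i) _.
rewrite /gl_deg !(relabeledM (@gl_sigma_inj n I)).
rewrite (castP (M := relabeled _ (gl_deg1 _ _ _)) (A11 := 1%:M) (A12 := 0) (A21 := b)
  (A22 := 1%:M)); try by move=> ? ?; rewrite ![LHS]mxE ![RHS]mxE !finset.inE !inI.
rewrite (castP (M := relabeled _ (gl_deg2 _ _ _)) (A11 := 1%:M) (A12 := 0) (A21 := 0)
  (A22 := cmx E (n - a) x)); try by move=> ? ?; rewrite ![LHS]mxE ![RHS]mxE !finset.inE !inI.
rewrite (castP (M := relabeled _ (gl_deg3 _ _ _)) (A11 := 1%:M) (A12 := c) (A21 := 0)
  (A22 := 1%:M)); try by move=> ? ?; rewrite ![LHS]mxE ![RHS]mxE !finset.inE !inI.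
rewrite -!castmx_mulsq !mulmx_block /=; congr castmx; congr block_mx;
  rewrite ?(mul1mx, mulmx1, mul0mx, mulmx0, addr0, add0r) //.
exact: addrC.
Qed.

End DegenerateBlocks.

Section DegenerateTwist.
Variables (R : realType) (n : nat) (I : {set 'I_n}).
Local Notation C := R[i].
Let S := gl_deg_labels I.
Let J : finType := {l : 'I_n * 'I_n | l \in S}.
Implicit Types (u th : 'I_n -> C) (l : J).

Definition gl_wt l (i : 'I_n) : int :=
  let: (v, w) := val l in
  if (v < w)%N then (i == w)%:R - (i == v)%:R else (i == v)%:R - (i == w)%:R.

Lemma prod_pick u (v w : 'I_n) : (forall i, u i != 0) ->
  \prod_i u i ^ ((i == v)%:R - (i == w)%:R) = u v / u w.
Proof.
move=> u0; have pick z : \prod_i u i ^ ((i == z)%:R : int) = u z.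
  rewrite (bigD1 z) //= eqxx expr1z big1 ?mulr1 // => i /negPf->.
  by rewrite expr0z.
rewrite -(pick v) -(pick w) -prodf_div; apply: eq_bigr => i _.
by rewrite expfzDr // -invr_expz.
Qed.

Lemma gl_wlam u l : (forall i, u i != 0) -> wlam gl_wt u l =
  if ((val l).1 < (val l).2)%N then u (val l).2 / u (val l).1
  else u (val l).1 / u (val l).2.
Proof.
move=> u0; rewrite /wlam /gl_wt; case: (val l) => v w /=.
by case: ifP => _; apply: prod_pick.
Qed.

Lemma gl_deg_label_neq l : ((val l).1 != (val l).2).
Proof.
have := valP l; rewrite inE finset.inE => /andP[l1 l2].
by apply: contraNneq l2 => <-.
Qed.

Lemma gl_wlam_lt1 th l : gl_domain th -> `|wlam gl_wt (tau_of th) l| < 1.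
Proof.
move=> dom; rewrite gl_wlam; last by move=> i; apply: expC_neq0.
have nz i : 0 < `|tau_of th i| by rewrite normr_gt0 expC_neq0.
have := gl_deg_label_neq l; rewrite -val_eqE neq_ltn.
case: ltnP => [h _|_ /= h]; rewrite normrM normfV ltr_pdivrMr // mul1r;
  exact: dom.
Qed.

Lemma prod_pick_pair (U : {set 'I_n}) (Q : rel 'I_n) (F : 'I_n -> 'I_n -> C) v w :
  v \in I -> w \in U ->
  \prod_(i in I) \prod_(j in U | Q i j) F i j ^ (((i, j) == (v, w))%:R : int)
    = if Q v w then F v w else 1.
Proof.
move=> vI wU; rewrite (bigD1 v) //= [X in _ * X]big1 ?mulr1; last first.
  move=> i /andP[_ /negPf iv]; rewrite big1 // => j _.
  by rewrite xpair_eqE iv expr0z.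
case: ifP => Qvw.
  rewrite (bigD1 w) ?wU //= eqxx expr1z big1 ?mulr1 // => j /andP[_ /negPf jw].
  by rewrite xpair_eqE jw andbF expr0z.
rewrite big1 // => j /andP[_ Qvj]; rewrite xpair_eqE eqxx /=.
by case: eqP => [jw|_]; rewrite ?expr0z //; rewrite jw Qvw in Qvj.
Qed.

Lemma gl_D_diag : exists kD : ('I_n -> C) -> C, (forall u, kD u != 0) /\
  forall u, diag_op (gl_D I u) (kD u) (wlam gl_wt (tau_of u)).
Proof.
have num := @affine_osc_number R _ S finset.set0.
have con := @affine_osc_conumber R _ S finset.set0.
have [c hc] := boolp.choice num; have [d hd] := boolp.choice con.
exists (fun u => (\prod_(i in I) \prod_(j in ~: I | (i < j)%N) expC ((u j - u i) * c (i, j)))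
  * (\prod_(i in I) \prod_(j in ~: I | (j < i)%N) expC ((u i - u j) * d (i, j)))); split=> u.
  by rewrite mulf_neq0 //; apply/prodf_neq0 => i _; apply/prodf_neq0 => j _; apply: expC_neq0.
have -> : wlam gl_wt (tau_of u) = fun l =>
    (\prod_(i in I) \prod_(j in ~: I | (i < j)%N)
       expC (u j - u i) ^ (osc_sign finset.set0 (i, j) * ((i, j) == val l)%:R))
  * (\prod_(i in I) \prod_(j in ~: I | (j < i)%N)
       expC (u i - u j) ^ (osc_sign finset.set0 (i, j) * ((i, j) == val l)%:R)).
  apply/funext => l; rewrite gl_wlam; last by move=> i; apply: expC_neq0.
  have sg ij : osc_sign finset.set0 (ij : 'I_n * 'I_n) = 1 by rewrite /osc_sign inE.
  have := gl_deg_label_neq l; have := valP l; rewrite inE; case: (val l) => v w /=.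
  rewrite -val_eqE => /andP[vI wI] vw.
  transitivity ((if (v < w)%N then expC (u w - u v) else 1) *
                (if (w < v)%N then expC (u v - u w) else 1)).
    rewrite /tau_of !expCD !expCN; case: (ltngtP v w) vw => //= _ _;
    by rewrite ?mulr1 ?mul1r.
  rewrite -(prod_pick_pair (fun i j : 'I_n => (i < j)%N) (fun i j => expC (u j - u i)) vI wI).
  rewrite -(prod_pick_pair (fun i j : 'I_n => (j < i)%N) (fun i j => expC (u i - u j)) vI wI).
  by congr (_ * _); apply: eq_bigr => i _; apply: eq_bigr => j _; rewrite sg mul1r.
apply: diagonalM; apply: diagonal_prod => i _; apply: diagonal_prod => j _;
  apply: diagonal_opexp.
  have [e1 e2] := osc0 R S (i, j); rewrite e1 e2; exact: hc.
have [e1 e2] := osc0 R S (i, j); rewrite e1 e2; exact: hd.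
Qed.

Lemma gl_ntrace_continues th : gl_domain th ->
  continues (ph_letter R (pred0 : pred J)) (wlam gl_wt (tau_of th))
    (fun X => ntrace (@gl_domain R n) (gl_D I) X (tau_of th)) 1.
Proof.
move=> dom; have [kD [kD0 dD]] := gl_D_diag.
apply: (ntrace_continues (kD := kD)) => //.
- by move=> u [].
- by move=> u _; apply: dD.
- by move=> u du l; apply: gl_wlam_lt1.
- by move=> i; apply: expC_neq0.
move=> l; apply: contraTneq (gl_wlam_lt1 l dom) => ->.
by rewrite normr1 ltxx.
Qed.

End DegenerateTwist.

Section FlipLetter.
Variables (C : fieldType) (E : algType C) (J JT : finType).
Variables (ell : bool * J -> E) (P : pred J) (s : C) (f : JT -> J).
Hypotheses (s2 : s * s = 1) (f_inj : injective f).

Definition flip_letter (l : bool * JT) : E := let j := f l.2 in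
  if P j then (if l.1 then s else - s) *: ell (~~ l.1, j) else s *: ell (l.1, j).

Lemma flip_letter_ccr : ccr ell -> ccr flip_letter.
Proof.
move=> /ccrP h; apply/ccrP => -[b i] [b' j]; rewrite /flip_letter /=.
have [ij|ij] := eqVneq i j; last first.
  have fij : (f i == f j) = false by rewrite (inj_eq f_inj) (negPf ij).
  case: (P (f i)); case: (P (f j)); rewrite !bracketE !h /ccr_coef /= fij (negPf ij);
  by rewrite !mul0r !scale0r !scaler0.
rewrite -ij; case: (P (f i)); rewrite !bracketE !h !scalerA; congr (_ *: _);
  rewrite /ccr_coef /= !eqxx; case: b; case: b' => /=;
  rewrite ?mulrN ?mulNr ?s2; ring.
Qed.

Lemma flip_letter_comm X l : (forall l', GRing.comm X (ell l')) -> GRing.comm X (flip_letter l).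
Proof.
move=> h; have hZ k Y : GRing.comm X Y -> GRing.comm X (k *: Y).
  by rewrite /GRing.comm -scalerAl -scalerAr => ->.
by rewrite /flip_letter; case: ifP => _; apply: hZ.
Qed.

End FlipLetter.

Section FlipWeight.
Variables (R : realType) (J0 J JT : finType) (lam0 : J0 -> R[i]) (lam : J -> R[i]).
Local Notation C := R[i].
Variables (ell : bool * J -> fock_end R (J0 + J0)%type) (P : pred J) (s : C) (f : JT -> J).
Hypothesis ell_hom : forall l, homogeneous lam0 (weight lam l) (ell l).

Lemma flip_letter_homogeneous (z : JT -> C) :
  (forall j, z j = if P (f j) then (lam (f j))^-1 else lam (f j)) ->
  forall l, homogeneous lam0 (weight z l) (flip_letter ell P s f l).
Proof.
move=> zE [b j]; rewrite /flip_letter /weight /= zE.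
have := ell_hom (b, f j); have := ell_hom (~~ b, f j); rewrite /weight /=.
case: (P (f j)) => h1 h2; apply: homogeneousZ => //.
by move: h1; case: b {h2} => //=; rewrite invrK.
Qed.

End FlipWeight.

Section GLFactorisation.
Variables (R : realType) (n : nat) (a : 'I_n) (I : {set 'I_n}) (th : 'I_n -> R[i]).
Local Notation C := R[i].
Hypotheses (cardI : #|I| = a) (dom : gl_domain th).
Local Notation sigma := (gl_sigma I).
Let S1 := gl_deg_labels I.
Let S2 := gl_deg_labels (~: I).
Let ST := gl_labels a.
Let J1 : finType := {l : 'I_n * 'I_n | l \in S1}.
Let J2 : finType := {l : 'I_n * 'I_n | l \in S2}.
Let JT : finType := {l : 'I_n * 'I_n | l \in ST}.
Let tau := tau_of th.
Let flip := gl_flip a I.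

Let tau_neq0 i : tau i != 0. Proof. exact: expC_neq0. Qed.

Let label1 (l : JT) : (sigma (val l).1, sigma (val l).2) \in S1.
Proof.
have := valP l; rewrite !inE /= => /andP[l1 l2].
by rewrite !(gl_sigma_in cardI) l1 -leqNgt l2.
Qed.

Let label2 (l : JT) : (sigma (val l).2, sigma (val l).1) \in S2.
Proof.
have := valP l; rewrite !inE /= => /andP[l1 l2].
by rewrite !(gl_sigma_in cardI) l1 -leqNgt l2.
Qed.

Let f1 (l : JT) : J1 := exist (fun s => s \in S1) _ (label1 l).
Let f2 (l : JT) : J2 := exist (fun s => s \in S2) _ (label2 l).

Let f1_inj : injective f1.
Proof.
move=> l l' /(congr1 val) /= [/gl_sigma_inj e1 /gl_sigma_inj e2]; apply: val_inj.
by rewrite [LHS]surjective_pairing [RHS]surjective_pairing e1 e2.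
Qed.

Let f2_inj : injective f2.
Proof.
move=> l l' /(congr1 val) /= [/gl_sigma_inj e1 /gl_sigma_inj e2]; apply: val_inj.
by rewrite [LHS]surjective_pairing [RHS]surjective_pairing e1 e2.
Qed.

Let lam1 := wlam (@gl_wt n I) tau.
Let lam2 := wlam (@gl_wt n (~: I)) tau.
Let lam (l : JT) : C := tau (sigma (val l).2) / tau (sigma (val l).1).

Let down (K : {set 'I_n}) (l : {l : 'I_n * 'I_n | l \in gl_deg_labels K}) :=
  ~~ ((val l).1 < (val l).2)%N.

Let lamE1 l : lam l = if down (f1 l) then (lam1 (f1 l))^-1 else lam1 (f1 l).
Proof.
rewrite /lam1 gl_wlam // /down /=; case: (ltnP (sigma _) (sigma _)) => _ //=.
by rewrite invf_div.
Qed.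

Let lamE2 l : (lam l)^-1 = if down (f2 l) then (lam2 (f2 l))^-1 else lam2 (f2 l).
Proof.
rewrite /lam2 gl_wlam // /down /=; case: (ltnP (sigma _) (sigma _)) => _ //=.
by rewrite invf_div.
Qed.

Let sigma_neq (l : JT) : sigma (val l).1 != sigma (val l).2.
Proof. exact: (gl_deg_label_neq (f1 l)). Qed.

Let lamT (l : JT) : C := if in_labels flip l then (lam l)^-1 else lam l.

Let in_flip (l : JT) : in_labels flip l = (sigma (val l).2 < sigma (val l).1)%N.
Proof. by rewrite /in_labels /flip inE (valP l). Qed.

Let lamT_lt1 l : `|lamT l| < 1.
Proof.
have nz i : 0 < `|tau i| by rewrite normr_gt0.
rewrite /lamT in_flip /lam; have := sigma_neq l; rewrite -val_eqE neq_ltn.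
case: (ltnP (sigma _)) => [h _|_ /orP[]// h].
  by rewrite invf_div normrM normfV ltr_pdivrMr // mul1r; apply: dom.
by rewrite normrM normfV ltr_pdivrMr // mul1r; apply: dom.
Qed.

Let lam_neq0 l : lam l != 0. Proof. by rewrite mulf_neq0 ?invr_eq0. Qed.
Let lamT_neq0 l : lamT l != 0.
Proof. by rewrite /lamT; case: ifP; rewrite ?invr_eq0. Qed.

Let ph_lamT l : ph_weight lamT (in_labels flip) l = lam l.
Proof. by rewrite /ph_weight /lamT; case: (in_labels flip l); rewrite ?invrK. Qed.

Let lam_neq1 l : lam l != 1.
Proof. by rewrite -ph_lamT; apply: ph_weight_neq1. Qed.

Let wlam_neq (K : {set 'I_n}) l : wlam (@gl_wt n K) tau l != 0 /\ wlam (@gl_wt n K) tau l != 1.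
Proof.
split; first by rewrite gl_wlam //; case: ifP => _; rewrite mulf_neq0 ?invr_eq0.
by apply: contraTneq (gl_wlam_lt1 l dom) => ->; rewrite normr1 ltxx.
Qed.

Let E := fock_end R ((J1 + J2) + (J1 + J2))%type.
Let ell1 : bool * J1 -> E := left_letter lam1 lam2.
Let ell2 : bool * J2 -> E := right_letter lam1 lam2.
Let p1 : bool * JT -> E := flip_letter ell1 (@down I) 1 f1.
Let p2 : bool * JT -> E := flip_letter ell2 (@down (~: I)) (-1) f2.
Let one := fun _ : JT => 1 : C.
Let mixed := mixed_letter p1 p2 one.
Let del := mixed_del p1 p2 one one.
Let ext_del (l : 'I_n * 'I_n) : E := oapp del 0 (insub l).

Let Lb (E0 : algType C) (f : 'I_n * 'I_n -> E0) : 'M[E0]_(a, n - a) :=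
  \matrix_(i, j) f (gl_fst i, gl_snd j).
Let La (E0 : algType C) (f : 'I_n * 'I_n -> E0) : 'M[E0]_(n - a, a) :=
  \matrix_(j, i) f (gl_fst i, gl_snd j).

Let lax_eval t (E0 : algType C) (ab an : 'I_n * 'I_n -> E0) x :
  eval_lax (gl_lax a t ab an) x = castmx (gl_dim a, gl_dim a)
    (block_lax (x + t) (x - (a : nat)%:R) (Lb ab) (La an)).
Proof.
have ec m (k : C) : map_mx (evp x) (sc E0 k)%:M = cmx E0 m k.
  by rewrite map_scalar_mx /= evp_sc.
have eX m : map_mx (evp x) ('X%:M : 'M_m) = cmx E0 m x.
  by rewrite map_scalar_mx /= evpX.
rewrite eval_laxE /gl_lax map_castmx; congr castmx; rewrite map_block_mx /block_lax.
set Ab := \matrix_(i < a, j < n - a) _; set A := \matrix_(j < n - a, i < a) _.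
have eb : map_mx (evp x) Ab = Lb ab.
  by apply/matrixP => i j; rewrite !mxE; apply: evpC.
have ea : map_mx (evp x) A = La an.
  by apply/matrixP => i j; rewrite !mxE; apply: evpC.
have -> : x + t - (x - (a : nat)%:R) = t + (a : nat)%:R by ring.
by rewrite !(map_mxN, map_mxD, map_mxM, map_mxB) eb ea !raddfB !raddfD /= !ec !eX !(cmxD, cmxN).
Qed.

Let ext_val (K : {set 'I_n}) (el : bool * {l : 'I_n * 'I_n | l \in gl_deg_labels K} -> E) b l :
  extend_letter el b ((val l).1, (val l).2) = el (b, l).
Proof. by rewrite -surjective_pairing /extend_letter valK. Qed.

Let upE (K : {set 'I_n}) (el : bool * {l : 'I_n * 'I_n | l \in gl_deg_labels K} -> E) l :
  gl_up (extend_letter el true) (extend_letter el false) (val l).1 (val l).2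
    = el (~~ down l, l).
Proof. by rewrite /gl_up /down negbK !ext_val; case: ifP. Qed.

Let dnE (K : {set 'I_n}) (el : bool * {l : 'I_n * 'I_n | l \in gl_deg_labels K} -> E) l :
  gl_dn (extend_letter el true) (extend_letter el false) (val l).1 (val l).2
    = if down l then el (true, l) else - el (false, l).
Proof.
rewrite /gl_dn /down !ext_val; have := gl_deg_label_neq l; rewrite -val_eqE.
by case: ltngtP.
Qed.

Let labelT (i : 'I_a) (j : 'I_(n - a)) : JT := exist (fun s => s \in ST) _ (gl_label_mem i j).

Let ext_T (el : bool * JT -> E) b (i : 'I_a) (j : 'I_(n - a)) :
  extend_letter el b (gl_fst i, gl_snd j) = el (b, labelT i j).
Proof. exact: extend_letterE. Qed.

Let deg1_blocks x :
  relabeled sigma (gl_deg (extend_letter ell1 true) (extend_letter ell1 false) I x)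
  = castmx (gl_dim a, gl_dim a) (block_deg x (Lb (extend_letter p1 true))
      (La (extend_letter p1 false))).
Proof.
rewrite (gl_deg_relabeled cardI); congr castmx; congr block_deg; apply/matrixP => i j;
  rewrite !mxE ext_T.
  rewrite (upE ell1 (f1 (labelT i j))) /p1 /flip_letter /=.
  by case: (down _); rewrite scale1r.
rewrite (dnE ell1 (f1 (labelT j i))) /p1 /flip_letter /=.
by case: (down _); rewrite ?opprK ?scaleN1r ?scale1r.
Qed.

Let deg2_blocks x (y := - La (extend_letter p2 true)) (z := Lb (extend_letter p2 false)) :
  relabeled sigma (gl_deg (extend_letter ell2 true) (extend_letter ell2 false) (~: I) x)
  = castmx (gl_dim a, gl_dim a) (block_mx 1%:M z y (cmx E (n - a) x + y *m z)).
Proof.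
rewrite (gl_deg_compl_relabeled cardI) /=.
set y' : 'M_(n - a, a) := \matrix_(_, _) _; set z' : 'M_(a, n - a) := \matrix_(_, _) _.
have -> : y' = y.
  apply/matrixP => j i; rewrite !mxE ext_T.
  rewrite (upE ell2 (f2 (labelT i j))) /p2 /flip_letter /=.
  by case: (down _); rewrite scaleN1r opprK.
have -> // : z' = z.
apply/matrixP => i j; rewrite !mxE ext_T.
rewrite (dnE ell2 (f2 (labelT i j))) /p2 /flip_letter /=.
by case: (down _); rewrite ?opprK ?scaleN1r ?scale1r.
Qed.

Let mixed_false (i : 'I_a) (j : 'I_(n - a)) : extend_letter mixed false (gl_fst i, gl_snd j)
  = extend_letter p1 false (gl_fst i, gl_snd j) + extend_letter p2 true (gl_fst i, gl_snd j).
Proof. by rewrite !ext_T /mixed /mixed_letter /= scale1r. Qed.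

Let del_E (i : 'I_a) (j : 'I_(n - a)) : ext_del (gl_fst i, gl_snd j)
  = extend_letter p1 true (gl_fst i, gl_snd j) + extend_letter p2 false (gl_fst i, gl_snd j).
Proof.
rewrite !ext_T /ext_del (_ : insub _ = Some (labelT i j)) /=; last exact: (valK (labelT i j)).
by rewrite /del /mixed_del !scale1r.
Qed.

Let factor_identity x y :
  gl_deg (extend_letter ell1 true) (extend_letter ell1 false) I x *m
  gl_deg (extend_letter ell2 true) (extend_letter ell2 false) (~: I) y
  = scal_mx E (gl_B R I) *m (castmx (gl_dim a, gl_dim a)
      (block_lax x y (Lb (extend_letter mixed true)) (La (extend_letter mixed false)))
    *m castmx (gl_dim a, gl_dim a) (block_mx 1%:M (Lb ext_del) 0 1%:M))
    *m scal_mx E (relabel_mxV R sigma).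
Proof.
rewrite -[LHS](relabel_conj (@gl_sigma_inj n I)) (relabeledM (@gl_sigma_inj n I)).
rewrite deg1_blocks deg2_blocks -!castmx_mulsq block_factor.
have -> : Lb (extend_letter mixed true) = Lb (extend_letter p1 true).
  by apply/matrixP => i j; rewrite !mxE !ext_T.
have -> : La (extend_letter mixed false)
    = La (extend_letter p1 false) - - La (extend_letter p2 true).
  by rewrite opprK; apply/matrixP => j i; rewrite !mxE mixed_false.
have -> // : Lb ext_del = Lb (extend_letter p1 true) + Lb (extend_letter p2 false).
by apply/matrixP => i j; rewrite !mxE del_E.
Qed.

Let slope (i : 'I_n) (l : JT) : int :=
  (sigma (val l).2 == i)%:R - (sigma (val l).1 == i)%:R.
Let sgn (l : JT) : int := osc_sign flip (val l).

Let slopeP (i : 'I_a) (j : 'I_(n - a)) (X : osc R ST) c :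
  affine X c (fun l => osc_sign flip (gl_fst i, gl_snd j) * ((gl_fst i, gl_snd j) == val l)%:R) ->
  affine X c (fun l => sgn l * ((gl_fst i, gl_snd j) == val l)%:R).
Proof.
by move=> h; apply: (affine_ext h) => l; rewrite /sgn; case: eqP => [->|]; rewrite ?mulr0.
Qed.

Let sum_fst (i : 'I_a) (l : JT) :
  \sum_(j < n - a) ((gl_fst i, gl_snd j) == val l)%:R = (sigma (val l).1 == sigma (gl_fst i))%:R :> int.
Proof.
rewrite (inj_eq (@gl_sigma_inj n I)).
have [[i' e1]|[j' e1]] := gl_fst_snd a (val l).1; last first.
  by have := valP l; rewrite inE e1 /= ltnNge leq_addr.
have [[i2 e2]|[j' e2]] := gl_fst_snd a (val l).2.
  by have := valP l; rewrite inE e2 /= andbC leqNgt ltn_ord.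
rewrite [val l]surjective_pairing e1 e2 /= eq_sym (bigD1 j') //= xpair_eqE eqxx andbT.
rewrite big1 ?addr0 ?[gl_fst i == _]eq_sym // => j jj; rewrite xpair_eqE andbC.
by rewrite (inj_eq (@cast_ord_inj _ _ _)) (inj_eq (@rshift_inj _ _)) (negPf jj).
Qed.

Let sum_snd (j : 'I_(n - a)) (l : JT) :
  \sum_(i < a) ((gl_fst i, gl_snd j) == val l)%:R = (sigma (val l).2 == sigma (gl_snd j))%:R :> int.
Proof.
rewrite (inj_eq (@gl_sigma_inj n I)).
have [[i' e1]|[j' e1]] := gl_fst_snd a (val l).1; last first.
  by have := valP l; rewrite inE e1 /= ltnNge leq_addr.
rewrite [val l]surjective_pairing e1 /= (bigD1 i') //= xpair_eqE eqxx /= eq_sym.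
rewrite big1 ?addr0 // => i ii; rewrite xpair_eqE.
by rewrite (inj_eq (@cast_ord_inj _ _ _)) (inj_eq (@lshift_inj _ _)) (negPf ii).
Qed.

Let gl_B_unit : gl_B R I \in unitmx /\ invmx (gl_B R I) = relabel_mxV R sigma.
Proof. exact: (right_inv_unit (relabel_mxK R (@gl_sigma_inj n I)).1). Qed.

Let laxI_eval t x : eval_lax (gl_laxI a I t) x =
  scal_mx _ (gl_B R I) *m
    castmx (gl_dim a, gl_dim a) (block_lax (x + t) (x - (a : nat)%:R) (Lb (ph_bar R ST flip))
      (La (ph_ann R ST flip))) *m scal_mx _ (invmx (gl_B R I)).
Proof. by rewrite /gl_laxI eval_conj_lax lax_eval. Qed.

Let cast_fst (A : 'M[osc R ST]_a) (B : 'M_(a, n - a)) (D : 'M_(n - a, a)) (F : 'M_(n - a)) (k : 'I_a) :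
  castmx (gl_dim a, gl_dim a) (block_mx A B D F) (gl_fst k) (gl_fst k) = A k k.
Proof. by rewrite castmxE !cast_ordK block_mxEul. Qed.

Let cast_snd (A : 'M[osc R ST]_a) (B : 'M_(a, n - a)) (D : 'M_(n - a, a)) (F : 'M_(n - a))
    (k : 'I_(n - a)) :
  castmx (gl_dim a, gl_dim a) (block_mx A B D F) (gl_snd k) (gl_snd k) = F k k.
Proof. by rewrite castmxE !cast_ordK block_mxEdr. Qed.

Let twist_affine t i : exists c : C, affine (gen_lax 0 (gl_laxI a I t) i i : fock_end R JT) c
  (fun l => sgn l * slope i l).
Proof.
rewrite /gen_lax coef0_eval laxI_eval gl_B_unit.2.
have [q <-] : exists q, sigma q = i.
  by have [g _ gK] := injF_bij (@gl_sigma_inj n I); exists (g i).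
have out (l : JT) : (sigma (val l).1 \in I) = true /\ (sigma (val l).2 \in I) = false.
  by have := valP l; rewrite inE !(gl_sigma_in cardI) => /andP[-> h]; rewrite ltnNge h.
rewrite (relabel_diag (@gl_sigma_inj n I)) ?scale0r ?scale1r //.
have [[k ->]|[k ->]] := gl_fst_snd a q.
- rewrite cast_fst.
  have hb := fun j : 'I_(n - a) => @affine_osc_number R _ ST flip (gl_fst k, gl_snd j).
  have [c hc] := boolp.choice hb.
  have hs := affine_sum (index_enum 'I_(n - a)) (P := xpredT) (fun j _ => slopeP (hc j)).
  have h0 := affineD (@affine_scalar R JT (0 + t)) (affineN hs).
  exists (0 + t - \sum_j c j); rewrite mxE [X in X + _]mxE eqxx mulr1n [X in _ + X]mxE [X in - X]mxE.
  have -> : \sum_j Lb (ph_bar R ST flip) k j * La (ph_ann R ST flip) j k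
      = \sum_(j < n - a) ph_bar R ST flip (gl_fst k, gl_snd j) * ph_ann R ST flip (gl_fst k, gl_snd j).
    by apply: eq_bigr => j _; rewrite !mxE.
  apply: (affine_ext h0) => l; rewrite -mulr_sumr sum_fst add0r /slope -mulrN; congr (_ * _).
  have -> : (sigma (val l).2 == sigma (gl_fst k)) = false.
    by apply/eqP => e; have [_] := out l; rewrite e (gl_sigma_fst cardI).
  by rewrite add0r.
rewrite cast_snd.
have hb := fun i : 'I_a => @affine_osc_conumber R _ ST flip (gl_fst i, gl_snd k).
have [c hc] := boolp.choice hb.
have hs := affine_sum (index_enum 'I_a) (P := xpredT) (fun i _ => slopeP (hc i)).
have h0 := affineD (@affine_scalar R JT (0 - (a : nat)%:R)) hs.
exists (0 - (a : nat)%:R + \sum_i c i); rewrite mxE [X in X + _]mxE eqxx mulr1n [X in _ + X]mxE.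
have -> : \sum_i La (ph_ann R ST flip) k i * Lb (ph_bar R ST flip) i k
    = \sum_(i < a) ph_ann R ST flip (gl_fst i, gl_snd k) * ph_bar R ST flip (gl_fst i, gl_snd k).
  by apply: eq_bigr => j _; rewrite !mxE.
apply: (affine_ext h0) => l; rewrite -mulr_sumr sum_snd add0r /slope; congr (_ * _).
have -> : (sigma (val l).1 == sigma (gl_snd k)) = false.
  by apply/eqP => e; have [] := out l; rewrite e (gl_sigma_snd cardI).
by rewrite subr0.
Qed.

Let twist_diag t : exists2 k : C, k != 0 & diag_op (gl_twist a I t th) k lamT.
Proof.
have [k k0 hk] := twist_diagonal th (twist_affine t); exists k => //.
suff <- : (fun l : JT => \prod_i expC (th i) ^ (sgn l * slope i l)) = lamT by [].
apply/funext => l.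
have h : \prod_i tau i ^ slope i l = lam l.
  rewrite /lam -(prod_pick _ _ tau_neq0); apply: eq_bigr => i _.
  by rewrite /slope eq_sym [sigma (val l).1 == _]eq_sym.
transitivity (\prod_i (tau i ^ slope i l) ^ sgn l).
  by apply: eq_bigr => i _; rewrite exprz_exp mulrC.
rewrite /lamT /sgn /osc_sign /in_labels; case: ifP => _.
  by rewrite -h -prodfV; apply: eq_bigr => i _; rewrite exprN1.
by rewrite -h; apply: eq_bigr => i _; rewrite expr1z.
Qed.

Let minus1_sq : (-1) * (-1) = 1 :> C. Proof. by rewrite mulrNN mulr1. Qed.

Let p12_comm l l' : GRing.comm (p1 l) (p2 l').
Proof.
apply: flip_letter_comm => l2; apply: commr_sym; apply: flip_letter_comm => l1.
exact/commr_sym/left_right_comm.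
Qed.

Let p1_hom l : homogeneous (lam12 lam1 lam2) (weight lam l) (p1 l).
Proof.
apply: flip_letter_homogeneous lamE1 l => l; apply: left_homogeneous => k.
  exact: (wlam_neq k).1.
exact: (wlam_neq k).2.
Qed.

Let p2_hom l : homogeneous (lam12 lam1 lam2) (weight (fun j => (lam j)^-1) l) (p2 l).
Proof.
apply: flip_letter_homogeneous lamE2 l => l; apply: right_homogeneous => k.
  exact: (wlam_neq k).1.
exact: (wlam_neq k).2.
Qed.

Lemma related_gl_deg (K : {set 'I_n}) (E0 E1 : algType C) (L : Type) (el0 : L -> E0)
    (el1 : L -> E1) ab0 an0 ab1 an1 x :
  (forall l, related el0 el1 (ab0 l) (ab1 l)) -> (forall l, related el0 el1 (an0 l) (an1 l)) ->
  related_mx el0 el1 (gl_deg ab0 an0 K x) (gl_deg ab1 an1 K x).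
Proof.
move=> hb ha; rewrite /gl_deg.
have r1 k : related el0 el1 (k%:R : E0) (k%:R : E1).
  by have := related_scalar el0 el1 (k%:R); rewrite !scaler_nat.
apply: related_mul; first apply: related_mul.
- move=> i j; rewrite !mxE; apply: relatedD => //; case: ifP => _; last exact: related0.
  by rewrite /gl_up; case: ifP.
- move=> i j; rewrite !mxE; apply: relatedMn; case: ifP => _; last exact: related1.
  exact: related_scalar.
move=> i j; rewrite !mxE; apply: relatedD => //; case: ifP => _; last exact: related0.
by rewrite /gl_dn; case: ifP => _ //; apply: relatedN.
Qed.

Theorem gl_factorisation N t x :
  gl_T_cvg N a I t x th /\
  gl_T N a I t x th = gl_ch a I t th *:
    (gl_Q N I (x + t) (tau_of th) *m gl_Q N (~: I) (x - (a : nat)%:R) (tau_of th)).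
Proof.
have [k k0 dW] := twist_diag t.
have rT (E' : algType C) (ell' : bool * JT -> E') y z :
  related_mx (ph_letter R (in_labels flip)) ell'
    (castmx (gl_dim a, gl_dim a) (block_lax y z (Lb (ph_bar R ST flip)) (La (ph_ann R ST flip))))
    (castmx (gl_dim a, gl_dim a) (block_lax y z (Lb (extend_letter ell' true))
      (La (extend_letter ell' false)))).
  apply: related_cast; apply: related_block_lax => i j; rewrite !mxE.
    by rewrite ph_barE; apply: related_extend.
  by rewrite ph_annE; apply: related_extend.
have rQ (K : {set 'I_n}) (E' : algType C)
    (ell' : bool * {l : 'I_n * 'I_n | l \in gl_deg_labels K} -> E') y :
  related_mx (ph_letter R pred0) ell'
    (gl_deg (osc_bar R (gl_deg_labels K)) (osc_ann R (gl_deg_labels K)) K y)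
    (gl_deg (extend_letter ell' true) (extend_letter ell' false) K y).
  apply: related_gl_deg => l; first by rewrite osc_barE; apply: related_extend.
  by rewrite osc_annE; apply: related_extend.
split.
  have h := conj_related (gl_B R I) (rT E mixed (x + t) (x - (a : nat)%:R)).
  rewrite -laxI_eval in h; exact: (transfer_cvg_related N dW lamT_lt1 h).
have cT : continues (ph_letter R (in_labels flip)) lam
    (fun X => trace (gl_twist a I t th * X)) (trace (gl_twist a I t th)).
  have <- : ph_weight lamT (in_labels flip) = lam by apply/funext.
  exact: (trace_continues dW lamT_lt1 lamT_neq0).
have rU : related_mx del (fun=> 0 : C^o)
    (castmx (gl_dim a, gl_dim a) (block_mx 1%:M (Lb ext_del) 0 1%:M)) 1%:M.
  have -> : (1%:M : 'M[C^o]_n) = castmx (gl_dim a, gl_dim a) (block_mx 1%:M 0 0 1%:M).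
    rewrite -scalar_mx_block; symmetry; apply: castmx_sqP => u v.
    by rewrite !mxE (inj_eq (@cast_ord_inj _ _ _)).
  apply: related_cast; apply: related_block; try exact: related_id; last first.
    by move=> i j; rewrite !mxE; apply: related0.
  move=> i j; rewrite !mxE /ext_del.
  rewrite (_ : insub _ = Some (labelT i j)); last exact: (valK (labelT i j)).
  exact: (related_letter del (fun=> 0 : C^o)).
have fact := mixed_factorisation (fun l => (wlam_neq (K := I) l).1)
  (fun l => (wlam_neq (K := I) l).2)
  (fun l => (wlam_neq (K := ~: I) l).1) (fun l => (wlam_neq (K := ~: I) l).2)
  (flip_letter_ccr (@down I) (mul1r 1) f1_inj (left_letter_ccr lam1 lam2))
  (flip_letter_ccr (@down (~: I)) minus1_sq f2_inj (right_letter_ccr lam1 lam2))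
  p12_comm p1_hom p2_hom (fun=> mul1r 1) lam_neq1
  (gl_ntrace_continues (I := I) dom) (gl_ntrace_continues (I := ~: I) dom) cT N.
rewrite /gl_T /gl_Q /transfer /qop !gl_deg_lax_eval laxI_eval.
have conj1 m (M : 'M[C]_#|{ffun 'I_N -> 'I_m}|) : conj_tens 1%:M M = M.
  by rewrite /conj_tens tens1 invmx1 mul1mx mulmx1.
rewrite -[X in _ *: (X *m _)]conj1 -[X in _ *: (_ *m X)]conj1.
have u1 : (1%:M : 'M[C]_n) \in unitmx by exact: unitmx1.
apply: (fact _ _ _ _ _ _ _ _ _ _ _ u1 u1 gl_B_unit.1
  (rQ I _ _ _) (rQ (~: I) _ _ _) (rT _ _ _ _) rU).
have id_conj (M1 M2 M : 'M[E]_n) : M1 *m M2 = M ->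
    (scal_mx E 1%:M *m M1 *m scal_mx E (invmx 1%:M)) *m
    (scal_mx E 1%:M *m M2 *m scal_mx E (invmx 1%:M)) = M.
  by rewrite invmx1 !scal_mx1 !mul1mx !mulmx1.
by apply: id_conj; rewrite gl_B_unit.2; exact: factor_identity.
Qed.

End GLFactorisation.

Section BDPermutation.
Variables (K : nat) (hK : (4 < K)%N).
Local Notation r := (K./2).
Implicit Types (k i : 'I_r) (p q : 'I_K) (b : bool).

(** The permutation of the K indices whose matrix is [bd_B b k]. *)
Definition bd_perm b k (p : 'I_K) : 'I_K :=
  let kk := bd_ix b k in let one := ord_first kk in
  if p == one then kk else if p == kk then one
  else if p == rev_ord one then rev_ord kk
  else if p == rev_ord kk then rev_ord one else if b then rev_ord p else p.

Lemma half_bound k : (k.*2.+2 <= K)%N.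
Proof. by have := ltn_ord k; have := odd_double_half K; rewrite -!muln2; case: (odd K); lia. Qed.

Lemma bd_permE b k p : let kk := (if b then K.-1 - k else k)%N in
  bd_perm b k p = (if p == 0 :> nat then kk else if p == kk :> nat then 0
    else if p == K.-1 :> nat then K.-1 - kk
    else if p == K.-1 - kk :> nat then K.-1 else if b then K.-1 - p else p)%N :> nat.
Proof.
rewrite /bd_perm /= -!val_eqE /= !subnS !subn0.
have e : bd_ix b k = (if b then K.-1 - k else k)%N :> nat.
  by rewrite /bd_ix; case: b => //=; rewrite subnS; lia.
rewrite !e.
have := half_bound k; have := ltn_ord p; have := ltn_ord k.
case: b {e} => /=; repeat (case: ifP => /=; try move=> /eqP); rewrite ?e /=; lia.
Qed.

Ltac perm_cases := repeat (case: ifP => /=; try move=> /eqP); lia.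

Lemma bd_permK b k : involutive (bd_perm b k).
Proof.
move=> p; apply: val_inj; rewrite /= !bd_permE /=.
have := half_bound k; have := ltn_ord p; have := ltn_ord k.
case: b => /=; perm_cases.
Qed.

Lemma bd_perm_rev b k p : bd_perm b k (rev_ord p) = rev_ord (bd_perm b k p).
Proof.
apply: val_inj; rewrite /= !bd_permE /=.
have := half_bound k; have := ltn_ord p; have := ltn_ord k.
case: b => /=; perm_cases.
Qed.

Lemma bd_perm_neg b k p : bd_perm (~~ b) k p = bd_perm b k (rev_ord p).
Proof.
apply: val_inj; rewrite /= !bd_permE /=.
have := half_bound k; have := ltn_ord p; have := ltn_ord k.
case: b => /=; perm_cases.
Qed.

Lemma bd_perm_ix k i : bd_perm false k (bd_ix false i) = bd_ix false (tperm (ord_first k) k i).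
Proof.
apply: val_inj; rewrite /= !bd_permE /=.
have := half_bound k; have := half_bound i; have := ltn_ord k; have := ltn_ord i.
case: tpermP => [->|->|/eqP + /eqP +]; rewrite -?val_eqE /=; perm_cases.
Qed.

(** The flipped labels are those that the permutation moves before the image of
    the first index. *)
Lemma bd_perm_flip b k p (one := ord_first p) : p \in bd_labels K ->
  (if p \in @bd_flip K b k then bd_perm b k p < bd_perm b k one
   else bd_perm b k one < bd_perm b k p)%N.
Proof.
move=> pS; rewrite inE pS /= !bd_permE /=.
move: pS; rewrite inE; have := half_bound k; have := ltn_ord p; have := ltn_ord k.
case: b => /=; perm_cases.
Qed.

Lemma bd_entry (l kk i j : nat) b : (0 < kk < l)%N -> kk != (l - kk)%N -> (i <= l)%N -> (j <= l)%N ->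
  (((i == 0) && (j == kk)) + ((i == kk) && (j == 0)) + ((i == l) && (j == l - kk))
    + ((i == l - kk) && (j == l)) +
    [&& 0 < i < l, i != kk, i != l - kk & j == (if b then l - i else i)]
  = (i == (if j == 0 then kk else if j == kk then 0
    else if j == l then l - kk
    else if j == l - kk then l else if b then l - j else j)))%N.
Proof.
move=> h1 h2 h3 h4; case: (j =P 0%N) => [->|j0]; first by case: b; lia.
case: (j =P kk) => [->|jk]; first by case: b; lia.
case: (j =P l) => [->|jl]; first by case: b; lia.
case: (j =P (l - kk)%N) => [->|jk']; first by case: b; lia.
case: b; lia.
Qed.

Lemma bd_BE (R : realType) b k : bd_B R b k = relabel_mx R (bd_perm b k).
Proof.
apply/matrixP => i j; rewrite relabel_mxE /bd_B.
have hk := half_bound k; have hi := ltn_ord i; have hj := ltn_ord j.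
case: ifP => [/eqP /= k0|/negbT /= k0].
  rewrite -val_eqE /= bd_permE /=; case: b.
    rewrite summxE (bigD1 i) //= mxE eqxx big1 ?addr0 => [|l li].
      congr (_ %:R); rewrite -val_eqE /=; congr nat_of_bool; apply/eqP/eqP; perm_cases.
    by rewrite mxE [i == l]eq_sym (negPf li).
  rewrite mxE; congr (_%:R); rewrite -val_eqE /=; congr nat_of_bool; apply/eqP/eqP; perm_cases.
rewrite ![in LHS]mxE summxE.
have -> : \sum_(l in bd_labels K | (l != bd_ix b k) && (l != rev_ord (bd_ix b k)))
     (delta_mx l (if b then rev_ord l else l) : 'M[R[i]]_K) i j
  = [&& i \in bd_labels K, i != bd_ix b k, i != rev_ord (bd_ix b k)
      & j == (if b then rev_ord i else i)]%:R.
  case: (boolP ((i \in bd_labels K) && ((i != bd_ix b k) && (i != rev_ord (bd_ix b k))))) => hP.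
    rewrite (bigD1 i) //= mxE eqxx big1 ?addr0 => [|l /andP[_ li]].
      by case/and3P: hP => -> -> ->.
    by rewrite mxE [i == l]eq_sym (negPf li).
  rewrite big1 => [|l lP]; last first.
    by rewrite mxE; case: eqP => // il; rewrite il lP in hP.
  by case: and4P => // -[h1 h2 h3 _]; rewrite h1 h2 h3 in hP.
rewrite -!natrD; congr (_%:R).
rewrite inE -!val_eqE /= bd_permE.
have eix : bd_ix b k = (if b then K.-1 - k else k)%N :> nat.
  by rewrite /bd_ix; case: b => //=; rewrite subnS; lia.
have [l lE] : exists l, l = K.-1 by exists K.-1.
have [kk kkE] : exists kk, kk = (bd_ix b k : nat) by exists (bd_ix b k : nat).
have er (z : nat) : (K - z.+1 = l - z)%N by rewrite lE subnS; lia.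
have -> : nat_of_ord (if b then rev_ord i else i) = (if b then l - i else i)%N.
  by case: b {eix kkE} => //=; rewrite er.
rewrite -eix -kkE !er subn0 -lE; apply: bd_entry; try lia; rewrite kkE eix.
  by case: b {eix kkE}; lia.
by case: b {eix kkE}; lia.
Qed.
End BDPermutation.

Section BDWeights.
Variables (R : realType) (K : nat) (hK : (4 < K)%N).
Local Notation C := R[i].
Local Notation r := (K./2).
Implicit Types (k i : 'I_r) (p q : 'I_K) (b : bool) (u th : 'I_r -> C).

Definition bd_first : 'I_K := Ordinal (ltn_trans (isT : (0 < 4)%N) hK).

(** The weights of the vector representation: e_i has weight tau_i, e_i' has
    weight tau_i^-1, and the middle vector in odd dimension has weight 1. *)
Definition vec_wt q i : int := (bd_ix false i == q)%:R - (bd_ix true i == q)%:R.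
Definition vec_val u q : C := \prod_i u i ^ vec_wt q i.

Lemma bd_ix_rev b i : rev_ord (bd_ix b i) = bd_ix (~~ b) i.
Proof. by case: b; rewrite /bd_ix /= ?rev_ordK. Qed.

Lemma bd_ix_eq i j : (bd_ix false i == bd_ix false j) = (i == j).
Proof. by []. Qed.

Lemma bd_ix_neq i j : (bd_ix true i == bd_ix false j) = false.
Proof.
apply/negP => /eqP /(congr1 val) /=.
have := half_bound hK i; have := half_bound hK j; lia.
Qed.

Lemma bd_ixP q : [\/ exists i, q = bd_ix false i, exists i, q = bd_ix true i
  | (q.*2.+1 = K)%N /\ forall b i, bd_ix b i != q].
Proof.
have rK : (r.*2 <= K)%N by have := odd_double_half K; lia.
case: (ltnP q r) => [qr|rq].
  by constructor 1; exists (Ordinal qr); apply: val_inj.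
case: (ltnP (rev_ord q) r) => [qr|qr].
  by constructor 2; exists (Ordinal qr); apply: val_inj => /=; have := ltn_ord q; lia.
constructor 3; split=> [|b i].
  by move: qr => /=; have := ltn_ord q; have := odd_double_half K; lia.
rewrite -val_eqE /=; have := ltn_ord i; move: rq qr => /=.
by case: b => /=; lia.
Qed.

Lemma vec_val_ix u i : vec_val u (bd_ix false i) = u i.
Proof.
rewrite /vec_val (bigD1 i) //= /vec_wt eqxx bd_ix_neq subr0 expr1z big1 ?mulr1 //.
by move=> j ji; rewrite bd_ix_eq bd_ix_neq (negPf ji) subr0 expr0z.
Qed.

Lemma vec_wt_rev q i : vec_wt (rev_ord q) i = - vec_wt q i.
Proof.
have e b : (bd_ix b i == rev_ord q) = (bd_ix (~~ b) i == q).
  by rewrite -bd_ix_rev (inv_eq (@rev_ordK _)).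
by rewrite /vec_wt !e opprB.
Qed.

Lemma vec_val_rev u q : vec_val u (rev_ord q) = (vec_val u q)^-1.
Proof.
rewrite /vec_val -prodfV; apply: eq_bigr => i _.
by rewrite vec_wt_rev invr_expz.
Qed.

Lemma vec_val_neq0 u q : (forall i, u i != 0) -> vec_val u q != 0.
Proof. by move=> u0; apply/prodf_neq0 => i _; apply: expfz_neq0. Qed.

Lemma vec_val_mid u q : (forall b i, bd_ix b i != q) -> vec_val u q = 1.
Proof.
move=> h; rewrite /vec_val big1 // => i _.
by rewrite /vec_wt !(negPf (h _ _)) subrr expr0z.
Qed.

Lemma vec_val_decreasing th p q : cl_domain th -> (p < q)%N ->
  `|vec_val (tau_of th) q| < `|vec_val (tau_of th) p|.
Proof.
move=> [dom1 dom2]; set tau := tau_of th.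
have inv1 i : `|(tau i)^-1| < 1.
  by rewrite normfV invf_lt1 ?dom2 // normr_gt0 expC_neq0.
have lo i : vec_val tau (bd_ix true i) = (tau i)^-1.
  by rewrite -[true]/(~~ false) -bd_ix_rev vec_val_rev vec_val_ix.
case: (bd_ixP p) => [[i ->]|[i ->]|[rp hp]]; case: (bd_ixP q) => [[j ->]|[j ->]|[rq hq]];
  rewrite ?vec_val_ix ?lo ?(vec_val_mid _ hp) ?(vec_val_mid _ hq) ?normr1 => pq.
- exact: dom1.
- exact: lt_trans (inv1 _) (dom2 _).
- exact: dom2.
- by move: pq => /=; have := half_bound hK i; have := half_bound hK j; lia.
- rewrite !normfV ltf_pV2 ?posrE ?normr_gt0 ?expC_neq0 //; apply: dom1.
  by move: pq => /=; have := ltn_ord i; have := ltn_ord j; lia.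
- by exfalso; move: pq => /=; have := half_bound hK i; lia.
- by exfalso; move: pq => /=; have := half_bound hK j; lia.
- exact: inv1.
- lia.
Qed.

Lemma bd_ix_inj b : injective (@bd_ix K b).
Proof.
by case: b => i j /(congr1 val) /= => [|e]; [have := half_bound hK i; have := half_bound hK j|];
  move=> *; apply: val_inj => /=; lia.
Qed.

(** The substitution of the twist parameters in the degenerate matrix permutes the
    weights in the same way as [bd_B b k] permutes the basis vectors. *)
Lemma vec_val_tau b k u q : vec_val (bd_tau b k u) q = vec_val u (bd_perm b k q).
Proof.
pose t : 'I_r -> 'I_r := tperm (ord_first k) k.
have tK : involutive t by apply: tpermK.
have wt0 i p : vec_wt (bd_perm false k p) i = vec_wt p (t i).
  have e b' : (bd_ix b' i == bd_perm false k p) = (bd_ix b' (t i) == p).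
    rewrite eq_sym (inv_eq (bd_permK hK false k)) eq_sym; congr (_ == _).
    case: b'; last exact: bd_perm_ix.
    by rewrite -[true]/(~~ false) -!bd_ix_rev (bd_perm_rev hK) (bd_perm_ix hK).
  by rewrite /vec_wt !e.
have wtb i : vec_wt (bd_perm b k q) (t i) = if b then - vec_wt q i else vec_wt q i.
  case: b => /=; last by rewrite wt0 tK.
  by rewrite -[true]/(~~ false) (bd_perm_neg hK) wt0 tK vec_wt_rev.
rewrite /vec_val [RHS](reindex_inj (inv_inj tK)) /=; apply: eq_bigr => i _.
by rewrite wtb /bd_tau -/(t i); case: (b) => //=; rewrite exprz_inv.
Qed.

Let S := bd_labels K.
Let J : finType := {l : 'I_K | l \in S}.

Definition bd_wt (l : J) i : int := vec_wt (val l) i - vec_wt bd_first i.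

Lemma bd_wlam u l : (forall i, u i != 0) ->
  wlam bd_wt u l = vec_val u (val l) / vec_val u bd_first.
Proof.
move=> u0; rewrite /wlam /vec_val -prodf_div; apply: eq_bigr => i _.
by rewrite /bd_wt expfzDr // -invr_expz.
Qed.

Lemma bd_wlam_lt1 th l : cl_domain th -> `|wlam bd_wt (tau_of th) l| < 1.
Proof.
move=> dom; have t0 i : tau_of th i != 0 by apply: expC_neq0.
rewrite bd_wlam // normrM normfV ltr_pdivrMr ?normr_gt0 ?vec_val_neq0 // mul1r.
by apply: vec_val_decreasing => //; have := valP l; rewrite inE => /andP[].
Qed.

Let half_gt0 : (0 < r)%N. Proof. by have := odd_double_half K; lia. Qed.

Lemma bd_first_wt i : vec_wt bd_first i = (val i == 0%N)%:R.
Proof.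
rewrite /vec_wt -!val_eqE /=; have := half_bound hK i => h.
by rewrite (_ : (K - i.+1 == 0)%N = false) ?subr0 //; apply/negbTE; lia.
Qed.

Lemma bd_D1_diag : exists kD : ('I_r -> C) -> C, (forall u, kD u != 0) /\
  forall u, diag_op (bd_D1 u : osc R S) (kD u) (wlam bd_wt (tau_of u)).
Proof.
have num := @affine_osc_number R _ S finset.set0.
have num0 l : exists c, affine (Defs.number R S l : fock_end R J) c (fun j => (l == val j)%:R).
  have [c hc] := num l; exists c; rewrite /Defs.number.
  have [-> ->] := osc0 R S l; apply: (affine_ext hc) => j.
  by rewrite /osc_sign inE mul1r.
have hF i : exists c, affine ((if val i == 0%N then - \sum_(l in S) Defs.number R S l
    else Defs.number R S (bd_ix false i) - Defs.number R S (bd_ix true i)) : fock_end R J) c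
    (fun j => bd_wt j i).
  have [i0|i0] := eqVneq (val i) 0%N.
    have [c hc] := boolp.choice num0.
    have hs := affineN (affine_sum (index_enum 'I_K) (P := mem S) (fun l _ => hc l)).
    exists (- \sum_(l in S) c l); apply: (affine_ext hs) => j.
    rewrite (bigD1 (val j)) ?(valP j) //=; last exact: (valP j).
    rewrite eqxx big1 ?addr0 => [|l /andP[_ /negPf->] //].
    rewrite /bd_wt bd_first_wt i0 /vec_wt -!val_eqE /= i0.
    have := valP j; rewrite inE /=; move: (sval j) => z /andP[z0 z1].
    have -> : (0 == z :> nat)%N = false.
      by rewrite eq_sym; apply/negbTE; rewrite -lt0n.
    have -> : (K - 1 == z :> nat)%N = false.
      by rewrite subn1 eq_sym; apply/negbTE; rewrite neq_ltn z1.
    by rewrite subrr sub0r.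
  have [c hc] := num0 (bd_ix false i); have [d hd] := num0 (bd_ix true i).
  exists (c - d); have h0 := affineD hc (affineN hd); apply: (affine_ext h0) => j.
  by rewrite /bd_wt bd_first_wt (negPf i0) subr0.
have tw u := twist_diagonal u hF.
have /boolp.choice[kD hkD] : forall u, exists k : C, k != 0 /\
    diag_op (bd_D1 u : osc R S) k (wlam bd_wt (tau_of u)).
  by move=> u; have [k k0 hk] := tw u; exists k; split.
by exists kD; split=> u; case: (hkD u).
Qed.

Lemma bd_ntrace_continues u : (forall i, u i != 0) -> (forall l, wlam bd_wt u l != 1) ->
  continues (ph_letter R (pred0 : pred J)) (wlam bd_wt u)
    (fun X => ntrace (@cl_domain R r) (@bd_D1 R K) X u) 1.
Proof.
move=> u0 u1; have [kD [kD0 dD]] := bd_D1_diag.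
apply: (ntrace_continues (kD := kD)) => //.
  by move=> th0 _; apply: dD.
by move=> th0 dth l; apply: bd_wlam_lt1.
Qed.

End BDWeights.

Section Block3.
Variables (S : pzRingType) (m : nat).

Definition blk3 (A11 : 'M[S]_(1, 1)) (A12 : 'M[S]_(1, m)) (A13 : 'M[S]_(1, 1))
    (A21 : 'M[S]_(m, 1)) (A22 : 'M[S]_(m, m)) (A23 : 'M[S]_(m, 1))
    (A31 : 'M[S]_(1, 1)) (A32 : 'M[S]_(1, m)) (A33 : 'M[S]_(1, 1)) : 'M[S]_(1 + (m + 1)) :=
  block_mx A11 (row_mx A12 A13) (col_mx A21 A31) (block_mx A22 A23 A32 A33).

Lemma blk3M A11 A12 A13 A21 A22 A23 A31 A32 A33 B11 B12 B13 B21 B22 B23 B31 B32 B33 :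
  blk3 A11 A12 A13 A21 A22 A23 A31 A32 A33 *m blk3 B11 B12 B13 B21 B22 B23 B31 B32 B33 =
  blk3 (A11 *m B11 + A12 *m B21 + A13 *m B31) (A11 *m B12 + A12 *m B22 + A13 *m B32)
       (A11 *m B13 + A12 *m B23 + A13 *m B33)
       (A21 *m B11 + A22 *m B21 + A23 *m B31) (A21 *m B12 + A22 *m B22 + A23 *m B32)
       (A21 *m B13 + A22 *m B23 + A23 *m B33)
       (A31 *m B11 + A32 *m B21 + A33 *m B31) (A31 *m B12 + A32 *m B22 + A33 *m B32)
       (A31 *m B13 + A32 *m B23 + A33 *m B33).
Proof.
rewrite /blk3 mulmx_block mul_row_col mul_mx_row mul_row_block add_row_mx.
rewrite mul_col_mx mul_block_col add_col_mx mul_col_row mulmx_block add_block_mx.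
by rewrite !addrA.
Qed.

Lemma blk3_id : blk3 1%:M 0 0 0 1%:M 0 0 0 1%:M = 1%:M.
Proof.
by rewrite /blk3 row_mx0 col_mx0 -!scalar_mx_block.
Qed.

Let simp := (mul1mx, mulmx1, mul0mx, mulmx0, addr0, add0r).

Lemma blk3_congr A11 A12 A13 A21 A22 A23 A31 A32 A33 B11 B12 B21 B22 :
  A11 = B11 -> A12 = B12 -> A21 = B21 -> A22 = B22 ->
  blk3 A11 A12 A13 A21 A22 A23 A31 A32 A33 = blk3 B11 B12 A13 B21 B22 A23 A31 A32 A33.
Proof. by move=> -> -> -> ->. Qed.

Lemma blk3_dld x y A21 A31 A32 v w :
  blk3 x 0 0 0 y 0 0 0 1%:M *m blk3 1%:M 0 0 A21 1%:M 0 A31 A32 1%:M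
    *m blk3 1%:M 0 0 0 v 0 0 0 w
  = blk3 x 0 0 (y *m A21) (y *m v) 0 A31 (A32 *m v) w.
Proof. by rewrite !blk3M !simp. Qed.

Lemma blk3_udl A12 A13 A23 x y B21 B31 B32 :
  blk3 1%:M A12 A13 0 1%:M A23 0 0 1%:M *m blk3 x 0 0 0 y 0 0 0 1%:M
    *m blk3 1%:M 0 0 B21 1%:M 0 B31 B32 1%:M
  = blk3 (x + A12 *m y *m B21 + A13 *m B31) (A12 *m y + A13 *m B32) A13
         (y *m B21 + A23 *m B31) (y + A23 *m B32) A23 B31 B32 1%:M.
Proof. by rewrite !blk3M !simp. Qed.

End Block3.

Section Unipotent3.
Variables (R : realType) (E : algType R[i]) (m : nat).
Local Notation C := R[i].
Implicit Types (b : 'rV[E]_m) (a : 'cV[E]_m).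

Definition rev3 : 'M[E]_m := \matrix_(c, d) (d == rev_ord c)%:R.
Definition half3 : E := (1 / 2%:R : C)%:A.

Lemma rev3_mulE n (M : 'M[E]_(m, n)) c j : (rev3 *m M) c j = M (rev_ord c) j.
Proof.
rewrite !mxE (bigD1 (rev_ord c)) //= mxE eqxx mul1r big1 ?addr0 // => l li.
by rewrite mxE (negPf li) mul0r.
Qed.

Lemma mul_rev3E n (M : 'M[E]_(n, m)) i c : (M *m rev3) i c = M i (rev_ord c).
Proof.
rewrite !mxE (bigD1 (rev_ord c)) //= mxE rev_ordK eqxx mulr1 big1 ?addr0 // => l li.
by rewrite mxE -[c]rev_ordK (inj_eq rev_ord_inj) eq_sym (negPf li) mulr0.
Qed.

Definition pair3 b b' : 'M[E]_1 := b *m rev3 *m b'^T.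

Lemma pair3C b b' : (forall i j, GRing.comm (b 0 i) (b' 0 j)) -> pair3 b b' = pair3 b' b.
Proof.
move=> h; apply/matrixP => i j; rewrite !ord1 mxE [RHS]mxE (reindex_inj rev_ord_inj).
by apply: eq_bigr => l _; rewrite !mul_rev3E !mxE rev_ordK; apply: h.
Qed.

Lemma half3_comm n p (M : 'M[E]_(n, p)) q (A : 'M[E]_(q, n)) :
  A *m (half3 *: M) = half3 *: (A *m M).
Proof.
apply/matrixP => i j; rewrite !mxE mulr_sumr; apply: eq_bigr => k _.
by rewrite !mxE /half3 !mulrA comm_scalar.
Qed.

(** The unipotent factors of the Lax matrix: exponentials of the two abelian
    nilradicals of the orthogonal algebra. *)
Definition up3 b : 'M[E]_(1 + (m + 1)) :=
  blk3 1%:M b (- (half3 *: (b *m rev3 *m b^T))) 0 1%:M (- (rev3 *m b^T)) 0 0 1%:M.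
Definition lo3 a : 'M[E]_(1 + (m + 1)) :=
  blk3 1%:M 0 0 (- a) 1%:M 0 (- (half3 *: (a^T *m rev3 *m a))) (a^T *m rev3) 1%:M.
Definition dg3 (x y z : C) : 'M[E]_(1 + (m + 1)) :=
  blk3 (cmx E 1 x) 0 0 0 (cmx E m y) 0 0 0 (cmx E 1 z).

Let simp := (mul1mx, mulmx1, mul0mx, mulmx0, addr0, add0r).

Let half_double (M : 'M[E]_1) : half3 *: M + half3 *: M = M.
Proof.
rewrite -scalerDl /half3 -scalerDl (_ : 1 / 2%:R + 1 / 2%:R = 1 :> C) ?scale1r //.
by field.
Qed.

Let half_pairD b b' : (forall i j, GRing.comm (b 0 i) (b' 0 j)) ->
  half3 *: pair3 (b + b') (b + b') = half3 *: pair3 b b + pair3 b b' + half3 *: pair3 b' b'.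
Proof.
move=> h; rewrite /pair3 linearD /= mulmxDr !mulmxDl -!/(pair3 _ _) -(pair3C h).
by rewrite !scalerDr addrA -{3}(half_double (pair3 b b')) !addrA.
Qed.

Lemma up3M b b' : (forall i j, GRing.comm (b 0 i) (b' 0 j)) ->
  up3 b *m up3 b' = up3 (b + b').
Proof.
move=> h; rewrite /up3 blk3M !simp; congr blk3.
- by rewrite addrC.
- rewrite -/(pair3 (b + b') (b + b')) half_pairD // !opprD mulmxN mulmxA.
  by rewrite addrC addrA addrAC.
- by rewrite linearD /= mulmxDr opprD addrC.
Qed.

Lemma up3N b : up3 (- b) = blk3 1%:M (- b) (- (half3 *: (b *m rev3 *m b^T))) 0 1%:M
  (rev3 *m b^T) 0 0 1%:M.
Proof. by rewrite /up3 linearN /= !mulmxN !mulNmx !opprK. Qed.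

Lemma up3K b : up3 (- b) *m up3 b = 1%:M.
Proof.
rewrite up3N /up3 blk3M !simp -blk3_id; congr blk3.
- by rewrite subrr.
- by rewrite mulmxN mulNmx opprK mulmxA addrAC -opprD half_double addNr.
- by rewrite addNr.
Qed.

Lemma lo3M a a' : (forall i j, GRing.comm (a i 0) (a' j 0)) ->
  lo3 a *m lo3 a' = lo3 (a + a').
Proof.
move=> h; have h' i j : GRing.comm (a^T 0 i) (a'^T 0 j) by rewrite !mxE.
have pT (c c' : 'cV[E]_m) : c^T *m rev3 *m c' = pair3 c^T c'^T by rewrite /pair3 trmxK.
rewrite /lo3 blk3M !simp; congr blk3.
- by rewrite opprD.
- rewrite mulmxN !pT linearD /= half_pairD // !opprD.
  by [].
- by rewrite linearD /= mulmxDl addrC.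
Qed.

(** The Lax matrix and the degenerate one in factorised form. *)
Definition quad_val (k x : C) : C := x * (x - k + 2%:R).

Definition lax3 k u v b a := up3 b *m (dg3 (quad_val k u) u 1 *m lo3 a *m
  dg3 1 v (quad_val k v)) *m up3 (- b).
Definition deg3 k x b a := up3 b *m dg3 (quad_val k x) x 1 *m lo3 a.

Let regroup n (U U' D L L' D' W : 'M[E]_n) : U' *m U = 1%:M ->
  U *m D *m L *m (L' *m D' *m W) = U *m (D *m (L *m L') *m D') *m U' *m (U *m W).
Proof. by move=> UK; rewrite -[in RHS]mulmxA (mulmxA U') UK mul1mx !mulmxA. Qed.

Lemma factor3 k u v b a b' a' :
  (forall i j, GRing.comm (a i 0) (b'^T j 0)) -> (forall i j, GRing.comm (b 0 i) (a'^T 0 j)) ->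
  deg3 k u b a *m (lo3 b'^T *m dg3 1 v (quad_val k v) *m up3 a'^T)
    = lax3 k u v b (a + b'^T) *m up3 (b + a'^T).
Proof.
move=> h1 h2; rewrite /deg3 /lax3 -lo3M // -up3M //; apply: regroup; exact: up3K.
Qed.

Let dg3_left x y : dg3 x y 1 = blk3 (cmx E 1 x) 0 0 0 (cmx E m y) 0 0 0 1%:M.
Proof. by rewrite /dg3 [cmx E 1 1](_ : _ = 1%:M) // /cmx scale1r. Qed.

Let dg3_right y z : dg3 1 y z = blk3 1%:M 0 0 0 (cmx E m y) 0 0 0 (cmx E 1 z).
Proof. by rewrite /dg3 [cmx E 1 1](_ : _ = 1%:M) // /cmx scale1r. Qed.

Lemma lax3_mid k u v a : dg3 (quad_val k u) u 1 *m lo3 a *m dg3 1 v (quad_val k v)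
  = blk3 (cmx E 1 (quad_val k u)) 0 0 (- (a *m cmx E 1 u)) (cmx E m (u * v)) 0
     (- (half3 *: (a^T *m rev3 *m a))) (a^T *m rev3 *m cmx E m v) (cmx E 1 (quad_val k v)).
Proof.
have cM n x y : cmx E n x *m cmx E n y = cmx E n (x * y).
  by rewrite /cmx -scalar_mxM -scalerAl mul1r scalerA.
rewrite dg3_left dg3_right /lo3 blk3_dld cM.
by rewrite (_ : cmx E m u *m - a = - (a *m cmx E 1 u)) // mulmxN cmx_comm.
Qed.

Definition quarter3 : E := (1 / 4%:R : C)%:A.

Lemma deg3E k x b a : deg3 k x b a =
  blk3 (cmx E 1 (quad_val k x) - x%:A *: (b *m a)
          + quarter3 *: (b *m rev3 *m b^T *m a^T *m rev3 *m a))
     (x%:A *: b - half3 *: (b *m rev3 *m b^T *m a^T *m rev3))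
     (- (half3 *: (b *m rev3 *m b^T)))
     (- (x%:A *: a) + half3 *: (rev3 *m b^T *m a^T *m rev3 *m a))
     (cmx E m x - rev3 *m b^T *m a^T *m rev3)
     (- (rev3 *m b^T))
     (- (half3 *: (a^T *m rev3 *m a)))
     (a^T *m rev3)
     1%:M.
Proof.
rewrite /deg3 dg3_left /up3 /lo3 blk3_udl.
have cz n p (M : 'M[E]_(n, p)) : cmx E n x *m M = x%:A *: M by exact: mul_scalar_mx.
have nn n p q (M : 'M[E]_(n, p)) (M' : 'M[E]_(p, q)) : - M *m - M' = M *m M'.
  by rewrite mulmxN mulNmx opprK.
apply: blk3_congr.
- rewrite -cmx_comm cz nn mulmxN; congr (_ - _ + _).
    by rewrite -scalemxAl.
  rewrite -scalemxAl half3_comm scalerA !mulmxA; congr (_ *: _).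
  by rewrite /half3 /quarter3 scal_alg scalerA; congr (_%:A); field.
- by rewrite -cmx_comm cz mulNmx -scalemxAl !mulmxA.
- by rewrite cz scalerN nn half3_comm !mulmxA.
- by rewrite mulNmx !mulmxA.
Qed.

End Unipotent3.

Section BDEvaluation.
Variables (R : realType) (K : nat) (hK : (4 < K)%N) (E : algType R[i]).
Local Notation C := R[i].
Implicit Types (ab an : 'I_K -> E).

Definition bd_row ab : 'rV[E]_(K - 2) := \row_c ab (bd_mid hK c).
Definition bd_col an : 'cV[E]_(K - 2) := \col_c an (bd_mid hK c).
Definition half_dim : C := K%:R / 2%:R.

Section At.
Variable x : C.
Local Notation ev := (map_mx (evp x)).

Let wbE ab : ev (bd_wb hK ab) = bd_row ab.
Proof. by apply/matrixP => i j; rewrite !mxE; apply: evpC. Qed.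
Let wE an : ev (bd_w hK an) = bd_col an.
Proof. by apply/matrixP => i j; rewrite !mxE; apply: evpC. Qed.
Let JE : ev (bd_J K E) = rev3 E (K - 2).
Proof. by apply/matrixP => i j; rewrite !mxE; rewrite raddfMn /= rmorph1. Qed.
Let halfE : evp x (sc E (1 / 2%:R)) = half3 E. Proof. exact: evp_sc. Qed.
Let quarterE : evp x (sc E (1 / 4%:R)) = quarter3 E. Proof. exact: evp_sc. Qed.

Lemma ev_block3 (m : nat) A11 A12 A13 A21 A22 A23 A31 A32 A33 :
  ev (block3 (E := E) (m := m) A11 A12 A13 A21 A22 A23 A31 A32 A33)
  = blk3 (ev A11) (ev A12) (ev A13) (ev A21) (ev A22) (ev A23) (ev A31) (ev A32) (ev A33).
Proof. by rewrite /block3 /blk3 map_block_mx map_row_mx map_col_mx map_block_mx. Qed.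

Let evD m n (A B : 'M[{poly E}]_(m, n)) : ev (A + B) = ev A + ev B.
Proof. exact: map_mxD. Qed.
Let evN m n (A : 'M[{poly E}]_(m, n)) : ev (- A) = - ev A.
Proof. exact: map_mxN. Qed.
Let evM m n p (A : 'M[{poly E}]_(m, n)) (B : 'M_(n, p)) : ev (A *m B) = ev A *m ev B.
Proof. exact: map_mxM. Qed.
Let evZ m n c (A : 'M[{poly E}]_(m, n)) : ev (c *: A) = evp x c *: ev A.
Proof. exact: map_mxZ. Qed.
Let ev0 m n : ev (0 : 'M[{poly E}]_(m, n)) = 0.
Proof. exact: map_mx0. Qed.
Let ev1 m : ev (1%:M : 'M[{poly E}]_m) = 1%:M.
Proof. exact: map_mx1. Qed.
Let evT m n (A : 'M[{poly E}]_(m, n)) : ev A^T = (ev A)^T.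
Proof. by rewrite map_trmx. Qed.
Let evS m c : ev (c%:M : 'M[{poly E}]_m) = (evp x c)%:M.
Proof. by rewrite map_scalar_mx. Qed.

Let evs := (evD, evN, evM, evZ, ev0, ev1, evT, evS, wbE, wE, JE, halfE, quarterE).

Lemma bd_deg_lax_eval ab an : eval_lax (bd_deg_lax hK ab an) x
  = castmx (bd_dim hK, bd_dim hK) (deg3 half_dim x (bd_row ab) (bd_col an)).
Proof.
rewrite eval_laxE /bd_deg_lax map_castmx ev_block3 deg3E !evs evpX; congr castmx.
apply: blk3_congr => //.
rewrite scalerBr addrA; congr (_ - _ + _).
rewrite scale_scalar_mx -raddfD rmorphXn /= evpX evp_sc expr2 !scal_alg -scalerDr -scalerDl.
by rewrite /cmx scalerA /quad_val /half_dim; congr ((_ *: _)%:M); ring.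
Qed.

Lemma bd_lax_eval t ab an : eval_lax (bd_lax hK t ab an) x
  = castmx (bd_dim hK, bd_dim hK)
      (lax3 half_dim (x - 1 + t / 2%:R + K%:R / 4%:R) (x - t / 2%:R - K%:R / 4%:R)
         (bd_row ab) (bd_col an)).
Proof.
rewrite eval_laxE /bd_lax map_castmx; congr castmx.
set u := x - 1 + _ + _; set v := x - _ - _.
have eu : evp x ('X + sc E (-1 + t / 2%:R + K%:R / 4%:R)) = u%:A.
  by rewrite raddfD /= evpX evp_sc -scalerDl /u !addrA.
have ew : evp x ('X - sc E (t / 2%:R + K%:R / 4%:R)) = v%:A.
  by rewrite raddfB /= evpX evp_sc -scalerBl /v opprD addrA.
have eK : evp x (sc E (K%:R / 2%:R)) = half_dim%:A by apply: evp_sc.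
have e2 : evp x (2%:R : {poly E}) = (2%:R : C)%:A.
  by rewrite raddfMn /= rmorph1 scaler_nat.
have eq (p : {poly E}) (y : C) : evp x p = y%:A ->
    evp x (p * (p - sc E (K%:R / 2%:R) + 2%:R)) = (quad_val half_dim y)%:A.
  move=> e; rewrite rmorphM /= raddfD /= raddfB /= e eK e2 -scalerBl -scalerDl.
  by rewrite scal_alg scalerA.
have euv : evp x (('X + sc E (-1 + t / 2%:R + K%:R / 4%:R))
     * ('X - sc E (t / 2%:R + K%:R / 4%:R))) = (u * v)%:A.
  by rewrite rmorphM /= eu ew scal_alg scalerA.
have triple (A B D : 'M[{poly E}]_(1 + (K - 2 + 1))) A' B' D' :
    ev A = A' -> ev B = B' -> ev D = D' -> ev (A *m B *m D) = A' *m B' *m D'.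
  by move=> <- <- <-; rewrite !map_mxM.
apply: triple.
- by rewrite ev_block3 !evs.
- by rewrite lax3_mid ev_block3 !evs !(eq _ _ eu, eq _ _ ew) eu ew euv.
by rewrite up3N ev_block3 !evs.
Qed.

End At.
End BDEvaluation.

Section Reversal3.
Variables (R : realType) (E : algType R[i]).
Local Notation C := R[i].

Lemma relabeled_rev_cast p n (e : p = n) (A : 'M[E]_p) :
  relabeled (@rev_ord n) (castmx (e, e) A) = castmx (e, e) (relabeled (@rev_ord p) A).
Proof. by case: n / e; rewrite !castmx_id. Qed.

Variable m : nat.
Let p0 : 'I_(1 + (m + 1)) := lshift (m + 1) ord0.
Let pm (c : 'I_m) : 'I_(1 + (m + 1)) := rshift 1 (lshift 1 c).
Let p1 : 'I_(1 + (m + 1)) := rshift 1 (rshift m ord0).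

Lemma pos3P (u : 'I_(1 + (m + 1))) : [\/ u = p0, exists c, u = pm c | u = p1].
Proof.
case: (split_ordP u) => v ->; first by constructor 1; rewrite (ord1 v).
case: (split_ordP v) => w ->; first by constructor 2; exists w.
by constructor 3; rewrite (ord1 w).
Qed.

Let rev_p0 : rev_ord p0 = p1. Proof. by apply: val_inj => /=; lia. Qed.
Let rev_p1 : rev_ord p1 = p0. Proof. by apply: val_inj => /=; lia. Qed.
Let rev_pm c : rev_ord (pm c) = pm (rev_ord c).
Proof. by apply: val_inj => /=; have := ltn_ord c; lia. Qed.

Section Entries.
Variables (A11 : 'M[E]_(1, 1)) (A12 : 'M[E]_(1, m))
    (A13 : 'M[E]_(1, 1)) (A21 : 'M[E]_(m, 1)) (A22 : 'M[E]_(m, m))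
    (A23 : 'M[E]_(m, 1)) (A31 : 'M[E]_(1, 1)) (A32 : 'M[E]_(1, m)) (A33 : 'M[E]_(1, 1)).
Let A := blk3 A11 A12 A13 A21 A22 A23 A31 A32 A33.

Lemma blk3_rev : relabeled (@rev_ord _) A =
  blk3 A33 (A32 *m rev3 E m) A31 (rev3 E m *m A23) (rev3 E m *m A22 *m rev3 E m)
    (rev3 E m *m A21) A13 (A12 *m rev3 E m) A11.
Proof.
apply/matrixP => u v; rewrite mxE /A /blk3.
case: (pos3P u) => [->|[c ->]|->]; case: (pos3P v) => [->|[d ->]|->];
  rewrite ?rev_p0 ?rev_p1 ?rev_pm /p0 /p1 /pm
    ?(block_mxEul, block_mxEur, block_mxEdl, block_mxEdr, row_mxEl, row_mxEr,
      col_mxEu, col_mxEd) //;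
  by rewrite ?(mul_rev3E, rev3_mulE).
Qed.

End Entries.

Lemma rev3K : rev3 E m *m rev3 E m = 1%:M.
Proof. by apply/matrixP => c d; rewrite rev3_mulE !mxE rev_ordK eq_sym. Qed.

Lemma up3_rev (b : 'rV[E]_m) : relabeled (@rev_ord _) (up3 b) = lo3 b^T.
Proof.
rewrite /up3 blk3_rev /lo3 !mul0mx !mulmx0 mulmx1 rev3K mulmxN mulmxA rev3K mul1mx trmxK.
by [].
Qed.

Lemma lo3_rev (a : 'cV[E]_m) : relabeled (@rev_ord _) (lo3 a) = up3 a^T.
Proof.
have e : a^T *m rev3 E m *m rev3 E m = a^T by rewrite -mulmxA rev3K mulmx1.
by rewrite /lo3 blk3_rev e /up3 !mul0mx !mulmx0 mulmx1 rev3K trmxK mulmxN.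
Qed.

Lemma dg3_rev x y z : relabeled (@rev_ord _) (dg3 E m x y z) = dg3 E m z y x.
Proof.
by rewrite /dg3 blk3_rev !mul0mx !mulmx0 -cmx_comm -mulmxA rev3K mulmx1.
Qed.

Lemma deg3_rev k x (b : 'rV[E]_m) (a : 'cV[E]_m) : relabeled (@rev_ord _) (deg3 k x b a)
  = lo3 b^T *m dg3 E m 1 x (quad_val k x) *m up3 a^T.
Proof.
have triple (M1 M2 M3 : 'M[E]_(1 + (m + 1))) : relabeled (@rev_ord _) (M1 *m M2 *m M3)
    = relabeled (@rev_ord _) M1 *m relabeled (@rev_ord _) M2 *m relabeled (@rev_ord _) M3.
  by rewrite !(relabeledM rev_ord_inj).
refine (eq_trans (triple _ _ _) _).
by apply: congr2; [apply: congr2; [exact: up3_rev|exact: dg3_rev]|exact: lo3_rev].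
Qed.

End Reversal3.

Section Diagonal3.
Variables (S : pzRingType) (m : nat).

Lemma blk3_udu b q c x y z w s v b' q' c' : exists B12 B13 B21 B23 B31 B32,
  blk3 1%:M b q 0 1%:M c 0 0 1%:M *m blk3 x 0 0 y z 0 w s v
    *m blk3 1%:M b' q' 0 1%:M c' 0 0 1%:M
  = blk3 (S := S) (m := m) (x + b *m y + q *m w) B12 B13
     B21 ((y + c *m w) *m b' + (z + c *m s)) B23
     B31 B32 (w *m q' + s *m c' + v).
Proof.
by do 6!eexists; rewrite !blk3M ?(mul1mx, mulmx1, mul0mx, mulmx0, addr0, add0r).
Qed.

End Diagonal3.

Section LinearCoefficient.
Variables (R : realType) (E : algType R[i]).
Local Notation C := R[i].
Implicit Types (p q : {poly E}).

(** The coefficients of x^0 and x^1 multiply like dual numbers. *)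
Definition jet p (a b : E) := p`_0 = a /\ p`_1 = b.

Lemma jetC a : jet a%:P a 0.
Proof. by rewrite /jet !coefC. Qed.

Lemma jetD p q a b a' b' : jet p a b -> jet q a' b' -> jet (p + q) (a + a') (b + b').
Proof. by move=> [pa pb] [qa qb]; split; rewrite coefD ?pa ?pb ?qa ?qb. Qed.

Lemma jetN p a b : jet p a b -> jet (- p) (- a) (- b).
Proof. by move=> [pa pb]; split; rewrite coefN ?pa ?pb. Qed.

Lemma jetM p q a b a' b' : jet p a b -> jet q a' b' -> jet (p * q) (a * a') (a * b' + b * a').
Proof.
move=> [pa pb] [qa qb]; split; rewrite coefM.
  by rewrite big_ord1 pa qa.
by rewrite big_ord_recr big_ord1 /= pa pb qa qb.
Qed.

Lemma jetX : jet 'X 0 1.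
Proof. by rewrite /jet !coefX. Qed.

Lemma jet_sum (I : finType) (F : I -> {poly E}) (a b : I -> E) :
  (forall i, jet (F i) (a i) (b i)) -> jet (\sum_i F i) (\sum_i a i) (\sum_i b i).
Proof.
move=> h; split; rewrite coef_sum; apply: eq_bigr => i _; by case: (h i).
Qed.

Lemma jet_linear k : jet ('X + sc E k) k%:A 1.
Proof. by have := jetD jetX (jetC k%:A); rewrite add0r addr0. Qed.

End LinearCoefficient.

Section BDTwistEntries.
Variables (R : realType) (K : nat) (hK : (4 < K)%N) (E : algType R[i]).
Local Notation C := R[i].
Implicit Types (ab an : 'I_K -> E) (t : C).
Local Notation PE := {poly E}.
Local Notation mid := (bd_mid hK).

Let cst m n (M : 'M[PE]_(m, n)) := forall i j, exists a, jet (M i j) a 0.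

Let cstM m n p (A : 'M[PE]_(m, n)) (B : 'M_(n, p)) : cst A -> cst B -> cst (A *m B).
Proof.
move=> hA hB i j; rewrite mxE; have [a ha] := boolp.choice (fun k => hA i k).
have [b hb] := boolp.choice (fun k => hB k j).
exists (\sum_k a k * b k); have := jet_sum (fun k => jetM (ha k) (hb k)).
by rewrite [X in jet _ _ X](_ : _ = 0) // big1 // => k _; rewrite mulr0 mul0r addr0.
Qed.

Let cstN m n (A : 'M[PE]_(m, n)) : cst A -> cst (- A).
Proof. by move=> hA i j; have [a /jetN h] := hA i j; exists (- a); rewrite mxE -[0]oppr0. Qed.

Let cstZ m n k (A : 'M[PE]_(m, n)) : cst A -> cst (sc E k *: A).
Proof.
move=> hA i j; have [a h] := hA i j; exists (k%:A * a); rewrite mxE.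
by have := jetM (jetC k%:A) h; rewrite mulr0 mul0r addr0.
Qed.

Let cstT m n (A : 'M[PE]_(m, n)) : cst A -> cst A^T.
Proof. by move=> hA i j; rewrite mxE; apply: hA. Qed.

Let cst_wb ab : cst (bd_wb hK ab).
Proof. by move=> i j; exists (ab (mid j)); rewrite mxE; apply: jetC. Qed.
Let cst_w an : cst (bd_w hK an).
Proof. by move=> i j; exists (an (mid i)); rewrite mxE; apply: jetC. Qed.
Let cst_J : cst (bd_J K E).
Proof.
move=> i j; exists (j == rev_ord i)%:R; rewrite mxE -polyC_natr; exact: jetC.
Qed.

Let Jmul n (M : 'M[PE]_(K - 2, n)) c j : (bd_J K E *m M) c j = M (rev_ord c) j.
Proof.
rewrite !mxE (bigD1 (rev_ord c)) //= mxE eqxx mul1r big1 ?addr0 // => l li.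
by rewrite mxE (negPf li) mul0r.
Qed.

Let mulJ n (M : 'M[PE]_(n, K - 2)) i c : (M *m bd_J K E) i c = M i (rev_ord c).
Proof.
rewrite !mxE (bigD1 (rev_ord c)) //= mxE rev_ordK eqxx mulr1 big1 ?addr0 // => l li.
by rewrite mxE -[c]rev_ordK (inj_eq rev_ord_inj) eq_sym (negPf li) mulr0.
Qed.

Let mul_sc m n (M : 'M[PE]_(m, n)) (p : PE) i j : (M *m p%:M) i j = M i j * p.
Proof.
rewrite mxE (bigD1 j) //= mxE eqxx big1 ?addr0 // => k kj.
by rewrite mxE (negPf kj) mulr0.
Qed.

Let addE m n (A B : 'M[PE]_(m, n)) i j : (A + B) i j = A i j + B i j.
Proof. by rewrite mxE. Qed.
Let oppE m n (A : 'M[PE]_(m, n)) i j : (- A) i j = - A i j.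
Proof. by rewrite mxE. Qed.

Let quad_jet k l : exists c : C, exists a, jet (('X + sc E k) * ('X + sc E k - sc E l + 2%:R)) a c%:A.
Proof.
have h2 : jet (2%:R : PE) 2%:R 0 by rewrite -polyC_natr; apply: jetC.
have h := jetM (jet_linear E k) (jetD (jetD (jet_linear E k) (jetN (jetC l%:A))) h2).
exists (k + (k - l + 2%:R)); exists (k%:A * (k%:A - l%:A + 2%:R)).
have e2 : (2%:R : C)%:A = 2%:R :> E by rewrite scaler_nat.
rewrite scalerDl (scalerDl 1 (k - l) 2%:R) scalerBl e2.
by move: h; rewrite subr0 addr0 mulr1 mul1r.
Qed.

Let first : 'I_K := cast_ord (bd_dim hK) (lshift (K - 2 + 1) ord0).
Let last : 'I_K := cast_ord (bd_dim hK) (rshift 1 (rshift (K - 2) ord0)).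

(** The linear part in the spectral parameter of the diagonal of the Lax matrix:
    the Cartan elements in the oscillator realisation. *)
Lemma bd_lax_coef1 t ab an : exists k0 km k1 : C,
  [/\ (bd_lax hK t ab an first first)`_1 = k0%:A - \sum_c ab (mid c) * an (mid c),
      forall c, (bd_lax hK t ab an (mid c) (mid c))`_1
        = km%:A + an (mid c) * ab (mid c) - ab (mid (rev_ord c)) * an (mid (rev_ord c))
    & (bd_lax hK t ab an last last)`_1 = k1%:A + \sum_c an (mid c) * ab (mid c)].
Proof.
set ku : C := -1 + t / 2%:R + K%:R / 4%:R; set kv : C := - (t / 2%:R + K%:R / 4%:R).
have vE : 'X - sc E (t / 2%:R + K%:R / 4%:R) = 'X + sc E kv.
  by rewrite /kv /sc scaleNr polyCN.
have [cu [au hu]] := quad_jet ku (K%:R / 2%:R).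
have [cv [av hv]] := quad_jet kv (K%:R / 2%:R).
rewrite /bd_lax vE.
set b := bd_wb hK ab; set a := bd_w hK an; set J := bd_J K E.
set q := - (_ *: (b *m J *m b^T)).
have [B12 [B13 [B21 [B23 [B31 [B32 e]]]]]] := blk3_udu b q (- (J *m b^T))
  (('X + sc E ku) * ('X + sc E ku - sc E (K%:R / 2%:R) + 2%:R))%:M
  (- (a *m ('X + sc E ku)%:M)) (('X + sc E ku) * ('X + sc E kv))%:M
  (- (sc E (1 / 2%:R) *: (a^T *m J *m a))) (a^T *m J *m ('X + sc E kv)%:M)
  (('X + sc E kv) * ('X + sc E kv - sc E (K%:R / 2%:R) + 2%:R))%:M
  (- b) q (J *m b^T).
have cb : cst b by exact: cst_wb.
have ca : cst a by exact: cst_w.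
have cJ : cst J by exact: cst_J.
have cW : cst (- (sc E (1 / 2%:R) *: (a^T *m J *m a))).
  by apply/cstN/cstZ/cstM => //; apply: cstM => //; apply: cstT.
have cq : cst q by apply/cstN/cstZ/cstM; [exact: cstM|exact: cstT].
have cJb : cst (- (J *m b^T)) by apply/cstN/cstM => //; apply: cstT.
rewrite /blk3 in e; rewrite /block3 -/ku e {e}.
have jets p x y : jet (E := E) p x y -> p`_1 = y by case.
have sum_cst m (A : 'M[PE]_m) i k j y : cst A -> jet (k : PE) j y -> (k + A i i)`_1 = y.
  by move=> /(_ i i) [x hx] /jetD /(_ hx); rewrite addr0 => /jets.
exists cu, (ku + kv), cv; split=> [|c|].
- rewrite castmxE !cast_ordK block_mxEul addE.
  apply: sum_cst (cstM cq cW) _; rewrite addE mulmxN oppE mulmxA.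
  have jba : jet ((b *m a) ord0 ord0) (\sum_c ab (mid c) * an (mid c)) 0.
    rewrite mxE; have := jet_sum (fun d => jetM (jetC (ab (mid d))) (jetC (an (mid d)))).
    rewrite [X in jet _ _ X](_ : _ = 0); last by rewrite big1 // => d _; rewrite mulr0 mul0r addr0.
    by rewrite (eq_bigr (fun d => b ord0 d * a d ord0)) // => d _; rewrite !mxE.
  rewrite mul_sc mxE eqxx mulr1n.
  have := jetD hu (jetN (jetM jba (jet_linear E ku))).
  by rewrite mulr1 mul0r addr0; apply.
- have ecm : cast_ord (esym (bd_dim hK)) (mid c) = rshift 1 (lshift 1 c) by exact: cast_ordK.
  rewrite castmxE !ecm block_mxEdr block_mxEul addE addE.
  rewrite mxE big_ord1 [X in _ + (X + _)]mxE eqxx mulr1n oppE.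
  have [z hz] := cstM cJb cW c ord0.
  have h1 : jet ((- (a *m ('X + sc E ku)%:M) + - (J *m b^T) *m
      - (sc E (1 / 2%:R) *: (a^T *m J *m a))) c ord0) (- (an (mid c) * ku%:A) + z) (- an (mid c)).
    rewrite addE oppE mul_sc; have ha : jet (a c ord0) (an (mid c)) 0 by rewrite mxE; apply: jetC.
    have := jetD (jetN (jetM ha (jet_linear E ku))) hz.
    by rewrite mulr1 mul0r !addr0.
  have h2 : jet (b ord0 c) (ab (mid c)) 0 by rewrite mxE; apply: jetC.
  have h3 : jet ((- (J *m b^T) *m (a^T *m J *m ('X + sc E kv)%:M)) c c)
      (- ab (mid (rev_ord c)) * (an (mid (rev_ord c)) * kv%:A))
      (- (ab (mid (rev_ord c)) * an (mid (rev_ord c)))).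
    rewrite mxE big_ord1 oppE Jmul mul_sc mulJ [b^T _ _]mxE [a^T _ _]mxE.
    have hb : jet (b ord0 (rev_ord c)) (ab (mid (rev_ord c))) 0 by rewrite mxE; apply: jetC.
    have ha : jet (a (rev_ord c) ord0) (an (mid (rev_ord c))) 0 by rewrite mxE; apply: jetC.
    rewrite -mulNr; have := jetM (jetN hb) (jetM ha (jet_linear E kv)).
    by rewrite mulr1 mul0r addr0 oppr0 mul0r addr0.
  have := jetD (jetM h1 (jetN h2)) (jetD (jetM (jet_linear E ku) (jet_linear E kv)) h3).
  move/jets; rewrite oppr0 mulr0 add0r mulrNN mulr1 [1 * kv%:A]mul1r -scalerDl => ->.
  by rewrite addrA [an _ * _ + _]addrC.
rewrite castmxE !cast_ordK block_mxEdr block_mxEdr -addrA addE [_ ord0 ord0 + _]addrC.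
apply: sum_cst (cstM cW cq) _; rewrite addE mxE.
have h d : jet ((a^T *m J *m ('X + sc E kv)%:M) ord0 d * (J *m b^T) d ord0)
    (an (mid (rev_ord d)) * kv%:A * ab (mid (rev_ord d)))
    (an (mid (rev_ord d)) * ab (mid (rev_ord d))).
  rewrite Jmul mul_sc mulJ [b^T _ _]mxE [a^T _ _]mxE.
  have hb : jet (b ord0 (rev_ord d)) (ab (mid (rev_ord d))) 0 by rewrite mxE; apply: jetC.
  have ha : jet (a (rev_ord d) ord0) (an (mid (rev_ord d))) 0 by rewrite mxE; apply: jetC.
  have := jetM (jetM ha (jet_linear E kv)) hb.
  by rewrite mulr1 mul0r addr0 mulr0 add0r.
rewrite [X in _ + X]mxE eqxx mulr1n; have := jetD (jet_sum h) hv.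
by rewrite addrC [X in jet _ _ X]addrC [\sum_i an _ * ab _](reindex_inj rev_ord_inj); apply.
Qed.

End BDTwistEntries.

Section Related3.
Variables (R : realType) (L : Type) (E E' : algType R[i]) (ell : L -> E) (ell' : L -> E').
Variable m : nat.
Local Notation rel := (related_mx ell ell').

Let rel0 p q : rel (0 : 'M_(p, q)) 0.
Proof. by move=> i j; rewrite !mxE; apply: related0. Qed.
Let rel_tr p q (A : 'M[E]_(p, q)) A' : rel A A' -> rel A^T A'^T.
Proof. by move=> h i j; rewrite !mxE. Qed.
Let rel_rev : rel (rev3 E m) (rev3 E' m).
Proof.
move=> i j; rewrite !mxE; have := related_scalar ell ell' ((j == rev_ord i)%:R).
by rewrite !scaler_nat.
Qed.
Let rel_half p q (A : 'M[E]_(p, q)) A' : rel A A' -> rel (half3 E *: A) (half3 E' *: A').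
Proof. by move=> h i j; rewrite !mxE; apply: relatedM => //; apply: related_scalar. Qed.

Lemma related_blk3 A11 A12 A13 A21 A22 A23 A31 A32 A33 B11 B12 B13 B21 B22 B23 B31 B32 B33 :
  rel A11 B11 -> rel A12 B12 -> rel A13 B13 -> rel A21 B21 -> rel A22 B22 -> rel A23 B23 ->
  rel A31 B31 -> rel A32 B32 -> rel A33 B33 ->
  rel (blk3 (m := m) A11 A12 A13 A21 A22 A23 A31 A32 A33)
    (blk3 B11 B12 B13 B21 B22 B23 B31 B32 B33).
Proof.
move=> h11 h12 h13 h21 h22 h23 h31 h32 h33; apply: related_block => //.
- move=> i j; case: (split_ordP j) => l ->; first by rewrite !row_mxEl.
  by rewrite !row_mxEr.
- move=> i j; case: (split_ordP i) => l ->; first by rewrite !col_mxEu.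
  by rewrite !col_mxEd.
exact: related_block.
Qed.

Lemma related_up3 (b : 'rV[E]_m) (b' : 'rV[E']_m) : rel b b' -> rel (up3 b) (up3 b').
Proof.
move=> hb; have hbt := rel_tr hb.
apply: related_blk3 => //; try exact: related_id.
  by apply/related_opp/rel_half/related_mul => //; apply: related_mul.
by apply/related_opp/related_mul.
Qed.

Lemma related_lo3 (a : 'cV[E]_m) (a' : 'cV[E']_m) : rel a a' -> rel (lo3 a) (lo3 a').
Proof.
move=> ha; have hat := rel_tr ha.
apply: related_blk3 => //; try exact: related_id.
- exact: related_opp.
- by apply/related_opp/rel_half/related_mul => //; apply: related_mul.
exact: related_mul.
Qed.

Lemma related_dg3 x y z : rel (dg3 E m x y z) (dg3 E' m x y z).
Proof. by apply: related_blk3 => //; apply: related_cmx. Qed.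

Lemma related_deg3 k x (b : 'rV[E]_m) (b' : 'rV[E']_m) (a : 'cV[E]_m) (a' : 'cV[E']_m) : rel b b' -> rel a a' ->
  rel (deg3 k x b a) (deg3 k x b' a').
Proof.
move=> hb ha; apply: related_mul; last exact: related_lo3.
by apply: related_mul; [exact: related_up3|exact: related_dg3].
Qed.

Lemma related_lax3 k u v (b : 'rV[E]_m) (b' : 'rV[E']_m) (a : 'cV[E]_m) (a' : 'cV[E']_m) : rel b b' -> rel a a' ->
  rel (lax3 k u v b a) (lax3 k u v b' a').
Proof.
move=> hb ha; apply: related_mul; last by apply/related_up3/related_opp.
apply: related_mul; first exact: related_up3.
apply: related_mul; last exact: related_dg3.
by apply: related_mul; [exact: related_dg3|exact: related_lo3].
Qed.

End Related3.

Lemma up3_0 (R : realType) (E : algType R[i]) m : up3 (0 : 'rV[E]_m) = 1%:M.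
Proof.
by rewrite /up3 !mul0mx trmx0 mulmx0 scaler0 !oppr0 blk3_id.
Qed.

Section BDPositions.
Variables (K : nat) (hK : (4 < K)%N).
Local Notation mid := (bd_mid hK).

Definition pos_first : 'I_K := cast_ord (bd_dim hK) (lshift (K - 2 + 1) ord0).
Definition pos_last : 'I_K := cast_ord (bd_dim hK) (rshift 1 (rshift (K - 2) ord0)).

Lemma pos_firstE : pos_first = bd_first hK. Proof. exact: val_inj. Qed.
Lemma pos_lastE : pos_last = rev_ord (bd_first hK).
Proof. by apply: val_inj => /=; lia. Qed.

Lemma bd_posP q : [\/ q = pos_first, exists c, q = mid c | q = pos_last].
Proof.
rewrite -(cast_ordKV (bd_dim hK) q); set u := cast_ord _ q.
have [->|[c ->]|->] := pos3P u.
- by constructor 1.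
- by constructor 2; exists c.
by constructor 3.
Qed.

Lemma bd_mid_rev c : rev_ord (mid c) = mid (rev_ord c).
Proof. by apply: val_inj => /=; have := ltn_ord c; lia. Qed.

Lemma bd_mid_inj : injective mid.
Proof. by move=> c d /(congr1 val) /= /eqP; rewrite eqSS => /eqP; apply: val_inj. Qed.

Lemma bd_mid_label c : mid c \in bd_labels K.
Proof. by rewrite inE /=; have := ltn_ord c; lia. Qed.

Lemma bd_label_mid l : l \in bd_labels K -> exists c, l = mid c.
Proof.
move=> hl; case: (bd_posP l) => [e|//|e]; move: hl; rewrite inE e /= ?addn0; last lia.
by [].
Qed.

End BDPositions.

Lemma relabel_mx_comp (R : realType) n (f g : 'I_n -> 'I_n) :
  relabel_mx R f *m relabel_mx R g = relabel_mx R (f \o g).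
Proof.
apply/matrixP => i j; rewrite mxE relabel_mxE (bigD1 (g j)) //= !relabel_mxE eqxx mulr1.
by rewrite big1 ?addr0 // => k kj; rewrite [relabel_mx R g _ _]relabel_mxE (negPf kj) mulr0.
Qed.

Section BDFactorisation.
Variables (R : realType) (K : nat) (hK : (4 < K)%N) (b : bool) (k : 'I_(K./2)).
Variable th : 'I_(K./2) -> R[i].
Local Notation C := R[i].
Local Notation r := (K./2).
Hypothesis dom : cl_domain th.
Local Notation sigma := (bd_perm b k).
Local Notation mid := (bd_mid hK).
Let S := bd_labels K.
Let J : finType := {l : 'I_K | l \in S}.
Let tau := tau_of th.
Let flip := @bd_flip K b k.
Let first := bd_first hK.

Let tau_neq0 i : tau i != 0. Proof. exact: expC_neq0. Qed.

Let tau1 := bd_tau b k tau.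
Let tau2 := bd_tau (~~ b) k tau.

Let bd_tau_neq0 b' i : bd_tau b' k tau i != 0.
Proof. by rewrite /bd_tau; case: b'; rewrite ?invr_eq0. Qed.

Let lam1 := wlam (bd_wt hK) tau1.
Let lam2 := wlam (bd_wt hK) tau2.
Let vv := vec_val tau.
Let vv_neq0 q : vv q != 0. Proof. exact: vec_val_neq0. Qed.

Let lam1E l : lam1 l = vv (sigma (val l)) / vv (sigma first).
Proof. by rewrite /lam1 bd_wlam ?vec_val_tau // => i; apply: bd_tau_neq0. Qed.

Let lam2E l : lam2 l = (lam1 l)^-1.
Proof.
rewrite lam1E /lam2 bd_wlam; last by move=> i; apply: bd_tau_neq0.
rewrite !vec_val_tau // !(bd_perm_neg hK) !(bd_perm_rev hK) !vec_val_rev // -/vv.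
by rewrite invfM.
Qed.

Let lamT (l : J) : C := if in_labels flip l then (lam1 l)^-1 else lam1 l.

Let lamT_lt1 l : `|lamT l| < 1.
Proof.
have lS : val l \in S by exact: (valP l).
have := bd_perm_flip hK b k lS; rewrite (_ : ord_first _ = first); last exact: val_inj.
have nz q : 0 < `|vv q| by rewrite normr_gt0.
rewrite /lamT /in_labels -/flip lam1E; case: ifP => _ h.
  by rewrite invf_div normrM normfV ltr_pdivrMr // mul1r; apply: vec_val_decreasing.
by rewrite normrM normfV ltr_pdivrMr // mul1r; apply: vec_val_decreasing.
Qed.

Let lam1_neq0 l : lam1 l != 0.
Proof. by rewrite lam1E mulf_neq0 ?invr_eq0. Qed.
Let lamT_neq0 l : lamT l != 0.
Proof. by rewrite /lamT; case: ifP; rewrite ?invr_eq0. Qed.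
Let ph_lamT l : ph_weight lamT (in_labels flip) l = lam1 l.
Proof. by rewrite /ph_weight /lamT; case: (in_labels flip l); rewrite ?invrK. Qed.
Let lam1_neq1 l : lam1 l != 1.
Proof. by rewrite -ph_lamT; apply: ph_weight_neq1. Qed.
Let lam2_neq0 l : lam2 l != 0. Proof. by rewrite lam2E invr_eq0. Qed.
Let lam2_neq1 l : lam2 l != 1. Proof. by rewrite lam2E invr_eq1. Qed.

Let E := fock_end R ((J + J) + (J + J))%type.
Let p1 : bool * J -> E := left_letter lam1 lam2.
Let p2 : bool * J -> E := right_letter lam1 lam2.
Let one := fun _ : J => 1 : C.
Let mixed := mixed_letter p1 p2 one.
Let del := mixed_del p1 p2 one one.
Let ext_del (l : 'I_K) : E := oapp del 0 (insub l).

Let row (E0 : algType C) (f : 'I_K -> E0) : 'rV[E0]_(K - 2) := bd_row hK f.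
Let col (E0 : algType C) (f : 'I_K -> E0) : 'cV[E0]_(K - 2) := bd_col hK f.

Let B := bd_B R b k.
Let B2 := bd_B R (~~ b) k.
Let rv := relabel_mx R (@rev_ord K).

Let B2E : B2 = B *m rv.
Proof.
rewrite /B2 /B !(bd_BE hK) relabel_mx_comp; congr relabel_mx; apply/funext => p.
exact: bd_perm_neg.
Qed.

Let sigma_inj : injective sigma. Proof. exact: inv_inj (bd_permK hK b k). Qed.

Let B_unit : B \in unitmx /\ invmx B = relabel_mxV R sigma.
Proof. by rewrite /B bd_BE //; exact: (right_inv_unit (relabel_mxK R sigma_inj).1). Qed.

Let B2_unit : B2 \in unitmx /\ invmx B2 = relabel_mxV R (@rev_ord K) *m invmx B.
Proof.
have uB : B \in unitmx by case: B_unit.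
have := right_inv_unit (mulmx_inv_comp (mulmxV uB) (relabel_mxK R (@rev_ord_inj K)).1).
by rewrite -/rv -B2E.
Qed.

Let ext_comm (q q' : bool) l l' :
  GRing.comm (extend_letter p1 q l) (extend_letter p2 q' l').
Proof.
rewrite /extend_letter; case: insubP => [x _ _|_] /=; case: insubP => [y _ _|_] /=;
  rewrite /GRing.comm ?mul0r ?mulr0 //; exact: left_right_comm.
Qed.

Let mixed_false l : extend_letter mixed false l = extend_letter p1 false l + extend_letter p2 true l.
Proof.
rewrite /extend_letter; case: insubP => [u _ _|_] /=; last by rewrite addr0.
by rewrite /mixed /mixed_letter /= scale1r.
Qed.

Let mixed_true l : extend_letter mixed true l = extend_letter p1 true l.
Proof. by rewrite /extend_letter; case: insubP. Qed.

Let del_E l : ext_del l = extend_letter p1 true l + extend_letter p2 false l.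
Proof.
rewrite /ext_del /extend_letter; case: insubP => [u _ _|_] /=; last by rewrite addr0.
by rewrite /del /mixed_del !scale1r.
Qed.

Let cast (A : 'M[E]_(1 + (K - 2 + 1))) : 'M[E]_K := castmx (bd_dim hK, bd_dim hK) A.

Let factor_identity x y :
  (scal_mx E B *m cast (deg3 (half_dim R K) x (row (extend_letter p1 true))
      (col (extend_letter p1 false))) *m scal_mx E (invmx B)) *m
  (scal_mx E B2 *m cast (deg3 (half_dim R K) y (row (extend_letter p2 true))
      (col (extend_letter p2 false))) *m scal_mx E (invmx B2))
  = scal_mx E B *m (cast (lax3 (half_dim R K) x y (row (extend_letter mixed true))
        (col (extend_letter mixed false))) *m cast (up3 (row ext_del)))
      *m scal_mx E (invmx B).
Proof.
have BB : scal_mx E (invmx B) *m scal_mx E B = 1%:M.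
  by rewrite -scal_mxM mulVmx ?scal_mx1 //; case: B_unit.
have rvV : relabel_mxV R (@rev_ord K) = rv.
  apply/matrixP => i j; rewrite relabel_mxVE relabel_mxE eq_sym (inv_eq (@rev_ordK _)).
  by rewrite eq_sym.
have regroup (X Xi Y Z M1 M2 : 'M[E]_K) : Xi *m X = 1%:M ->
    (X *m M1 *m Xi) *m ((X *m Y) *m M2 *m (Z *m Xi)) = X *m (M1 *m (Y *m M2 *m Z)) *m Xi.
  by move=> XX; rewrite -!mulmxA (mulmxA Xi) XX mul1mx.
rewrite B2_unit.2 B2E !scal_mxM; refine (eq_trans (regroup _ _ _ _ _ _ BB) _).
have conj : scal_mx E rv *m cast (deg3 (half_dim R K) y (row (extend_letter p2 true))
      (col (extend_letter p2 false))) *m scal_mx E (relabel_mxV R (@rev_ord K))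
  = cast (lo3 (row (extend_letter p2 true))^T *m dg3 E (K - 2) 1 y (quad_val (half_dim R K) y)
      *m up3 (col (extend_letter p2 false))^T).
  rewrite rvV -{1}rvV relabelE /cast relabeled_rev_cast; congr castmx; exact: deg3_rev.
have eb : row (extend_letter mixed true) = row (extend_letter p1 true).
  by apply/matrixP => i j; rewrite !mxE mixed_true.
have ea : col (extend_letter mixed false)
    = col (extend_letter p1 false) + (row (extend_letter p2 true))^T.
  by apply/matrixP => i j; rewrite !mxE mixed_false.
have ed : row ext_del = row (extend_letter p1 true) + (col (extend_letter p2 false))^T.
  by apply/matrixP => i j; rewrite !mxE del_E.
rewrite eb ea ed; apply: (congr1 (fun A => scal_mx E B *m A *m scal_mx E (invmx B))).
refine (eq_trans (congr1 (mulmx _) conj) _).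
refine (eq_trans (esym (castmx_mulsq _ _ _)) (eq_trans (congr1 cast _) (castmx_mulsq _ _ _))).
by apply: factor3 => i j; rewrite !mxE; apply: ext_comm.
Qed.

Let sgn (l : J) : int := osc_sign flip (val l).

(** The weight of the vector at position p, on the label l, read at position q. *)
Let pos_wt (q p : 'I_K) : int := (q == p)%:R - (q == rev_ord p)%:R.

Let vec_wt_sigma p i : vec_wt (sigma p) i = pos_wt (sigma (bd_ix false i)) p.
Proof.
have e q : (bd_ix false i == sigma q) = (sigma (bd_ix false i) == q).
  by rewrite eq_sym (inv_eq (bd_permK hK b k)) eq_sym.
rewrite /vec_wt /pos_wt -e -[true]/(~~ false) -bd_ix_rev; congr (_ - _).
by rewrite -e (bd_perm_rev hK) (inv_eq (@rev_ordK _)).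
Qed.

Let sgn_at p (l : J) : osc_sign flip p * (p == val l)%:R = sgn l * (p == val l)%:R.
Proof. by rewrite /sgn; case: eqP => [->|]; rewrite ?mulr0. Qed.

Let sum_mid (l : J) : \sum_c (mid c == val l)%:R = 1 :> int.
Proof.
have [c lc] := bd_label_mid hK (valP l); rewrite lc (bigD1 c) //= eqxx big1 ?addr0 // => d dc.
by rewrite (inj_eq (@bd_mid_inj K hK)) (negPf dc).
Qed.

Let laxk_coef t q : ((bd_laxk hK b k t) (sigma q) (sigma q))`_1
  = (bd_lax hK t (ph_bar R S flip) (ph_ann R S flip) q q)`_1.
Proof.
have scE : map_mx (sc (osc R S)) (bd_B R b k) = map_mx (sc (osc R S)) (relabel_mx R sigma).
  by rewrite bd_BE.
have scVE : map_mx (sc (osc R S)) (invmx (bd_B R b k))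
    = map_mx (sc (osc R S)) (relabel_mxV R sigma).
  by rewrite -/B B_unit.2.
rewrite /bd_laxk /conj_lax scE scVE (relabel_diag sigma_inj) //.
  by rewrite /sc scale0r polyC0.
by rewrite /sc scale1r polyC1.
Qed.

Let middle_pos p (l : J) : p = first \/ p = rev_ord first -> (p == val l) = false.
Proof.
move=> hp; apply/eqP => e; have := valP l; rewrite -e inE.
by case: hp => -> /=; lia.
Qed.

Let ends_neq : (first == rev_ord first) = false.
Proof. by apply/eqP => /(congr1 val) /=; lia. Qed.

Let rev_eq (p q : 'I_K) : (p == rev_ord q) = (rev_ord p == q).
Proof. by rewrite eq_sym (inv_eq (@rev_ordK _)) eq_sym. Qed.

Let pos_wt_first (l : J) : pos_wt first (val l) - pos_wt first first = -1.
Proof.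
rewrite /pos_wt (middle_pos l (or_introl erefl)) rev_eq (middle_pos l (or_intror erefl)).
by rewrite ends_neq eqxx !subr0 sub0r.
Qed.

Let pos_wt_last (l : J) : pos_wt (rev_ord first) (val l) - pos_wt (rev_ord first) first = 1.
Proof.
rewrite /pos_wt rev_eq rev_ordK (middle_pos l (or_introl erefl)).
by rewrite (middle_pos l (or_intror erefl)) eqxx eq_sym ends_neq subr0 !sub0r opprK.
Qed.

Let pos_wt_mid c (l : J) : pos_wt (mid c) (val l) - pos_wt (mid c) first
  = (mid c == val l)%:R - (mid (rev_ord c) == val l)%:R.
Proof.
rewrite /pos_wt rev_eq bd_mid_rev; have := bd_mid_label hK c; have := bd_mid_label hK (rev_ord c).
have out : first \notin bd_labels K by rewrite inE.
have ne d : mid d \in bd_labels K -> (mid d == first) = false.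
  by move=> hd; apply/negP => /eqP e; rewrite e (negPf out) in hd.
by move=> /ne e1 /ne e2; rewrite (rev_eq (mid c) first) bd_mid_rev e1 e2 subrr subr0.
Qed.

Let twist_affine t i : exists c : C, affine
  (gen_lax 1 (bd_laxk hK b k t) (bd_ix false i) (bd_ix false i) : fock_end R J) c
  (fun l => sgn l * (vec_wt (sigma (val l)) i - vec_wt (sigma first) i)).
Proof.
rewrite /gen_lax -[bd_ix false i](bd_permK hK b k) laxk_coef.
set q := sigma (bd_ix false i).
have [k0 [km [k1 [h0 hm h1]]]] := bd_lax_coef1 hK t (ph_bar R S flip) (ph_ann R S flip).
have num c := @affine_osc_number R _ S flip (mid c).
have con c := @affine_osc_conumber R _ S flip (mid c).
have [n hn] := boolp.choice num; have [d hd] := boolp.choice con.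
have slope (l : J) : vec_wt (sigma (val l)) i - vec_wt (sigma first) i
    = pos_wt q (val l) - pos_wt q first by rewrite !vec_wt_sigma.
have sum_sgn (l : J) :
    \sum_c osc_sign flip (mid c) * (mid c == val l)%:R = sgn l.
  by under eq_bigr do rewrite sgn_at; rewrite -mulr_sumr sum_mid mulr1.
case: (bd_posP hK q) => [e|[c e]|e]; rewrite e in slope *.
- rewrite h0; have hs := affine_sum (index_enum 'I_(K - 2)) (P := xpredT) (fun c _ => hn c).
  exists (k0 - \sum_c n c); have h := affineD (@affine_scalar R J k0) (affineN hs).
  apply: (affine_ext h) => l; rewrite add0r slope pos_firstE pos_wt_first mulrN1.
  by rewrite sum_sgn.
- rewrite hm; exists (km + d c - n (rev_ord c)).
  have h := affineD (affineD (@affine_scalar R J km) (hd c)) (affineN (hn (rev_ord c))).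
  by apply: (affine_ext h) => l; rewrite add0r slope pos_wt_mid !sgn_at mulrBr.
rewrite h1; have hs := affine_sum (index_enum 'I_(K - 2)) (P := xpredT) (fun c _ => hd c).
exists (k1 + \sum_c d c); have h := affineD (@affine_scalar R J k1) hs.
apply: (affine_ext h) => l; rewrite add0r slope pos_lastE pos_wt_last mulr1.
by rewrite sum_sgn.
Qed.

Let twist_diag t : exists2 c : C, c != 0 & diag_op (bd_twist hK b k t th) c lamT.
Proof.
have [c c0 hc] := twist_diagonal th (twist_affine t); exists c => //.
suff <- : (fun l : J => \prod_i expC (th i) ^
    (sgn l * (vec_wt (sigma (val l)) i - vec_wt (sigma first) i))) = lamT by [].
apply/funext => l.
have h : \prod_i tau i ^ (vec_wt (sigma (val l)) i - vec_wt (sigma first) i) = lam1 l.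
  rewrite lam1E /vv /vec_val -prodf_div; apply: eq_bigr => i _.
  by rewrite expfzDr // -invr_expz.
transitivity (\prod_i (tau i ^ (vec_wt (sigma (val l)) i - vec_wt (sigma first) i)) ^ sgn l).
  by apply: eq_bigr => i _; rewrite exprz_exp mulrC.
rewrite /lamT /sgn /osc_sign /in_labels; case: ifP => _.
  by rewrite -h -prodfV; apply: eq_bigr => i _; rewrite exprN1.
by rewrite -h; apply: eq_bigr => i _; rewrite expr1z.
Qed.

Let p2_hom l : homogeneous (lam12 lam1 lam2) (weight (fun j => (lam1 j)^-1) l) (p2 l).
Proof.
have <- : lam2 = (fun j => (lam1 j)^-1) by apply/funext.
exact: right_homogeneous.
Qed.

Theorem bd_factorisation N t x (u := x - 1 + t / 2%:R + K%:R / 4%:R)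
    (v := x - t / 2%:R - K%:R / 4%:R) :
  bd_T_cvg hK N b k t x th /\
  bd_T hK N b k t x th = bd_ch hK b k t th *:
    (bd_Q hK N b k u (tau_of th) *m bd_Q hK N (~~ b) k v (tau_of th)).
Proof.
have [c c0 dW] := twist_diag t.
have rT (E' : algType C) (ell' : bool * J -> E') y z :
  related_mx (ph_letter R (in_labels flip)) ell'
    (castmx (bd_dim hK, bd_dim hK)
      (lax3 (half_dim R K) y z (row (ph_bar R S flip)) (col (ph_ann R S flip))))
    (castmx (bd_dim hK, bd_dim hK)
      (lax3 (half_dim R K) y z (row (extend_letter ell' true)) (col (extend_letter ell' false)))).
  apply: related_cast; apply: related_lax3 => i j; rewrite !mxE.
    by rewrite ph_barE; apply: related_extend.
  by rewrite ph_annE; apply: related_extend.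
have rQ (E' : algType C) (ell' : bool * J -> E') y :
  related_mx (ph_letter R (pred0 : pred J)) ell'
    (castmx (bd_dim hK, bd_dim hK)
      (deg3 (half_dim R K) y (row (osc_bar R S)) (col (osc_ann R S))))
    (castmx (bd_dim hK, bd_dim hK)
      (deg3 (half_dim R K) y (row (extend_letter ell' true)) (col (extend_letter ell' false)))).
  apply: related_cast; apply: related_deg3 => i j; rewrite !mxE.
    by rewrite osc_barE; apply: related_extend.
  by rewrite osc_annE; apply: related_extend.
have eval_k : eval_lax (bd_laxk hK b k t) x = scal_mx _ B *m
    castmx (bd_dim hK, bd_dim hK)
      (lax3 (half_dim R K) u v (row (ph_bar R S flip)) (col (ph_ann R S flip)))
    *m scal_mx _ (invmx B).
  rewrite /bd_laxk eval_conj_lax; congr (_ *m _ *m _); exact: bd_lax_eval.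
split.
  have h := conj_related B (rT E mixed u v).
  rewrite -eval_k in h; exact: (transfer_cvg_related N dW lamT_lt1 h).
have cT : continues (ph_letter R (in_labels flip)) lam1
    (fun X => trace (bd_twist hK b k t th * X)) (trace (bd_twist hK b k t th)).
  have <- : ph_weight lamT (in_labels flip) = lam1 by apply/funext.
  exact: (trace_continues dW lamT_lt1 lamT_neq0).
have rU : related_mx del (fun=> 0 : C^o)
    (castmx (bd_dim hK, bd_dim hK) (up3 (row ext_del))) 1%:M.
  have -> : (1%:M : 'M[C^o]_K) = castmx (bd_dim hK, bd_dim hK) (up3 0).
    rewrite up3_0; symmetry; apply: castmx_sqP => i j.
    by rewrite !mxE (inj_eq (@cast_ord_inj _ _ _)).
  apply: related_cast; apply: related_up3 => i j; rewrite !mxE /ext_del.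
  case: (insub (mid j)) => [l|] /=; last exact: related0.
  exact: (related_letter del (fun=> 0 : C^o)).
have fact := mixed_factorisation lam1_neq0 lam1_neq1 lam2_neq0 lam2_neq1
  (left_letter_ccr lam1 lam2) (right_letter_ccr lam1 lam2)
  (left_right_comm lam1 lam2) (left_homogeneous lam2 lam1_neq0 lam1_neq1) p2_hom
  (fun=> mul1r 1) lam1_neq1
  (bd_ntrace_continues (bd_tau_neq0 b) lam1_neq1)
  (bd_ntrace_continues (bd_tau_neq0 (~~ b)) lam2_neq1) cT N.
rewrite /bd_T /bd_Q /bd_Q1 /transfer /qop !bd_deg_lax_eval eval_k.
exact: (fact _ _ _ _ _ _ _ _ _ _ _ B_unit.1 B2_unit.1 B_unit.1
  (rQ _ _ _) (rQ _ _ _) (rT _ _ _ _) rU (factor_identity u v)).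
Qed.

End BDFactorisation.

Theorem theorem3 (R : realType) (N : nat) :
  (* (A) gl_n *)
  (forall (n : nat) (a : 'I_n) (I : {set 'I_n}) (t x : R[i])
      (th : 'I_n -> R[i]),
    (1 < n)%N -> (0 < a)%N -> #|I| = a -> gl_domain th ->
    gl_T_cvg N a I t x th /\
    gl_T N a I t x th =
      gl_ch a I t th *:
        (gl_Q N I (x + t) (tau_of th) *m
         gl_Q N (~: I) (x - (nat_of_ord a)%:R) (tau_of th)))
  /\
  (* (C) sp_2r *)
  (forall (r : nat) (mu : 'I_r -> int) (t x : R[i]) (th : 'I_r -> R[i]),
    (0 < r)%N -> (forall i, mu i = 1 \/ mu i = -1) -> cl_domain th ->
    sp_T_cvg N mu t x th /\
    sp_T N mu t x th =
      sp_ch mu t th *: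
        (sp_Q N mu (x + t) (tau_of th) *m
         sp_Q N (fun i => - mu i) (x - t - r%:R - 1) (tau_of th)))
  /\
  (* (D, spinorial) so_2r *)
  (forall (r : nat) (mu : 'I_r -> int) (t x : R[i]) (th : 'I_r -> R[i]),
    (1 < r)%N -> (forall i, mu i = 1 \/ mu i = -1) -> cl_domain th ->
    so_T_cvg N mu t x th /\
    so_T N mu t x th =
      so_ch mu t th *:
        (so_Q N mu (x + t) (tau_of th) *m
         so_Q N (fun i => - mu i) (x - t - r%:R + 1) (tau_of th)))
  /\
  (* (BD, first fundamental) so_K; the indices k and k' are (false, k) and
     (true, k) *)
  (forall (K : nat) (hK : (4 < K)%N) (k : 'I_(K./2)) (t x : R[i])
      (th : 'I_(K./2) -> R[i]),
    cl_domain th ->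
    let u := x - 1 + t / 2%:R + K%:R / 4%:R in
    let v := x - t / 2%:R - K%:R / 4%:R in
    (bd_T_cvg hK N false k t x th /\
     bd_T hK N false k t x th =
       bd_ch hK false k t th *:
         (bd_Q hK N false k u (tau_of th) *m bd_Q hK N true k v (tau_of th)))
    /\
    (bd_T_cvg hK N true k t x th /\
     bd_T hK N true k t x th =
       bd_ch hK true k t th *:
         (bd_Q hK N true k u (tau_of th) *m bd_Q hK N false k v (tau_of th)))).
Proof.
split; [|split; [|split]].
- by move=> n a I t x th _ _ cardI dom; exact: gl_factorisation.
- move=> r mu t x th _ muP dom.
  have [h1 h2] := classical_factorisation true muP dom N t x.
  split; first exact: h1.
  have e : x - t - r%:R - 1 = x - t - cd_kap R r true by rewrite /cd_kap opprD addrA.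
  rewrite e; exact: h2.
- move=> r mu t x th _ muP dom.
  have [h1 h2] := classical_factorisation false muP dom N t x.
  split; first exact: h1.
  have e : x - t - r%:R + 1 = x - t - cd_kap R r false.
    by rewrite /cd_kap opprB addrA addrAC.
  rewrite e; exact: h2.
move=> K hK k t x th dom; split.
  exact: (bd_factorisation hK false k dom N t x).
exact: (bd_factorisation hK true k dom N t x).
Qed.
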